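(* (Schwartz–Zippel Lemma in $\mathsf{S^1_2}$.) The theory $\mathsf{S^1_2}$ proves the following: for all $n,d,q \in \mathrm{Log}$ and all $P \in \mathrm{Ckt}(n,d)$, either $P \equiv 0$ (i.e., $P(\overline{a}) = 0$ for all $\overline{a} \in \mathbb{Z}^n$), or for every $\overline{a} = (a_1,\ldots,a_n) \in \mathbb{Z}^n$ with $P(\overline{a}) \neq 0$, the function $\mathrm{dec}_{P,\overline{a}} : C_{n,d,q} \to S_q^n$ is surjective onto $Z_{P,q}$ and inverts $\mathrm{enc}_{P,\overline{a}}$ on $Z_{P,q}$: for every $\overline{b} \in Z_{P,q}$, $\mathrm{dec}_{P,\overline{a}}(\mathrm{enc}_{P,\overline{a}}(\overline{b})) = \overline{b}$.
   Context: $\mathsf{S^1_2}$ denotes Buss's bounded arithmetic theory $\mathsf{S^1_2}$ extended with a symbol for every polynomial-time function ($\mathsf{PV}$) and their defining equations; integers (sign-magnitude), tuples and circuits are coded by natural numbers. $\mathrm{Log}$ is the class of binary lengths $|x|$. An algebraic circuit over $\mathbb{Z}$ is a straight-line program with variable inputs, parameter inputs (with plugged integer constants), $+$ and $\times$ gates. The syntactic individual degree of a gate on an input $u$ (variable or parameter) is 1 for the input gate labelled $u$, 0 for other input gates, the max of the operands for $+$, and the sum for $\times$; $\mathrm{Ckt}(n,d)$ is the set of algebraic circuits with at most $n$ indeterminates and maximum syntactic individual degree (over variables and parameters) at most $d$. $S_q = \{0,\ldots,q-1\}\subseteq\mathbb{Z}$, $Z_{P,q} = \{\overline{u} \in S_q^n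 : P(\overline{u}) = 0\}$, $C_{n,d,q} = [n]\times[d]\times S_q^{n-1}$ with $[k]=\{1,\ldots,k\}$. The polynomial-time function $\mathrm{enc}_{P,\overline{a}}(\overline{b})$ (with $d,q$ in unary, $\overline{b}\in S_q^n$): if not ($P(\overline{a}) \neq 0$ and $P(\overline{b}) = 0$), output $(1,1,\overline{0})$; otherwise find the least $k \in [n]$ with $P(b_1,\ldots,b_{k-1},a_k,\ldots,a_n) \neq 0$ and $P(b_1,\ldots,b_k,a_{k+1},\ldots,a_n) = 0$, let $Q(\mathrm{x}) = P(b_1,\ldots,b_{k-1},\mathrm{x},a_{k+1},\ldots,a_n)$, find the position $i$ of $b_k$ in the increasing list of roots of $Q$ in $S_q$; if $i > d$ output $(1,1,\overline{0})$, else output $(k,i,b_1,\ldots,b_{k-1},b_{k+1},\ldots,b_n)$. The polynomial-time function $\mathrm{dec}_{P,\overline{a}}(k,i,\overline{c})$ with $\overline{c}=(c_1,\ldots,c_{n-1})$: if $P(\overline{a}) = 0$ output $\overline{0}\in S_q^n$; otherwise let $G(\mathrm{x}) = P(c_1,\ldots,c_{k-1},\mathrm{x},a_{k+1},\ldots,a_n)$; if $G$ has fewer than $i$ roots in $S_q$ output $\overline{0}$; else with $r$ the $i$-th smallest root of $G$ in $S_q$, output $(c_1,\ldots,c_{k-1},r,c_k,\ldots,c_{n-1})$. *)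

(* Defs.v *)
From mathcomp Require Import all_boot.

Set Implicit Arguments.
Unset Strict Implicit.
Unset Printing Implicit Defensive.

(* Cobham's function algebra over Buss's base functions.  Every polynomial-time
   function has a symbol.  [pv_limrec g h0 h1 k] is recursion on notation on the
   first argument, limited by [k]; its defining equations (see [S12]) take the
   minimum with [k] at every step, so no side condition on the bound is needed. *)
Inductive pv : nat -> Type :=
| pv_zero  : pv 0
| pv_succ  : pv 1
| pv_half  : pv 1                 (* floor (x / 2) *)
| pv_len   : pv 1                 (* |x|, the binary length *)
| pv_add   : pv 2
| pv_mul   : pv 2
| pv_smash : pv 2                 (* x # y = 2 ^ (|x| * |y|) *)
| pv_proj n (i : 'I_n) : pv n
| pv_comp m n (f : pv m) (gs : 'I_m -> pv n) : pv n
| pv_limrec n (g : pv n) (h0 h1 : pv n.+2) (k : pv n.+1) : pv n.+1.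

(* De Bruijn indices: [Var 0] is bound by the innermost quantifier. *)
Inductive term : Type :=
| Var (i : nat)
| App n (f : pv n) (ts : 'I_n -> term).

Definition app n (f : pv n) (ts : n.-tuple term) : term := App f (tnth ts).

Inductive form : Type :=
| Bot
| Eq (s t : term)
| Le (s t : term)
| Imp (A B : form)
| And (A B : form)
| Or (A B : form)
| All (A : form)
| Ex (A : form).

Definition Neg (A : form) : form := Imp A Bot.

Fixpoint tsubst (s : nat -> term) (t : term) : term :=
  match t with
  | Var i => s i
  | App n f ts => App f (fun i => tsubst s (ts i))
  end.

Definition tshift : term -> term := tsubst (fun i => Var i.+1).

Definition up (s : nat -> term) (i : nat) : term :=
  if i is j.+1 then tshift (s j) else Var 0.

Fixpoint subst (s : nat -> term) (A : form) : form :=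
  match A with
  | Bot => Bot
  | Eq t u => Eq (tsubst s t) (tsubst s u)
  | Le t u => Le (tsubst s t) (tsubst s u)
  | Imp B C => Imp (subst s B) (subst s C)
  | And B C => And (subst s B) (subst s C)
  | Or B C => Or (subst s B) (subst s C)
  | All B => All (subst (up s) B)
  | Ex B => Ex (subst (up s) B)
  end.

Definition shift : form -> form := subst (fun i => Var i.+1).

Definition inst (t : term) : form -> form :=
  subst (fun i => if i is j.+1 then Var j else t).

(* Replaces variable 0 by [t], which may itself mention variable 0; the other
   variables are unchanged. *)
Definition repl0 (t : term) : form -> form :=
  subst (fun i => if i is _.+1 then Var i else t).

(* Axioms in [T] may have free variables and then count as
   universally closed. *)
Inductive proves (T : form -> Prop) : seq form -> form -> Prop :=
| p_ax G A : T A -> proves T G A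
| p_hyp G A : proves T (A :: G) A
| p_weak G A B : proves T G A -> proves T (B :: G) A
| p_impI G A B : proves T (A :: G) B -> proves T G (Imp A B)
| p_impE G A B : proves T G (Imp A B) -> proves T G A -> proves T G B
| p_andI G A B : proves T G A -> proves T G B -> proves T G (And A B)
| p_andE1 G A B : proves T G (And A B) -> proves T G A
| p_andE2 G A B : proves T G (And A B) -> proves T G B
| p_orI1 G A B : proves T G A -> proves T G (Or A B)
| p_orI2 G A B : proves T G B -> proves T G (Or A B)
| p_orE G A B C : proves T G (Or A B) ->
    proves T (A :: G) C -> proves T (B :: G) C -> proves T G C
| p_allI G A : proves T (map shift G) A -> proves T G (All A)
| p_allE G A t : proves T G (All A) -> proves T G (inst t A)
| p_exI G A t : proves T G (inst t A) -> proves T G (Ex A)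
| p_exE G A B : proves T G (Ex A) ->
    proves T (A :: map shift G) (shift B) -> proves T G B
| p_contra G A : proves T (Neg A :: G) Bot -> proves T G A
| p_refl G t : proves T G (Eq t t)
| p_eqE G A s t : proves T G (Eq s t) ->
    proves T G (inst s A) -> proves T G (inst t A).

(* An [hform] is a formula awaiting the number of quantifiers above it; a bound
   variable introduced below [l] quantifiers is [Var (k - l.+1)] at depth [k]. *)
Definition hterm : Type := nat -> term.
Definition hform : Type := nat -> form.

Definition tcall n (f : pv n) (ts : n.-tuple hterm) : hterm :=
  fun k => App f (fun i => tnth ts i k).

Definition fbot : hform := fun=> Bot.
Definition feq (s t : hterm) : hform := fun k => Eq (s k) (t k).
Definition fle (s t : hterm) : hform := fun k => Le (s k) (t k).
Definition fimp (A B : hform) : hform := fun k => Imp (A k) (B k).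
Definition fand (A B : hform) : hform := fun k => And (A k) (B k).
Definition for_ (A B : hform) : hform := fun k => Or (A k) (B k).
Definition fneg (A : hform) : hform := fimp A fbot.
Definition fall (A : hterm -> hform) : hform := fun l => All (A (fun k => Var (k - l.+1)) l.+1).
Definition fex (A : hterm -> hform) : hform := fun l => Ex (A (fun k => Var (k - l.+1)) l.+1).

Definition zero : hterm := tcall pv_zero [tuple].
Definition succ (s : hterm) : hterm := tcall pv_succ [tuple s].
Definition half (s : hterm) : hterm := tcall pv_half [tuple s].
Definition len (s : hterm) : hterm := tcall pv_len [tuple s].
Definition add (s t : hterm) : hterm := tcall pv_add [tuple s; t].
Definition mul (s t : hterm) : hterm := tcall pv_mul [tuple s; t].
Definition smash (s t : hterm) : hterm := tcall pv_smash [tuple s; t].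
Definition one : hterm := succ zero.
Definition two : hterm := succ one.
Definition three : hterm := succ two.

Declare Scope fo_scope.
Delimit Scope fo_scope with fo.
Notation "s = t" := (feq s t) : fo_scope.
Notation "s <> t" := (fneg (feq s t)) : fo_scope.
Notation "s <= t" := (fle s t) : fo_scope.
Notation "s < t" := (fle (succ s) t) : fo_scope.
Notation "~ A" := (fneg A) : fo_scope.
Notation "A /\ B" := (fand A B) : fo_scope.
Notation "A \/ B" := (for_ A B) : fo_scope.
Notation "A -> B" := (fimp A B) : fo_scope.
Notation "A <-> B" := (fand (fimp A B) (fimp B A)) : fo_scope.
Notation "s + t" := (add s t) : fo_scope.
Notation "s * t" := (mul s t) : fo_scope.
Notation "s # t" := (smash s t) (at level 40, left associativity) : fo_scope.
Notation "'\all' x .. y , A" := (fall (fun x => .. (fall (fun y => A%fo)) ..))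
  (at level 200, x binder, y binder, right associativity) : fo_scope.
Notation "'\ex' x .. y , A" := (fex (fun x => .. (fex (fun y => A%fo)) ..))
  (at level 200, x binder, y binder, right associativity) : fo_scope.
Local Open Scope fo_scope.

(* Buss's BASIC axioms, in his order. *)
Definition basic : seq hform := [::
  \all x y, y <= x -> y <= succ x;
  \all x, x <> succ x;
  \all x, zero <= x;
  \all x y, (x <= y /\ x <> y) <-> succ x <= y;
  \all x, x <> zero -> two * x <> zero;
  \all x y, y <= x \/ x <= y;
  \all x y, x <= y /\ y <= x -> x = y;
  \all x y z, x <= y /\ y <= z -> x <= z;
  len zero = zero;
  \all x, x <> zero ->
    len (two * x) = succ (len x) /\ len (succ (two * x)) = succ (len x);
  len one = one;
  \all x y, x <= y -> len x <= len y;
  \all x y, len (x # y) = succ (len x * len y);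
  \all x, zero # x = one;
  \all x, x <> zero ->
    one # (two * x) = two * (one # x) /\ one # succ (two * x) = two * (one # x);
  \all x y, x # y = y # x;
  \all x y z, len x = len y -> x # z = y # z;
  \all x y u v, len x = len u + len v -> x # y = (u # y) * (v # y);
  \all x y, x <= x + y;
  \all x y, x <= y /\ x <> y ->
    succ (two * x) <= two * y /\ succ (two * x) <> two * y;
  \all x y, x + y = y + x;
  \all x, x + zero = x;
  \all x y, x + succ y = succ (x + y);
  \all x y z, (x + y) + z = x + (y + z);
  \all x y z, x + y <= x + z <-> y <= z;
  \all x, x * zero = zero;
  \all x y, x * succ y = x * y + x;
  \all x y, x * y = y * x;
  \all x y z, x * (y + z) = x * y + x * z;
  \all x y z, one <= x -> (x * y <= x * z <-> y <= z);
  \all x, x <> zero -> len x = succ (len (half x));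
  \all x y, x = half y <-> (two * x = y \/ succ (two * x) = y)].

Definition All_le (t : term) (A : form) : form := All (Imp (Le (Var 0) (tshift t)) A).
Definition Ex_le (t : term) (A : form) : form := Ex (And (Le (Var 0) (tshift t)) A).

(* [bounded1 true] is Sigma^b_1 and [bounded1 false] is Pi^b_1. *)
Inductive bounded1 : bool -> form -> Prop :=
| b1_bot b : bounded1 b Bot
| b1_eq b s t : bounded1 b (Eq s t)
| b1_le b s t : bounded1 b (Le s t)
| b1_imp b A B : bounded1 (~~ b) A -> bounded1 b B -> bounded1 b (Imp A B)
| b1_and b A B : bounded1 b A -> bounded1 b B -> bounded1 b (And A B)
| b1_or b A B : bounded1 b A -> bounded1 b B -> bounded1 b (Or A B)
| b1_sharp_all b t A : bounded1 b A -> bounded1 b (All_le (app pv_len [tuple t]) A)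
| b1_sharp_ex b t A : bounded1 b A -> bounded1 b (Ex_le (app pv_len [tuple t]) A)
| b1_ex t A : bounded1 true A -> bounded1 true (Ex_le t A)
| b1_all t A : bounded1 false A -> bounded1 false (All_le t A).

Definition tzero : term := app pv_zero [tuple].
Definition tdouble (t : term) : term :=
  app pv_mul [tuple app pv_succ [tuple app pv_succ [tuple tzero]]; t].
Definition tdouble1 (t : term) : term := app pv_succ [tuple tdouble t].

Definition is_min (z x y : term) : form :=
  And (Imp (Le x y) (Eq z x)) (Imp (Neg (Le x y)) (Eq z y)).

Inductive S12 : form -> Prop :=
| S12_basic i : (i < size basic)%N -> S12 (nth fbot basic i 0)
| S12_proj n (i : 'I_n) ts : S12 (Eq (App (pv_proj i) ts) (ts i))
| S12_comp m n (f : pv m) (gs : 'I_m -> pv n) ts :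
    S12 (Eq (App (pv_comp f gs) ts) (App f (fun j => App (gs j) ts)))
| S12_rec0 n (g : pv n) h0 h1 k (ts : n.-tuple term) :
    S12 (is_min (app (pv_limrec g h0 h1 k) [tuple of tzero :: ts])
                (app g ts)
                (app k [tuple of tzero :: ts]))
| S12_rec_even n (g : pv n) h0 h1 k x (ts : n.-tuple term) :
    S12 (Imp (Neg (Eq x tzero))
      (is_min (app (pv_limrec g h0 h1 k) [tuple of tdouble x :: ts])
              (app h0 [tuple of x :: app (pv_limrec g h0 h1 k) [tuple of x :: ts] :: ts])
              (app k [tuple of tdouble x :: ts])))
| S12_rec_odd n (g : pv n) h0 h1 k x (ts : n.-tuple term) :
    S12 (is_min (app (pv_limrec g h0 h1 k) [tuple of tdouble1 x :: ts])
                (app h1 [tuple of x :: app (pv_limrec g h0 h1 k) [tuple of x :: ts] :: ts])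
                (app k [tuple of tdouble1 x :: ts]))
| S12_pind A : bounded1 true A ->
    S12 (Imp (inst tzero A)
      (Imp (All (Imp (repl0 (app pv_half [tuple Var 0]) A) A))
        (All A))).

Definition S12_proves (A : hform) : Prop := proves S12 [::] (A 0).

(* Injective, since x <= x + y and (s + 1) ^ 2 > s ^ 2 + s. *)
Definition cpair (x y : hterm) : hterm := (x + y) * (x + y) + x.

(* A tuple code <c, v> is a string v cut into blocks of |c| bits; [entry w i y]
   says that its i-th block, counting from 1 at the low-order end, is y.
   Here 1 # c = 2 ^ |c| and e # c = 2 ^ (|e| |c|). *)
Definition entry (w i y : hterm) : hform :=
  \ex c v e h l, w = cpair c v /\ i = succ (len e) /\
    v = (h * (one # c) + y) * (e # c) + l /\ l < e # c /\ y < one # c.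

Definition in_range (i t : hterm) : hform := one <= i /\ i <= t.

(* Codes of tuples are not unique: equality of n-tuples is entrywise. *)
Definition tuple_eq (n u v : hterm) : hform :=
  \all i, in_range i n -> \ex y, entry u i y /\ entry v i y.

(* An integer is coded as 2m for m >= 0 and as 2m + 1 for -m < 0; the code 1 of
   "minus zero" is excluded, so every integer has exactly one code. *)
Definition is_int (z : hterm) : hform := z <> one.

(* z is the code of the integer p - m, where p = 0 or m = 0. *)
Definition int_parts (z p m : hterm) : hform :=
  (z = two * p /\ m = zero) \/ (z = succ (two * m) /\ p = zero /\ m <> zero).

Definition int_add (x y z : hterm) : hform :=
  \ex px mx py my pz mz,
    int_parts x px mx /\ int_parts y py my /\ int_parts z pz mz /\
    pz + (mx + my) = (px + py) + mz.

Definition int_mul (x y z : hterm) : hform :=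
  \ex px mx py my pz mz,
    int_parts x px mx /\ int_parts y py my /\ int_parts z pz mz /\
    pz + (px * my + mx * py) = (px * py + mx * my) + mz.

(* Numbers n, d, q in Log are given as n = |N|, d = |D|, q = |Q|. *)

Definition var_gate (i : hterm) : hterm := cpair zero i.
Definition par_gate (i : hterm) : hterm := cpair one i.
Definition add_gate (l r : hterm) : hterm := cpair two (cpair l r).
Definition mul_gate (l r : hterm) : hterm := cpair three (cpair l r).

(* A circuit with gates 1, ..., |e| listed by G (the last one is the output) and
   parameters 1, ..., |f| with plugged constants listed by c.  Several gates may
   carry the same label. *)
Definition circuit_code (e f c G : hterm) : hterm := cpair e (cpair f (cpair c G)).

(* Well-formed circuits whose variables are among x_1, ..., x_|N|. *)
Definition is_circuit (N P : hterm) : hform :=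
  \ex e f c G, P = circuit_code e f c G /\ e <> zero /\
    (\all i, in_range i (len f) -> \ex z, entry c i z /\ is_int z) /\
    (\all j, in_range j (len e) -> \ex g, entry G j g /\
      ((\ex i, in_range i (len N) /\ g = var_gate i) \/
       (\ex i, in_range i (len f) /\ g = par_gate i) \/
       (\ex l r, one <= l /\ l < j /\ one <= r /\ r < j /\
          (g = add_gate l r \/ g = mul_gate l r)))).

(* [run leaf plus times P v]: the output of P gets the value v when input gates
   are evaluated by [leaf c g] (c the list of constants, g the gate label) and
   the others by [plus] and [times].  In the trace w, entry x + 1 stands for
   the value x and entry 0 for "not computed": only the gates that the output
   depends on have to be evaluated. *)
Definition run (leaf : hterm -> hterm -> hterm -> hform) (plus times : hterm -> hterm -> hterm -> hform)
    (P v : hterm) : hform :=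
  \ex e f c G w, P = circuit_code e f c G /\ entry w (len e) (succ v) /\
    \all j x, in_range j (len e) -> entry w j (succ x) ->
      \ex g, entry G j g /\
        (leaf c g x \/
         (\ex l r y z, entry w l (succ y) /\ entry w r (succ z) /\
            ((g = add_gate l r /\ plus y z x) \/
             (g = mul_gate l r /\ times y z x)))).

(* The value of P at the point a (a tuple of integers) is v. *)
Definition eval (P a v : hterm) : hform :=
  run (fun c g x => (\ex i, g = var_gate i /\ entry a i x) \/
                    (\ex i, g = par_gate i /\ entry c i x))
      int_add int_mul P v.

Definition is_max (x y z : hterm) : hform := (z = x /\ y <= x) \/ (z = y /\ x <= y).

(* The syntactic individual degree of (the output gate of) P on the input
   labelled u is v. *)
Definition degree (u P v : hterm) : hform :=
  run (fun _ g x => (\ex i, g = var_gate i \/ g = par_gate i) /\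
                    ((g = u /\ x = one) \/ (g <> u /\ x = zero)))
      is_max (fun x y z => z = x + y) P v.

Definition in_Ckt (N D P : hterm) : hform :=
  is_circuit N P /\
  (\all i, in_range i (len N) -> \ex v, degree (var_gate i) P v /\ v <= len D) /\
  (\ex e f c G, P = circuit_code e f c G /\
    \all i, in_range i (len f) -> \ex v, degree (par_gate i) P v /\ v <= len D).

Definition in_Zn (N a : hterm) : hform :=
  \all i, in_range i (len N) -> \ex z, entry a i z /\ is_int z.

Definition in_S (Q z : hterm) : hform := \ex r, r < len Q /\ z = two * r.

Definition in_Sn (N Q b : hterm) : hform :=
  \all i, in_range i (len N) -> \ex z, entry b i z /\ in_S Q z.

Definition in_ZPq (N Q P b : hterm) : hform := in_Sn N Q b /\ eval P b zero.

Definition triple (k i c : hterm) : hterm := cpair k (cpair i c).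

Definition in_C (N D Q x : hterm) : hform :=
  \ex k i c, x = triple k i c /\ in_range k (len N) /\ in_range i (len D) /\
    \all j, one <= j -> j < len N -> \ex z, entry c j z /\ in_S Q z.

(* h = (b_1, ..., b_{k-1}, z, a_{k+1}, ..., a_n) *)
Definition is_hybrid (N b k z a h : hterm) : hform :=
  \all j, in_range j (len N) -> \ex y, entry h j y /\
    (j < k -> entry b j y) /\ (j = k -> y = z) /\ (k < j -> entry a j y).

(* P(b_1, ..., b_{k-1}, z, a_{k+1}, ..., a_n) = 0 *)
Definition hybrid_zero (N P b k z a : hterm) : hform :=
  \ex h, is_hybrid N b k z a h /\ eval P h zero.

(* w_1 < ... < w_m are the roots in S_q of the univariate polynomial
   P(b_1, ..., b_{k-1}, x, a_{k+1}, ..., a_n). *)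
Definition root_list (N Q P b k a m w : hterm) : hform :=
  m <= len Q /\
  (\all j, in_range j m ->
     \ex z, entry w j z /\ in_S Q z /\ hybrid_zero N P b k z a) /\
  (\all j, one <= j -> j < m ->
     \ex y z, entry w j y /\ entry w (succ j) z /\ y < z) /\
  (\all z, in_S Q z -> hybrid_zero N P b k z a ->
     \ex j, in_range j m /\ entry w j z).

(* P(b_1, ..., b_{k-1}, a_k, ..., a_n) <> 0 and
   P(b_1, ..., b_k, a_{k+1}, ..., a_n) = 0 *)
Definition switch (N P a b k : hterm) : hform :=
  \ex y z, entry a k y /\ entry b k z /\
    ~ hybrid_zero N P b k y a /\ hybrid_zero N P b k z a.

Definition enc_default (N x : hterm) : hform :=
  \ex c, x = triple one one c /\
    \all j, one <= j -> j < len N -> entry c j zero.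

(* c = (b_1, ..., b_{k-1}, b_{k+1}, ..., b_n) *)
Definition is_delete (N k b c : hterm) : hform :=
  \all j, one <= j -> j < len N -> \ex y, entry c j y /\
    (j < k -> entry b j y) /\ (k <= j -> entry b (succ j) y).

(* y = (c_1, ..., c_{k-1}, r, c_k, ..., c_{n-1}) *)
Definition is_insert (N k r c y : hterm) : hform :=
  \all j, in_range j (len N) -> \ex z, entry y j z /\
    (j < k -> entry c j z) /\ (j = k -> z = r) /\
    (\all i, k < j -> j = succ i -> entry c i z).

Definition is_zero_tuple (N y : hterm) : hform :=
  \all j, in_range j (len N) -> entry y j zero.

(* The defining clauses of x = enc_{P,a}(b). *)
Definition enc_graph (N D Q P a b x : hterm) : hform :=
  (~ (~ eval P a zero /\ eval P b zero) /\ enc_default N x) \/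
  ((~ eval P a zero /\ eval P b zero) /\
   \ex k, in_range k (len N) /\ switch N P a b k /\
     (\all j, one <= j -> j < k -> ~ switch N P a b j) /\
     \ex m w z i, root_list N Q P b k a m w /\
       entry b k z /\ in_range i m /\ entry w i z /\
       ((len D < i /\ enc_default N x) \/
        (i <= len D /\ \ex c, x = triple k i c /\ is_delete N k b c))).

(* The defining clauses of y = dec_{P,a}(k, i, c). *)
Definition dec_graph (N Q P a k i c y : hterm) : hform :=
  (eval P a zero /\ is_zero_tuple N y) \/
  (~ eval P a zero /\
   \ex m w, root_list N Q P c k a m w /\
     ((m < i /\ is_zero_tuple N y) \/
      (i <= m /\ \ex r, entry w i r /\ is_insert N k r c y))).

(* [ev] computes P(a) from N, D, P, a. *)
Definition ev_spec (ev : pv 4) : hform :=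
  \all N D P a, in_Ckt N D P -> in_Zn N a ->
    eval P a (tcall ev [tuple N; D; P; a]).

Definition enc_spec (enc : pv 6) : hform :=
  \all N D Q P a b, in_Ckt N D P -> in_Zn N a -> in_Sn N Q b ->
    enc_graph N D Q P a b (tcall enc [tuple N; D; Q; P; a; b]).

Definition dec_spec (dec : pv 6) : hform :=
  \all N D Q P a k i c, in_Ckt N D P -> in_Zn N a -> in_C N D Q (triple k i c) ->
    dec_graph N Q P a k i c (tcall dec [tuple N; D; Q; P; a; triple k i c]).

(* S_q^n is a possible codomain of [dec] only for q >= 1. *)
Definition schwartz_zippel (enc dec : pv 6) : hform :=
  \all N D Q P, in_Ckt N D P ->
    (\all a, in_Zn N a -> eval P a zero) \/
    (\all a, in_Zn N a -> ~ eval P a zero ->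
      (\all x, in_C N D Q x -> one <= len Q ->
         in_Sn N Q (tcall dec [tuple N; D; Q; P; a; x])) /\
      (\all b, in_ZPq N Q P b ->
         \ex x, in_C N D Q x /\
           tuple_eq (len N) (tcall dec [tuple N; D; Q; P; a; x]) b) /\
      (\all b, in_ZPq N Q P b ->
         in_C N D Q (tcall enc [tuple N; D; Q; P; a; b]) /\
         tuple_eq (len N)
           (tcall dec [tuple N; D; Q; P; a; tcall enc [tuple N; D; Q; P; a; b]]) b)).

(* Main.v *)
(* By completeness it suffices to argue in an arbitrary model of S^1_2, where
   induction up to a length is available for Sigma^b_1 conditions.

   The value of a circuit is computed gate by gate. All values are small: if the
   inputs have length at most l, then the value of a gate has length at most its
   total degree, which is the sum of the individual degrees, times l plus the
   number of gates.

   If P(a) <> 0 = P(b), then replacing the coordinates of a with those of b one by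
   one meets a switch k, and the restriction q of P to the k-th line is not zero
   at a_k. What remains is that q has at most d roots in S_q. Its coefficients are
   not available, but its values are, and x - y divides q(x) - q(y) by induction
   on the gates. Given roots r_1 < ... < r_{d+1} and a large B = 2^|Z|, each B - r_i
   divides q(B). These divisors are coprime up to small factors, so their product
   divides q(B) up to a small factor as well. Its length is about (d + 1)|Z|, whereas
   that of q(B) is at most a constant plus d|Z|; hence q(B) = 0. Then B - y divides
   q(y) for every y, and q(y) = 0 since B is large. *)

From HB Require Import structures.
From mathcomp Require Import all_boot order ssralg ssrnum.
From mathcomp Require Import boolp.
From Stdlib Require Import Ring.
Require Import Defs.

Set Implicit Arguments.
Unset Strict Implicit.
Unset Printing Implicit Defensive.

(* The ring tactic of mathcomp, imported next, does not handle semirings. *)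
Ltac semiring := ring.
From mathcomp Require Import ring lra.

(** * Completeness of the calculus *)

(** Induction is available for Sigma^b_1 conditions only, and this shapes the proof: degrees,
    values, products and root lists are computed by explicit functions with a block size fixed
    beforehand, and quotients and cofactors carry explicit bounds. The degree is bounded at the
    output only, so other gates may have values that are too long; an entry that does not fit counts
    as not computed, and a size bound shows that this does not happen at the output.

    Modulo x = B - r_j the product A of the earlier B - r_i equals F, the product of the r_j - r_i,
    which is nonzero and short. If A U = E q(B) and x divides q(B), then x divides F U, so A x
    divides F E q(B). The small factor thus grows from E to F E, without greatest common divisors.

    In the bound on q(B) the length of the k-th input is multiplied by its individual degree, while
    all other inputs are multiplied by the total degree. The constant part therefore does not depend
    on Z, and |Z| can be chosen last, beyond all error terms. *)

Definition scons (X : Type) (x : X) (s : nat -> X) (i : nat) : X :=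
  if i is j.+1 then s j else x.

Lemma tsubst_id t : tsubst Var t = t.
Proof. by elim: t => //= n f ts IH; congr App; apply/funext. Qed.

Lemma tsubst_comp s s' t : tsubst s (tsubst s' t) = tsubst (tsubst s \o s') t.
Proof. by elim: t => //= n f ts IH; congr App; apply/funext. Qed.

Lemma up_id : up Var = Var.
Proof. by apply/funext => -[]. Qed.

Lemma tshift_up s t : tsubst (up s) (tshift t) = tshift (tsubst s t).
Proof. by rewrite /tshift !tsubst_comp. Qed.

Lemma up_comp s s' : up (tsubst s \o s') = tsubst (up s) \o up s'.
Proof. by apply/funext => -[|i] //=; rewrite tshift_up. Qed.

Lemma subst_id A : subst Var A = A.
Proof.
elim: A => //= [s t|s t|A -> B ->|A -> B ->|A -> B ->|A IH|A IH] //.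
- by rewrite !tsubst_id.
- by rewrite !tsubst_id.
- by rewrite up_id IH.
- by rewrite up_id IH.
Qed.

Lemma subst_comp s s' A : subst s (subst s' A) = subst (tsubst s \o s') A.
Proof.
elim: A s s' => //= [t u|t u|A IA B IB|A IA B IB|A IA B IB|A IH|A IH] s s'.
- by rewrite !tsubst_comp.
- by rewrite !tsubst_comp.
- by rewrite IA IB.
- by rewrite IA IB.
- by rewrite IA IB.
- by rewrite IH up_comp.
- by rewrite IH up_comp.
Qed.

Lemma shift_up s A : subst (up s) (shift A) = shift (subst s A).
Proof. by rewrite /shift !subst_comp; congr subst; apply/funext => i. Qed.

Lemma instE t : inst t = subst (scons t Var).
Proof. by []. Qed.

Lemma inst_up t s A : inst t (subst (up s) A) = subst (scons t s) A.
Proof.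
rewrite instE subst_comp; congr subst; apply/funext => -[|i] //=.
by rewrite /tshift tsubst_comp tsubst_id.
Qed.

Lemma subst_inst s t A : subst s (inst t A) = inst (tsubst s t) (subst (up s) A).
Proof. by rewrite inst_up instE subst_comp; congr subst; apply/funext => -[]. Qed.

(** * Substitution and weakening in derivations *)

Definition substitutive (T : form -> Prop) := forall A s, T A -> T (subst s A).

(** Axioms may have free variables, so [T] itself has to be closed under substitution. The use is
    the renaming of a fresh variable in the Henkin construction. *)
Lemma proves_subst T G A : substitutive T -> proves T G A ->
  forall s, proves T (map (subst s) G) (subst s A).
Proof.
move=> clT; elim=> {G A} /=.
- by move=> G A TA s; apply/p_ax/clT.
- by move=> G A s; apply: p_hyp.
- by move=> G A B _ IH s; apply: p_weak.
- by move=> G A B _ IH s; apply: p_impI.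
- by move=> G A B _ IH _ IH' s; apply: p_impE (IH s) (IH' s).
- by move=> G A B _ IH _ IH' s; apply: p_andI (IH s) (IH' s).
- by move=> G A B _ IH s; apply: p_andE1 (IH s).
- by move=> G A B _ IH s; apply: p_andE2 (IH s).
- by move=> G A B _ IH s; apply: p_orI1 (IH s).
- by move=> G A B _ IH s; apply: p_orI2 (IH s).
- by move=> G A B C _ IH _ IH1 _ IH2 s; apply: p_orE (IH s) (IH1 s) (IH2 s).
- move=> G A _ IH s; apply: p_allI.
  by have := IH (up s); rewrite -!map_comp; under eq_map do rewrite /= shift_up.
- by move=> G A t _ IH s; rewrite subst_inst; apply: p_allE (IH s).
- by move=> G A t _ IH s; apply: (@p_exI _ _ _ (tsubst s t)); rewrite -subst_inst.
- move=> G A B _ IH _ IH' s; apply: p_exE (IH s) _.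
  rewrite -shift_up; have := IH' (up s); rewrite -!map_comp.
  by under eq_map do rewrite /= shift_up.
- by move=> G A _ IH s; apply: p_contra (IH s).
- by move=> G t s; apply: p_refl.
- move=> G A t u _ IH _ IH' s; rewrite subst_inst; apply: p_eqE (IH s) _.
  by rewrite -subst_inst.
Qed.

(** Derivations from two stages of the Henkin construction have to be moved to a common stage;
    [p_weak] adds one formula at the head only. *)
Lemma proves_weaken T G A : proves T G A ->
  forall G', (forall B, List.In B G -> List.In B G') -> proves T G' A.
Proof.
have hyp B G' : List.In B G' -> proves T G' B.
  elim: G' => //= C G' IH [->|/IH]; [exact: p_hyp | exact: p_weak].
have sub_cons B (G1 G2 : seq form) : (forall C, List.In C G1 -> List.In C G2) ->
    forall C, List.In C (B :: G1) -> List.In C (B :: G2).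
  by move=> sG C /= [->|/sG]; [left | right].
have sub_map (f : form -> form) (G1 G2 : seq form) :
    (forall C, List.In C G1 -> List.In C G2) ->
    forall C, List.In C (map f G1) -> List.In C (map f G2).
  by move=> sG C /List.in_map_iff[D [<- /sG inD]]; apply: List.in_map.
elim=> {G A}.
- by move=> G A TA G' _; apply: p_ax.
- by move=> G A G' sG; apply/hyp/sG; left.
- by move=> G A B _ IH G' sG; apply: IH => C inC; apply: sG; right.
- by move=> G A B _ IH G' sG; apply/p_impI/IH/sub_cons.
- by move=> G A B _ IH _ IH' G' sG; apply: p_impE (IH _ sG) (IH' _ sG).
- by move=> G A B _ IH _ IH' G' sG; apply: p_andI (IH _ sG) (IH' _ sG).
- by move=> G A B _ IH G' sG; apply: p_andE1 (IH _ sG).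
- by move=> G A B _ IH G' sG; apply: p_andE2 (IH _ sG).
- by move=> G A B _ IH G' sG; apply: p_orI1 (IH _ sG).
- by move=> G A B _ IH G' sG; apply: p_orI2 (IH _ sG).
- move=> G A B C _ IH _ IH1 _ IH2 G' sG.
  by apply: p_orE (IH _ sG) (IH1 _ _) (IH2 _ _); apply: sub_cons.
- by move=> G A _ IH G' sG; apply/p_allI/IH/sub_map.
- by move=> G A t _ IH G' sG; apply: p_allE (IH _ sG).
- by move=> G A t _ IH G' sG; apply: p_exI (IH _ sG).
- move=> G A B _ IH _ IH' G' sG; apply: p_exE (IH _ sG) (IH' _ _).
  exact/sub_cons/sub_map.
- by move=> G A _ IH G' sG; apply: p_contra (IH _ _); apply: sub_cons.
- by move=> G t G' _; apply: p_refl.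
- by move=> G A t u _ IH _ IH' G' sG; apply: p_eqE (IH _ sG) (IH' _ sG).
Qed.

(** A form of the condition that all variables lie below [N] which can be applied to substitutions
    directly. *)
Definition tbounded N t :=
  forall s s', (forall i, i < N -> s i = s' i) -> tsubst s t = tsubst s' t.
Definition fbounded N A :=
  forall s s', (forall i, i < N -> s i = s' i) -> subst s A = subst s' A.

Lemma tbounded_ex t : exists N, tbounded N t.
Proof.
elim: t => [i|n f ts IH]; first by exists i.+1 => s s'; apply.
have [N HN] := choice IH; exists (\max_(i < n) N i) => s s' ss'.
congr App; apply/funext => i; apply: HN => j jN; apply/ss'/(leq_trans jN).
exact: (leq_bigmax i).
Qed.

Lemma fbounded_le N N' A : N <= N' -> fbounded N A -> fbounded N' A.
Proof. by move=> le bA s s' ss'; apply: bA => i iN; apply/ss'/(leq_trans iN). Qed.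

Lemma up_eq N s s' : (forall i, i < N -> s i = s' i) ->
  forall i, i < N.+1 -> up s i = up s' i.
Proof. by move=> ss' [|i] //=; rewrite ltnS => /ss' ->. Qed.

Lemma fbounded_ex A : exists N, fbounded N A.
Proof.
have two (C : form -> form -> form) B B' :
    (forall s, subst s (C B B') = C (subst s B) (subst s B')) ->
    (exists N, fbounded N B) -> (exists N, fbounded N B') ->
    exists N, fbounded N (C B B').
  move=> CE [N bB] [N' bB']; exists (maxn N N') => s s' ss'; rewrite !CE.
  by rewrite (bB s s') ?(bB' s s') // => i iN; apply: ss';
    rewrite leq_max iN ?orbT.
have twot (C : term -> term -> form) t u :
    (forall s, subst s (C t u) = C (tsubst s t) (tsubst s u)) ->
    exists N, fbounded N (C t u).
  move=> CE; have [N bt] := tbounded_ex t; have [N' bu] := tbounded_ex u.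
  exists (maxn N N') => s s' ss'; rewrite !CE.
  by rewrite (bt s s') ?(bu s s') // => i iN; apply: ss';
    rewrite leq_max iN ?orbT.
elim: A => [|s t|s t|A IA B IB|A IA B IB|A IA B IB|A [N bA]|A [N bA]].
- by exists 0.
- exact: twot.
- exact: twot.
- exact: two.
- exact: two.
- exact: two.
- by exists N => s s' ss' /=; congr All; apply: bA => i iN; apply: up_eq ss' _ _; rewrite ltnW.
- by exists N => s s' ss' /=; congr Ex; apply: bA => i iN; apply: up_eq ss' _ _; rewrite ltnW.
Qed.

Lemma context_bounded_ex (G : seq form) : exists N, forall A, List.In A G -> fbounded N A.
Proof.
elim: G => [|A G [N bG]]; first by exists 0.
have [N' bA] := fbounded_ex A; exists (maxn N N') => B /= [<-|/bG].
  by apply: fbounded_le bA; rewrite leq_maxr.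
by apply: fbounded_le; rewrite leq_maxl.
Qed.

(* Renaming the fresh variable [N] to [0] and every other [i] to [i.+1] turns a
   refutation from the witness instance into the premise of [p_exE]. *)
Lemma henkin_consistent T G A N : substitutive T ->
  (forall B, List.In B (Ex A :: G) -> fbounded N B) ->
  proves T (inst (Var N) A :: Ex A :: G) Bot -> proves T (Ex A :: G) Bot.
Proof.
move=> clT bG pr; apply: p_exE (p_hyp _ _ _) _.
set r := fun i => if i == N then Var 0 else Var i.+1.
have rE B : List.In B (Ex A :: G) -> subst r B = shift B.
  by move=> /bG; apply=> i iN; rewrite /r ltn_eqF.
have mapE (H : seq form) : (forall B, List.In B H -> List.In B (Ex A :: G)) ->
    map (subst r) H = map shift H.
  elim: H => //= B H IH sH; rewrite (rE B) ?IH //; first by move=> C inC; apply: sH; right.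
  by apply: sH; left.
have := proves_subst clT pr r; rewrite map_cons mapE // subst_inst /r /= eqxx.
suff -> : inst (Var 0) (subst (up r) A) = A by [].
have [bEx] : subst r (Ex A) = shift (Ex A) by apply: rE; left.
rewrite bEx inst_up -[RHS]subst_id; congr subst; apply/funext => -[|i] //.
Qed.

(** * Enumeration of the formulas *)

Section Encoding.

Local Notation tree := (GenTree.tree nat).

(** The arity is part of the code, so that symbols of different arities have different codes. *)
Fixpoint pv_code n (f : pv n) : tree :=
  let code := fun k l => GenTree.Node k [:: GenTree.Node 0 l; GenTree.Leaf n] in
  match f with
  | pv_zero => code 1 [::]
  | pv_succ => code 2 [::]
  | pv_half => code 3 [::]
  | pv_len => code 4 [::]
  | pv_add => code 5 [::]
  | pv_mul => code 6 [::]
  | pv_smash => code 7 [::]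
  | pv_proj n i => code 8 [:: GenTree.Leaf (val i)]
  | pv_comp m n f gs =>
      code 9 [:: pv_code f; GenTree.Node 0 [seq pv_code (gs i) | i <- enum 'I_m]; GenTree.Leaf m]
  | pv_limrec n g h0 h1 k =>
      code 10 [:: pv_code g; pv_code h0; pv_code h1; pv_code k]
  end.

Lemma enum_inj m (X : Type) (c : 'I_m -> X) (d : 'I_m -> X) :
  [seq c i | i <- enum 'I_m] = [seq d i | i <- enum 'I_m] -> forall i, c i = d i.
Proof.
move=> E i; have := congr1 (fun s => nth (c i) s i) E => /=.
by rewrite (nth_map i) ?(nth_map i (c i)) ?size_enum_ord //; rewrite nth_ord_enum.
Qed.

Lemma nat_inj_pair2 (P : nat -> Type) n (x y : P n) : existT P n x = existT P n y -> x = y.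
Proof. by apply: Eqdep_dec.inj_pair2_eq_dec => k l; case: (eqVneq k l) => [|/eqP]; [left | right]. Qed.

Lemma pv_code_inj n (f g : pv n) : pv_code f = pv_code g -> f = g.
Proof.
(* The induction compares [f] with symbols of arbitrary arity, so equality is stated between
   dependent pairs. *)
suff gen m (h : pv m) : pv_code f = pv_code h -> existT pv n f = existT pv m h.
  by move=> E; apply: (@nat_inj_pair2 pv); apply: gen.
elim: n / f m h {g} => [||||||||m n f IHf gs IHgs|n g IHg h0 IH0 h1 IH1 k IHk] /=.
1-7: by move=> m; case.
- move=> n i m; case=> // n' j /= [Ei En]; subst n'.
  by congr (existT _ _ (pv_proj _)); apply: val_inj.
- move=> m' h; case: m' / h => // m2 n2 f' gs' /= [Ef Egs Em En]; subst n2 m2.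
  rewrite (@nat_inj_pair2 pv _ _ _ (IHf _ _ Ef)); congr (existT _ _ (pv_comp _ _)).
  by apply/funext => i; apply: (@nat_inj_pair2 pv); apply: (IHgs i _ _ _); apply: enum_inj Egs i.
- move=> m' h; case: m' / h => // n2 g' h0' h1' k' /= [Eg E0 E1 Ek En]; subst n2.
  rewrite (@nat_inj_pair2 pv _ _ _ (IHg _ _ Eg)) (@nat_inj_pair2 pv _ _ _ (IH0 _ _ E0)).
  by rewrite (@nat_inj_pair2 pv _ _ _ (IH1 _ _ E1)) (@nat_inj_pair2 pv _ _ _ (IHk _ _ Ek)).
Qed.

Fixpoint term_code (t : term) : tree :=
  match t with
  | Var i => GenTree.Leaf i
  | App n f ts =>
      GenTree.Node n [:: pv_code f; GenTree.Node 0 [seq term_code (ts i) | i <- enum 'I_n]]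
  end.

Lemma term_code_inj : injective term_code.
Proof.
elim=> [i|n f ts IH] [j|m g us] //=; first by case=> ->.
case=> En; subst m => /pv_code_inj -> /enum_inj E.
by congr App; apply/funext => i; apply: IH.
Qed.

Fixpoint form_code (A : form) : tree :=
  match A with
  | Bot => GenTree.Node 0 [::]
  | Eq t u => GenTree.Node 1 [:: term_code t; term_code u]
  | Le t u => GenTree.Node 2 [:: term_code t; term_code u]
  | Imp B C => GenTree.Node 3 [:: form_code B; form_code C]
  | And B C => GenTree.Node 4 [:: form_code B; form_code C]
  | Or B C => GenTree.Node 5 [:: form_code B; form_code C]
  | All B => GenTree.Node 6 [:: form_code B]
  | Ex B => GenTree.Node 7 [:: form_code B]
  end.

Lemma form_code_inj : injective form_code.
Proof.
elim=> [|s t|s t|A IA B IB|A IA B IB|A IA B IB|A IA|A IA] [|s' t'|s' t'|A' B'|A' B'|A' B'|A'|A'] //=.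
1,2: by case=> /term_code_inj -> /term_code_inj ->.
1-3: by case=> /IA -> /IB ->.
all: by case=> /IA ->.
Qed.

Definition form_of_nat (k : nat) : form :=
  if pselect (exists A, pickle (form_code A) = k) is left ex then projT1 (cid ex) else Bot.

Lemma form_of_nat_surj A : exists k, form_of_nat k = A.
Proof.
exists (pickle (form_code A)); rewrite /form_of_nat; case: pselect => [ex|[]]; last by exists A.
by case: cid => B /= /(pcan_inj pickleK) /form_code_inj.
Qed.

End Encoding.

(** * Quotients by an equivalence relation *)

Section Quotient.

Variables (T : Type) (R : T -> T -> Prop).

(** Used twice: for terms modulo derivable equality and for the integers of a model as formal
    differences. *)
Definition quot := {P : T -> Prop | exists x, P = R x}.
Definition class (x : T) : quot := exist _ (R x) (ex_intro _ x erefl).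
Definition repr (q : quot) : T := projT1 (cid (proj2_sig q)).

Lemma class_repr q : class (repr q) = q.
Proof. by case: q => P ex; apply: eq_exist; rewrite /repr /=; case: cid. Qed.

Hypotheses (R_refl : forall x, R x x) (R_sym : forall x y, R x y -> R y x)
  (R_trans : forall x y z, R x y -> R y z -> R x z).

Lemma class_eq x y : class x = class y <-> R x y.
Proof.
split=> [[->] //|xy]; apply: eq_exist; apply/funext => z; apply/propext.
by split; apply: R_trans; [apply: R_sym|].
Qed.

End Quotient.

(** * Structures and the Henkin model *)

Record struct := Struct {
  carrier :> Type;
  interp : forall n, pv n -> ('I_n -> carrier) -> carrier;
  lep : carrier -> carrier -> Prop }.

Fixpoint eval_term (S : struct) (r : nat -> S) (t : term) : S :=
  match t with
  | Var i => r i
  | App n f ts => interp f (fun i => eval_term r (ts i))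
  end.

Fixpoint sat (S : struct) (r : nat -> S) (A : form) : Prop :=
  match A with
  | Bot => False
  | Eq t u => eval_term r t = eval_term r u
  | Le t u => lep (eval_term r t) (eval_term r u)
  | Imp B C => sat r B -> sat r C
  | And B C => sat r B /\ sat r C
  | Or B C => sat r B \/ sat r C
  | All B => forall x, sat (scons x r) B
  | Ex B => exists x, sat (scons x r) B
  end.

Section Henkin.

Variables (T : form -> Prop) (A0 : form).
Hypothesis clT : substitutive T.
Hypothesis unprovable : ~ proves T [::] A0.

Definition consistent G := ~ proves T G Bot.

(** Variables serve as Henkin constants. A stage is a finite list, so some variable is fresh for it
    and the language need not be extended. *)
Definition witness (A : form) (G : seq form) : seq form :=
  if A is Ex B then
    let N := projT1 (cid (context_bounded_ex (A :: G))) in inst (Var N) B :: A :: G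
  else A :: G.

Fixpoint stage k : seq form :=
  if k is k'.+1 then
    let A := form_of_nat k' in
    if pselect (consistent (A :: stage k')) is left _ then witness A (stage k') else stage k'
  else [:: Neg A0].

Lemma stage_consistent k : consistent (stage k).
Proof.
elim: k => [|k IH] /=; first by move=> pr; apply/unprovable/p_contra.
case: pselect => // con; rewrite /witness; case E: (form_of_nat k) con => [|??|??|??|??|??|?|A] //.
by case: cid => N bN /= con /(henkin_consistent clT bN).
Qed.

Lemma stage_le k l A : k <= l -> List.In A (stage k) -> List.In A (stage l).
Proof.
move=> /subnK <-; elim: (l - k) => //= m IH /IH {}IH; case: pselect => // _.
by rewrite /witness; case: form_of_nat => [|??|??|??|??|??|?|?]; right => //; right.
Qed.

Definition derives A := exists k, proves T (stage k) A.

Lemma derives_mono k l A : k <= l -> proves T (stage k) A -> proves T (stage l) A.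
Proof. by move=> kl pr; apply: proves_weaken pr _ _ => B; apply: stage_le. Qed.

Lemma derives2 A B C : (forall G, proves T G A -> proves T G B -> proves T G C) ->
  derives A -> derives B -> derives C.
Proof.
move=> rule [k kA] [l lB]; exists (maxn k l).
by apply: rule; [apply: derives_mono kA | apply: derives_mono lB]; rewrite ?leq_maxl ?leq_maxr.
Qed.

Lemma derives1 A C : (forall G, proves T G A -> proves T G C) -> derives A -> derives C.
Proof. by move=> rule [k kA]; exists k; apply: rule. Qed.

Lemma derives_bot : ~ derives Bot.
Proof. by case=> k; apply: stage_consistent. Qed.

Lemma derives_ax A : T A -> derives A.
Proof. by move=> TA; exists 0; apply: p_ax. Qed.

Lemma derives_A0 : derives (Neg A0).
Proof. by exists 0; apply: p_hyp. Qed.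

Lemma in_derives k A : List.In A (stage k) -> derives A.
Proof.
move=> inA; exists k; apply: (proves_weaken (p_hyp T [::] A)) => B /= [<-|//].
exact: inA.
Qed.

(** Maximality: the enumeration reaches [A] at some stage, where [A] either joins or is refuted. *)
Lemma derives_Neg A : derives (Neg A) <-> ~ derives A.
Proof.
split=> [dN dA|ndA]; first by apply/derives_bot/(derives2 _ dN dA) => G; apply: p_impE.
have [k kA] := form_of_nat_surj A; have [con|] := EM (consistent (A :: stage k)).
  case: ndA; apply: (@in_derives k.+1); rewrite /= kA; case: pselect => // _.
  by rewrite /witness; case: (A) => [|??|??|??|??|??|?|?]; rewrite /=; auto.
by move=> /contrapT pr; exists k; apply: p_impI.
Qed.

Lemma derives_Imp A B : derives (Imp A B) <-> (derives A -> derives B).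
Proof.
split=> [dI dA|AB]; first by apply: derives2 dI dA => G; apply: p_impE.
have [/AB [k kB]|/derives_Neg] := EM (derives A).
  by exists k; apply/p_impI/p_weak.
apply: derives1 => G pN; apply/p_impI/p_contra/p_weak.
by apply: p_impE (p_weak _ pN) (p_hyp _ _ _).
Qed.

Lemma derives_And A B : derives (And A B) <-> derives A /\ derives B.
Proof.
split=> [d|[dA dB]]; last by apply: derives2 dA dB => G; apply: p_andI.
by split; apply: derives1 d => G; [apply: p_andE1 | apply: p_andE2].
Qed.

Lemma derives_Or A B : derives (Or A B) <-> derives A \/ derives B.
Proof.
split=> [d|[]]; last 2 first.
- by apply: derives1 => G; apply: p_orI1.
- by apply: derives1 => G; apply: p_orI2.
have [|ndA] := EM (derives A); [by left | right].
move/derives_Neg in ndA; apply: (derives2 _ d ndA) => G pO pN; apply: p_orE pO _ (p_hyp _ _ _).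
by apply/p_contra/p_weak/(p_impE (p_weak _ pN))/p_hyp.
Qed.

(** A derivable [Ex A] is consistent with every stage, in particular with the one that examines it,
    and so it enters together with its witness. *)
Lemma derives_Ex A : derives (Ex A) <-> exists t, derives (inst t A).
Proof.
split=> [d|[t]]; last by apply: derives1 => G; apply: p_exI.
have [k kA] := form_of_nat_surj (Ex A).
have con : consistent (Ex A :: stage k).
  move=> pr; apply/derives_bot/(derives2 _ (_ : derives (Neg (Ex A))) d).
    by move=> G; apply: p_impE.
  by exists k; apply: p_impI.
pose N := projT1 (cid (context_bounded_ex (Ex A :: stage k))).
exists (Var N); apply: (@in_derives k.+1); rewrite /= kA; case: pselect => // _.
by left.
Qed.

Lemma derives_All A : derives (All A) <-> forall t, derives (inst t A).
Proof.
split=> [d t|all]; first by apply: derives1 d => G; apply: p_allE.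
apply: contrapT => /derives_Neg nd.
(* A universal formula that is not derivable is refuted, and its counterexample has a Henkin
   witness. *)
suff /derives_Ex [t dN] : derives (Ex (Neg A)) by apply: (proj1 (derives_Neg (inst t A)) dN).
apply: derives1 nd => G pN; apply: p_contra.
apply: p_impE (p_weak _ pN) _; apply/p_allI/p_contra.
apply: (@p_impE _ _ (shift (Ex (Neg A)))); first by apply/p_weak/p_hyp.
apply: (@p_exI _ _ _ (Var 0)); rewrite -[Imp _ _]/(subst (up (fun i => Var i.+1)) (Neg A)) inst_up.
suff -> : scons (Var 0) (fun i => Var i.+1) = Var by rewrite subst_id; apply: p_hyp.
by apply/funext => -[].
Qed.

Definition teq (t u : term) := derives (Eq t u).

Lemma derives_eqE A t u : teq t u -> derives (inst t A) -> derives (inst u A).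
Proof. by apply: derives2 => G; apply: p_eqE. Qed.

Lemma teq_refl t : teq t t.
Proof. by exists 0; apply: p_refl. Qed.

Lemma tshift_scons t u : tsubst (scons t Var) (tshift u) = u.
Proof. by rewrite /tshift tsubst_comp tsubst_id. Qed.

Lemma teq_sym t u : teq t u -> teq u t.
Proof.
move=> tu; have := @derives_eqE (Eq (Var 0) (tshift t)) _ _ tu.
by rewrite !instE /= !tshift_scons; apply; apply: teq_refl.
Qed.

Lemma teq_trans t u v : teq t u -> teq u v -> teq t v.
Proof.
move=> tu uv; have := @derives_eqE (Eq (tshift t) (Var 0)) _ _ uv.
by rewrite !instE /= !tshift_scons; apply.
Qed.

Lemma teq_App n (f : pv n) ts us : (forall i, teq (ts i) (us i)) -> teq (App f ts) (App f us).
Proof.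
(* The rule [p_eqE] replaces one variable, so the arguments are exchanged one at a time; in [mix k]
   the first k are done. *)
move=> tus; pose mix k i := if (i : 'I_n) < k then us i else ts i.
suff H k : k <= n -> teq (App f ts) (App f (mix k)).
  have -> : us = mix n by apply/funext => i; rewrite /mix ltn_ord.
  exact: H.
elim: k => [_|k IH kn]; first exact: teq_refl.
pose j := Ordinal kn; apply: teq_trans (IH (ltnW kn)) _.
pose A := Eq (tshift (App f (mix k))) (App f (fun i => if i == j then Var 0 else tshift (mix k i))).
have instA t : inst t A = Eq (App f (mix k)) (App f (fun i => if i == j then t else mix k i)).
  rewrite instE; congr Eq; first exact: tshift_scons.
  by congr App; apply/funext => i; case: eqP => _; [| exact: tshift_scons].
have := @derives_eqE A _ _ (tus j); rewrite !instA.
have -> : (fun i => if i == j then ts j else mix k i) = mix k.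
  by apply/funext => i; case: eqP => // ->; rewrite /mix /= ltnn.
have -> : (fun i => if i == j then us j else mix k i) = mix k.+1.
  apply/funext => i; rewrite /mix ltnS [i <= k]leq_eqVlt -[_ == k]/(i == j).
  by case: eqP => [->|].
by apply; apply: teq_refl.
Qed.

Lemma derives_Le t t' u u' : teq t t' -> teq u u' -> derives (Le t u) -> derives (Le t' u').
Proof.
move=> tt' uu' d; have := @derives_eqE (Le (Var 0) (tshift u)) _ _ tt'.
rewrite !instE /= !tshift_scons => /(_ d) {}d.
have := @derives_eqE (Le (tshift t') (Var 0)) _ _ uu'.
by rewrite !instE /= !tshift_scons => /(_ d).
Qed.

Let class_eqT := class_eq teq_refl teq_sym teq_trans.

Definition term_struct : struct :=
  @Struct (quot teq) (fun n f xs => class teq (App f (fun i => repr (xs i))))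
    (fun x y => derives (Le (repr x) (repr y))).

Lemma teq_repr t : teq t (repr (class teq t)).
Proof. by apply/class_eqT; rewrite class_repr. Qed.

Definition tclass (t : term) : term_struct := class teq t.

Lemma tclass_eq t u : tclass t = tclass u <-> teq t u.
Proof. exact: class_eqT. Qed.

Lemma tclass_repr x : tclass (repr x) = x.
Proof. exact: class_repr. Qed.

Lemma eval_term_tclass (s : nat -> term) t :
  eval_term (S := term_struct) (fun i => tclass (s i)) t = tclass (tsubst s t).
Proof.
elim: t => //= n f ts IH; apply/tclass_eq/teq_App => i.
by rewrite IH /=; apply/teq_sym/teq_repr.
Qed.

Lemma scons_class t s : scons (tclass t) (fun i => tclass (s i)) = fun i => tclass (scons t s i).
Proof. by apply/funext => -[]. Qed.

Lemma truth A : forall s,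
  sat (S := term_struct) (fun i => tclass (s i)) A <-> derives (subst s A).
Proof.
elim: A => [|t u|t u|A IA B IB|A IA B IB|A IA B IB|A IA|A IA] s /=.
- by split=> // /derives_bot.
- by rewrite !eval_term_tclass tclass_eq.
- rewrite !eval_term_tclass /=; split; apply: derives_Le; try exact: teq_repr;
  by apply/teq_sym/teq_repr.
- by rewrite derives_Imp IA IB.
- by rewrite derives_And IA IB.
- by rewrite derives_Or IA IB.
- rewrite derives_All; split=> [all t|all x].
    by rewrite inst_up -IA -scons_class.
  by rewrite -(tclass_repr x) scons_class IA -inst_up.
- rewrite derives_Ex; split=> [[x]|[t]].
    by rewrite -(tclass_repr x) scons_class IA -inst_up; exists (repr x).
  by rewrite inst_up -IA -scons_class; exists (tclass t).
Qed.

Lemma henkin_model : exists S : struct,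
  (forall A, T A -> forall r, sat (S := S) r A) /\ exists r, ~ sat (S := S) r A0.
Proof.
exists term_struct; split=> [A TA r|].
  have -> : r = fun i => tclass (repr (r i)) by apply/funext => i; rewrite tclass_repr.
  exact/truth/derives_ax/clT.
exists (fun i => tclass (Var i)) => /truth; rewrite subst_id.
by apply/derives_Neg/derives_A0.
Qed.

End Henkin.

Theorem completeness (T : form -> Prop) A : substitutive T ->
  (forall S : struct, (forall B, T B -> forall r, sat (S := S) r B) -> forall r, sat (S := S) r A) ->
  proves T [::] A.
Proof.
move=> clT valid; apply: contrapT => /(henkin_model clT)[S [modelS [r]]]; apply.
exact: valid.
Qed.

(** * Closure of the axioms of S^1_2 under substitution *)

Lemma tsubst_app s n (f : pv n) (ts : n.-tuple term) :
  tsubst s (app f ts) = app f (map_tuple (tsubst s) ts).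
Proof. by congr App; apply/funext => i; rewrite tnth_map. Qed.

Fixpoint tclosed k t : Prop :=
  match t with
  | Var i => i < k
  | App n f ts => forall i, tclosed k (ts i)
  end.

Fixpoint fclosed k A : Prop :=
  match A with
  | Bot => True
  | Eq t u | Le t u => tclosed k t /\ tclosed k u
  | Imp B C | And B C | Or B C => fclosed k B /\ fclosed k C
  | All B | Ex B => fclosed k.+1 B
  end.

Lemma tclosed_subst k t s : (forall i, i < k -> s i = Var i) -> tclosed k t -> tsubst s t = t.
Proof.
move=> sk; elim: t => [i /sk //|n f ts IH /= ct].
by congr App; apply/funext => i; apply: IH.
Qed.

Lemma fclosed_subst k A s : (forall i, i < k -> s i = Var i) -> fclosed k A -> subst s A = A.
Proof.
elim: A k s => [|t u|t u|A IA B IB|A IA B IB|A IA B IB|A IA|A IA] k s sk //=.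
1,2: by case=> ct cu; rewrite !(tclosed_subst sk).
1-3: by case=> cA cB; rewrite (IA k) ?(IB k).
all: by move=> cA; rewrite (IA k.+1) // => -[|i] //=; rewrite ltnS => /sk ->.
Qed.

Lemma tclosed_call k n (f : pv n) (ts : n.-tuple hterm) l :
  foldr (fun h P => tclosed k (h l) /\ P) True ts -> tclosed k (tcall f ts l).
Proof.
move=> all i; have : i < size ts by rewrite size_tuple.
rewrite (tnth_nth (fun=> Var 0)); move: (val i) => {}i.
by elim: (val ts) i all => /= [|h hs IH] [|i] /= ; rewrite ?ltn0 //; [case | case=> _; exact: IH].
Qed.

Lemma basic_closed i : i < size basic -> fclosed 0 (nth fbot basic i 0).
Proof.
do 32 (case: i => [_|i]; first
  by cbn [nth basic fclosed fall fex fimp feq fle fand for_ fneg fbot];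
     repeat first [split | apply: tclosed_call; cbn [foldr tval]]).
by [].
Qed.

Lemma bounded1_subst b A : bounded1 b A -> forall s, bounded1 b (subst s A).
Proof.
have all_le s t B : subst s (All_le t B) = All_le (tsubst s t) (subst (up s) B).
  by rewrite /All_le /= tshift_up.
have ex_le s t B : subst s (Ex_le t B) = Ex_le (tsubst s t) (subst (up s) B).
  by rewrite /Ex_le /= tshift_up.
have len1 s t : tsubst s (app pv_len [tuple t]) = app pv_len [tuple tsubst s t].
  by rewrite tsubst_app; congr app; apply: val_inj.
elim=> {b A} [b|b t u|b t u|b A B _ IA _ IB|b A B _ IA _ IB|b A B _ IA _ IB|b t A _ IA|b t A _ IA|t A _ IA|t A _ IA] s;
  rewrite ?all_le ?ex_le ?len1; by constructor.
Qed.

Lemma S12_subst : substitutive S12.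
Proof.
have is_minE s z x y : subst s (is_min z x y) = is_min (tsubst s z) (tsubst s x) (tsubst s y) by [].
have tup n (x y : n.-tuple term) (f : pv n) : tval x = tval y -> app f x = app f y.
  by move=> E; congr app; apply: val_inj.
have app0 s f : tsubst s (app f [tuple]) = app f [tuple].
  by rewrite tsubst_app; apply: tup.
have app1 s f x : tsubst s (app f [tuple x]) = app f [tuple tsubst s x].
  by rewrite tsubst_app; apply: tup.
have app2 s f x y : tsubst s (app f [tuple x; y]) = app f [tuple tsubst s x; tsubst s y].
  by rewrite tsubst_app; apply: tup.
have z s : tsubst s tzero = tzero by rewrite app0.
have dbl s t : tsubst s (tdouble t) = tdouble (tsubst s t).
  by rewrite /tdouble app2 !app1 z.
have dbl1 s t : tsubst s (tdouble1 t) = tdouble1 (tsubst s t).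
  by rewrite /tdouble1 app1 dbl.
have appS n (f : pv n.+1) s x (ts : n.-tuple term) :
    tsubst s (app f [tuple of x :: ts]) = app f [tuple of tsubst s x :: map_tuple (tsubst s) ts].
  by rewrite tsubst_app; apply: tup.
have appSS n (f : pv n.+2) s x y (ts : n.-tuple term) :
    tsubst s (app f [tuple of x :: y :: ts])
    = app f [tuple of tsubst s x :: tsubst s y :: map_tuple (tsubst s) ts].
  by rewrite tsubst_app; apply: tup.
move=> A s; case=> {A} [i /[dup] lt /basic_closed cl|n i ts|m n f gs ts|n g h0 h1 k ts|n g h0 h1 k x ts|n g h0 h1 k x ts|A bA].
- by rewrite (fclosed_subst _ cl) //; constructor.
- exact: (S12_proj i (fun j => tsubst s (ts j))).
- exact: (S12_comp f gs (fun j => tsubst s (ts j))).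
- rewrite is_minE !appS tsubst_app z; exact: S12_rec0.
- rewrite -[subst _ _]/(Imp (Neg (Eq (tsubst s x) (tsubst s tzero))) (subst s (is_min _ _ _))).
  rewrite is_minE z; move: (tdouble x) (dbl s x) => y dy; rewrite !appSS !appS dy.
  exact: S12_rec_even.
- rewrite is_minE; move: (tdouble1 x) (dbl1 s x) => y dy; rewrite !appSS !appS dy.
  exact: S12_rec_odd.
rewrite -[subst _ _]/(Imp (subst s (inst tzero A)) (Imp (All (Imp (subst (up s) (repl0 _ A)) (subst (up s) A)))
  (All (subst (up s) A)))) subst_inst z.
set B := subst (up s) A; suff -> : subst (up s) (repl0 (app pv_half [tuple Var 0]) A)
    = repl0 (app pv_half [tuple Var 0]) B.
  by apply: S12_pind; apply: bounded1_subst.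
rewrite /repl0 /B !subst_comp; congr subst; apply/funext => -[|i].
  exact: app1.
by rewrite [RHS]/= /tshift tsubst_comp.
Qed.

(** * Models of S^1_2 *)

Record model := Model {
  mstruct :> struct;
  modelP : forall A, S12 A -> forall r, sat (S := mstruct) r A }.

Section Model.

Variable M : model.
Implicit Types (x y z : M) (s : seq M).

Definition m0 : M :=
  interp (s := M) pv_zero (fun i : 'I_0 => False_rect M (match i with Ordinal m lt => notF lt end)).

(** Argument lists in place of functions on ['I_n] can be simplified by computation; missing
    arguments count as 0. *)
Definition ap n (f : pv n) (s : seq M) : M := interp f (fun i => nth m0 s i).

Definition msucc x := ap pv_succ [:: x].
Definition mhalf x := ap pv_half [:: x].
Definition mlen x := ap pv_len [:: x].
Definition madd x y := ap pv_add [:: x; y].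
Definition mmul x y := ap pv_mul [:: x; y].
Definition msmash x y := ap pv_smash [:: x; y].

Lemma interp_ap n (f : pv n) (xs : 'I_n -> M) s :
  (forall i : 'I_n, nth m0 s i = xs i) -> interp f xs = ap f s.
Proof. by move=> E; congr interp; apply/funext. Qed.

(* A higher-order term or formula of Defs is read at the depth [size r] at which
   it occurs, where [r] lists the values of the enclosing quantified variables,
   innermost first; a term has to keep its value below further quantifiers. *)
Variable env : nat -> M.

Definition senv (r : seq M) : nat -> M := foldr (@scons M) env r.

Definition TD (h : hterm) (r : seq M) x :=
  forall r', eval_term (senv (r' ++ r)) (h (size (r' ++ r))) = x.

Fixpoint TDs (hs : seq hterm) (r : seq M) s : Prop :=
  match hs, s with
  | [::], [::] => True
  | h :: hs, x :: s => TD h r x /\ TDs hs r s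
  | _, _ => False
  end.

Definition FD (A : hform) (r : seq M) (X : Prop) := sat (senv r) (A (size r)) <-> X.

Lemma scons_nth x r : scons x (nth m0 r) = nth m0 (x :: r).
Proof. by apply/funext => -[]. Qed.

Lemma TD_cons h r x y : TD h r x -> TD h (y :: r) x.
Proof. by move=> hx r'; have := hx (rcons r' y); rewrite cat_rcons. Qed.

Lemma TD_var r x : TD (fun k => Var (k - (size r).+1)) (x :: r) x.
Proof. by move=> r'; rewrite /= size_cat addnK; elim: r'. Qed.

Lemma TD_call n (f : pv n) (hs : n.-tuple hterm) r s :
  TDs hs r s -> TD (tcall f hs) r (ap f s).
Proof.
move=> hx r' /=; apply: interp_ap => i.
rewrite (tnth_nth (fun=> Var 0)); have : i < size hs by rewrite size_tuple.
move: (val i) => {}i; elim: (val hs) s i hx => [|h hs' IH] [|x s] [|i] //= [hx hs_].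
  by rewrite hx.
exact: IH.
Qed.

Lemma TD_zero r : TD zero r m0.
Proof. by move=> r' /=; congr interp; apply/funext => -[]. Qed.

Lemma TD_succ h r x : TD h r x -> TD (succ h) r (msucc x).
Proof. by move=> hx; apply: TD_call. Qed.
Lemma TD_half h r x : TD h r x -> TD (half h) r (mhalf x).
Proof. by move=> hx; apply: TD_call. Qed.
Lemma TD_len h r x : TD h r x -> TD (len h) r (mlen x).
Proof. by move=> hx; apply: TD_call. Qed.
Lemma TD_add h k r x y : TD h r x -> TD k r y -> TD (add h k) r (madd x y).
Proof. by move=> hx ky; apply: TD_call. Qed.
Lemma TD_mul h k r x y : TD h r x -> TD k r y -> TD (mul h k) r (mmul x y).
Proof. by move=> hx ky; apply: TD_call. Qed.
Lemma TD_smash h k r x y : TD h r x -> TD k r y -> TD (smash h k) r (msmash x y).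
Proof. by move=> hx ky; apply: TD_call. Qed.

Lemma FD_bot r : FD fbot r False.
Proof. by []. Qed.
Lemma FD_eq h k r x y : TD h r x -> TD k r y -> FD (feq h k) r (x = y).
Proof. by move=> /(_ [::]) hx /(_ [::]) ky; rewrite /FD /= hx ky. Qed.
Lemma FD_le h k r x y : TD h r x -> TD k r y -> FD (fle h k) r (lep x y).
Proof. by move=> /(_ [::]) hx /(_ [::]) ky; rewrite /FD /= hx ky. Qed.
Lemma FD_imp A B r X Y : FD A r X -> FD B r Y -> FD (fimp A B) r (X -> Y).
Proof. by rewrite /FD /= => -> ->. Qed.
Lemma FD_neg A r X : FD A r X -> FD (fneg A) r (~ X).
Proof. by rewrite /FD /= => ->. Qed.
Lemma FD_and A B r X Y : FD A r X -> FD B r Y -> FD (fand A B) r (X /\ Y).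
Proof. by rewrite /FD /= => -> ->. Qed.
Lemma FD_or A B r X Y : FD A r X -> FD B r Y -> FD (for_ A B) r (X \/ Y).
Proof. by rewrite /FD /= => -> ->. Qed.
Lemma FD_all A r (X : M -> Prop) :
  (forall x h, TD h (x :: r) x -> FD (A h) (x :: r) (X x)) -> FD (fall A) r (forall x, X x).
Proof.
move=> AX; rewrite /FD /=; split=> H x; first by apply/AX; [exact: TD_var | exact: H].
by apply/(AX x _ (@TD_var r x)).
Qed.
Lemma FD_ex A r (X : M -> Prop) :
  (forall x h, TD h (x :: r) x -> FD (A h) (x :: r) (X x)) -> FD (fex A) r (exists x, X x).
Proof.
move=> AX; rewrite /FD /=; split=> -[x H]; exists x; first by apply/AX; [exact: TD_var | exact: H].
by apply/(AX x _ (@TD_var r x)).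
Qed.

End Model.

Arguments m0 {M}.
Arguments TD_cons {M env h r x y}.

Ltac td := solve [repeat first
  [ assumption | simple apply TD_zero | simple apply TD_succ | simple apply TD_half
  | simple apply TD_len | simple apply TD_add | simple apply TD_mul | simple apply TD_smash
  | progress unfold one, two, three
  | simple apply TD_cons ]].

Create HintDb fd.
Ltac fd := repeat first
  [ simple apply FD_bot | simple apply FD_eq; [td|td] | simple apply FD_le; [td|td]
  | solve [auto 1 with fd nocore]
  | simple apply FD_neg | simple apply FD_imp | simple apply FD_and
  | simple apply FD_or | simple apply FD_all; intros ? ? ? | simple apply FD_ex; intros ? ? ? ].

Declare Scope m_scope.
Delimit Scope m_scope with m.
Bind Scope m_scope with carrier.
Notation "x <= y" := (lep x y) : m_scope.
Notation "x < y" := (lep (msucc x) y) : m_scope.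
Notation "x + y" := (madd x y) : m_scope.
Notation "x * y" := (mmul x y) : m_scope.
Notation "x # y" := (msmash x y) : m_scope.
Notation "0" := m0 : m_scope.
Notation "1" := (msucc m0) : m_scope.
Notation "2" := (msucc (msucc m0)) : m_scope.
Notation "3" := (msucc (msucc (msucc m0))) : m_scope.
Notation "x .+1" := (msucc x) : m_scope.

(** * The BASIC axioms in a model *)

Section Basic.

Local Open Scope m_scope.
Variable M : model.
Implicit Types (x y z u v : M).

Lemma basicP i (X : Prop) : (i < size basic)%N -> FD (M := M) (fun=> m0) (nth fbot basic i) [::] X -> X.
Proof. by move=> lt [H _]; apply: H; apply: modelP; constructor. Qed.

Ltac revert_ms := repeat match goal with x : carrier _ |- _ => revert x end.
Ltac basic i :=
  revert_ms; apply: (@basicP i) => //; cbn [nth basic]; fd.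

Lemma leS y x : y <= x -> y <= x.+1.
Proof. move: x y; basic 0%N. Qed.
Lemma le0m x : 0 <= x.
Proof. basic 2%N. Qed.
Lemma ltmP x y : (x <= y /\ x <> y -> x < y) /\ (x < y -> x <= y /\ x <> y).
Proof. move: x y; basic 3%N. Qed.
Lemma mul2_neq0 x : x <> 0 -> 2 * x <> 0.
Proof. basic 4%N. Qed.
Lemma lem_total x y : y <= x \/ x <= y.
Proof. move: x y; basic 5%N. Qed.
Lemma lem_anti x y : x <= y /\ y <= x -> x = y.
Proof. move: x y; basic 6%N. Qed.
Lemma lem_trans' x y z : x <= y /\ y <= z -> x <= z.
Proof. move: x y z; basic 7%N. Qed.
Lemma len0 : mlen 0 = 0 :> M.
Proof. basic 8%N. Qed.
Lemma len_double x : x <> 0 -> mlen (2 * x) = (mlen x).+1 /\ mlen (2 * x).+1 = (mlen x).+1.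
Proof. basic 9%N. Qed.
Lemma len1 : mlen 1 = 1 :> M.
Proof. basic 10%N. Qed.
Lemma le_len x y : x <= y -> mlen x <= mlen y.
Proof. move: x y; basic 11%N. Qed.
Lemma len_smash x y : mlen (x # y) = (mlen x * mlen y).+1.
Proof. move: x y; basic 12%N. Qed.
Lemma smash0x x : 0 # x = 1.
Proof. basic 13%N. Qed.
Lemma smash1_double x : x <> 0 -> 1 # (2 * x) = 2 * (1 # x) /\ 1 # (2 * x).+1 = 2 * (1 # x).
Proof. basic 14%N. Qed.
Lemma smashC x y : x # y = y # x.
Proof. move: x y; basic 15%N. Qed.
Lemma smash_eql x y z : mlen x = mlen y -> x # z = y # z.
Proof. move: x y z; basic 16%N. Qed.
Lemma smash_addl x y u v : mlen x = mlen u + mlen v -> x # y = (u # y) * (v # y).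
Proof. move: x y u v; basic 17%N. Qed.
Lemma lem_addr x y : x <= x + y.
Proof. move: x y; basic 18%N. Qed.
Lemma maddC x y : x + y = y + x.
Proof. move: x y; basic 20%N. Qed.
Lemma maddx0 x : x + 0 = x.
Proof. basic 21%N. Qed.
Lemma maddxS x y : x + y.+1 = (x + y).+1.
Proof. move: x y; basic 22%N. Qed.
Lemma maddA x y z : (x + y) + z = x + (y + z).
Proof. move: x y z; basic 23%N. Qed.
Lemma lem_add2l x y z : (x + y <= x + z -> y <= z) /\ (y <= z -> x + y <= x + z).
Proof. move: x y z; basic 24%N. Qed.
Lemma mmulx0 x : x * 0 = 0.
Proof. basic 25%N. Qed.
Lemma mmulxS x y : x * y.+1 = x * y + x.
Proof. move: x y; basic 26%N. Qed.
Lemma mmulC x y : x * y = y * x.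
Proof. move: x y; basic 27%N. Qed.
Lemma mmulDr x y z : x * (y + z) = x * y + x * z.
Proof. move: x y z; basic 28%N. Qed.
Lemma lem_mul2l x y z : 1 <= x -> (x * y <= x * z -> y <= z) /\ (y <= z -> x * y <= x * z).
Proof. move: x y z; basic 29%N. Qed.
Lemma len_half x : x <> 0 -> mlen x = (mlen (mhalf x)).+1.
Proof. basic 30%N. Qed.
Lemma halfP x y : (x = mhalf y -> 2 * x = y \/ (2 * x).+1 = y) /\
  (2 * x = y \/ (2 * x).+1 = y -> x = mhalf y).
Proof. move: x y; basic 31%N. Qed.

End Basic.

(** * Definable conditions and induction *)

Section Definable.

Variables (M : model) (ps : seq M).

Lemma eval_tsubst r s t : eval_term (S := M) r (tsubst s t) = eval_term (fun i => eval_term r (s i)) t.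
Proof. by elim: t => //= n f ts IH; congr interp; apply/funext. Qed.

Lemma eval_up (x : M) r s :
  (fun i => eval_term (scons x r) (up s i)) = scons x (fun i => eval_term r (s i)).
Proof. by apply/funext => -[|i] //=; rewrite eval_tsubst. Qed.

Lemma sat_subst s A : forall r, sat (S := M) r (subst s A) <-> sat (fun i => eval_term r (s i)) A.
Proof.
elim: A s => [|t u|t u|A IA B IB|A IA B IB|A IA B IB|A IA|A IA] s r /=; rewrite ?eval_tsubst //.
1-3: by rewrite IA IB.
- by split=> H x; move: (H x); rewrite IA eval_up.
- by split=> -[x H]; exists x; move: H; rewrite IA eval_up.
Qed.

(** Bound variables as nested pairs, the innermost last, so that a condition is an ordinary function
    of them and can be found by unification. *)
Fixpoint ctx k : Type := if k is k'.+1 then (ctx k' * M)%type else unit.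
Fixpoint flat k : ctx k -> seq M :=
  if k is k'.+1 return ctx k -> seq M then fun c => c.2 :: flat c.1 else fun=> [::].

Lemma size_flat k (c : ctx k) : size (flat c) = k.
Proof. by elim: k c => //= k IH [c x] /=; rewrite IH. Qed.

Definition DefT k (T : ctx k -> M) :=
  exists t, forall c, eval_term (nth m0 (flat c ++ ps)) t = T c.
Definition DefL k (L : ctx k -> seq M) :=
  exists ts, forall c, map (eval_term (nth m0 (flat c ++ ps))) ts = L c.
(** Induction in a model is licensed by a formula. [Def true] says that a condition is Sigma^b_1
    with parameters [ps], and [Def false] that it is Pi^b_1; the tactic [def] finds the formula from
    the shape of the condition. *)
Definition Def b k (X : ctx k -> Prop) :=
  exists A, bounded1 b A /\ forall c, sat (nth m0 (flat c ++ ps)) A <-> X c.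

Lemma DefT_const j k : DefT (fun _ : ctx k => nth m0 ps j).
Proof. by exists (Var (k + j)) => c; rewrite /= nth_cat size_flat ltnNge leq_addr addKn. Qed.

Lemma DefT_var k : DefT (fun c : ctx k.+1 => c.2).
Proof. by exists (Var 0) => -[]. Qed.

Lemma DefT_lift k (T : ctx k -> M) : DefT T -> DefT (fun c : ctx k.+1 => T c.1).
Proof. by case=> t H; exists (tshift t) => -[c x]; rewrite eval_tsubst -H. Qed.

Lemma DefT_var1 k : DefT (fun c : ctx k.+2 => c.1.2).
Proof. exact: DefT_lift (@DefT_var k). Qed.
Lemma DefT_var2 k : DefT (fun c : ctx k.+3 => c.1.1.2).
Proof. exact: DefT_lift (@DefT_var1 k). Qed.
Lemma DefT_var3 k : DefT (fun c : ctx k.+4 => c.1.1.1.2).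
Proof. exact: DefT_lift (@DefT_var2 k). Qed.

Lemma eval_zero (r : nat -> M) : eval_term r tzero = m0.
Proof. by congr interp; apply/funext => -[]. Qed.

Lemma DefT_zero k : DefT (fun _ : ctx k => m0).
Proof. by exists tzero => c; apply: eval_zero. Qed.

Lemma DefT_ap k n (f : pv n) (L : ctx k -> seq M) : DefL L -> DefT (fun c => ap f (L c)).
Proof.
case=> ts H; exists (App f (fun i => nth tzero ts i)) => c /=.
apply: interp_ap => i; rewrite -H; case: (ltnP i (size ts)) => lt.
  by rewrite (nth_map tzero).
by rewrite !nth_default ?size_map //; symmetry; apply: eval_zero.
Qed.

Lemma DefL_nil k : DefL (fun _ : ctx k => [::]).
Proof. by exists [::]. Qed.

Lemma DefL_cons k (T : ctx k -> M) L : DefT T -> DefL L -> DefL (fun c => T c :: L c).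
Proof. by case=> t H [ts HL]; exists (t :: ts) => c /=; rewrite H HL. Qed.

Lemma DefL_behead k : DefL (fun _ : ctx k => behead ps).
Proof.
exists (map (fun i => Var (k + i).+1) (iota 0 (size ps).-1)) => c; rewrite -map_comp.
apply: (@eq_from_nth _ m0) => [|i]; rewrite size_map size_iota ?size_behead // => lt.
rewrite (nth_map 0) ?size_iota // nth_iota //= nth_cat size_flat -addnS.
by rewrite ltnNge leq_addr addKn nth_behead.
Qed.

Lemma DefL_params k : DefL (fun _ : ctx k => ps).
Proof.
exists (map (fun i => Var (k + i)) (iota 0 (size ps))) => c; rewrite -map_comp.
apply: (@eq_from_nth _ m0) => [|i]; rewrite size_map size_iota // => lt.
rewrite (nth_map 0) ?size_iota // nth_iota //= nth_cat size_flat.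
by rewrite ltnNge leq_addr addKn.
Qed.

Lemma Def_eq b k (T U : ctx k -> M) : DefT T -> DefT U -> Def b (fun c => T c = U c).
Proof. by case=> t H [u K]; exists (Eq t u); split=> [|c]; [constructor | rewrite /= H K]. Qed.
Lemma Def_le b k (T U : ctx k -> M) : DefT T -> DefT U -> Def b (fun c => lep (T c) (U c)).
Proof. by case=> t H [u K]; exists (Le t u); split=> [|c]; [constructor | rewrite /= H K]. Qed.
Lemma Def_bot b k : Def b (fun _ : ctx k => False).
Proof. by exists Bot; split=> //; constructor. Qed.
Lemma Def_imp b k (X Y : ctx k -> Prop) : Def (~~ b) X -> Def b Y -> Def b (fun c => X c -> Y c).
Proof.
by case=> A [bA H] [B [bB K]]; exists (Imp A B); split=> [|c]; [constructor | rewrite /= H K].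
Qed.
Lemma Def_not b k (X : ctx k -> Prop) : Def (~~ b) X -> Def b (fun c => ~ X c).
Proof. by move=> dX; apply: Def_imp dX (Def_bot _ _). Qed.
Lemma Def_and b k (X Y : ctx k -> Prop) : Def b X -> Def b Y -> Def b (fun c => X c /\ Y c).
Proof.
by case=> A [bA H] [B [bB K]]; exists (And A B); split=> [|c]; [constructor | rewrite /= H K].
Qed.
Lemma Def_or b k (X Y : ctx k -> Prop) : Def b X -> Def b Y -> Def b (fun c => X c \/ Y c).
Proof.
by case=> A [bA H] [B [bB K]]; exists (Or A B); split=> [|c]; [constructor | rewrite /= H K].
Qed.

Lemma sat_All_le (r : nat -> M) t A :
  sat r (All_le t A) <-> forall j, lep j (eval_term r t) -> sat (scons j r) A.
Proof. by split=> H j; have := H j; rewrite /= eval_tsubst. Qed.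

Lemma sat_Ex_le (r : nat -> M) t A :
  sat r (Ex_le t A) <-> exists j, lep j (eval_term r t) /\ sat (scons j r) A.
Proof. by split=> -[j H]; exists j; move: H; rewrite /= eval_tsubst. Qed.

Lemma Def_sall b k (T : ctx k -> M) (Y : ctx k -> M -> Prop) : DefT T ->
  Def b (fun c : ctx k.+1 => Y c.1 c.2) -> Def b (fun c => forall j, lep j (mlen (T c)) -> Y c j).
Proof.
case=> t H [A [bA K]]; exists (All_le (app pv_len [tuple t]) A); split=> [|c]; first by constructor.
have lenE : eval_term (nth m0 (flat c ++ ps)) (app pv_len [tuple t]) = mlen (T c).
  by rewrite /= -H; apply: interp_ap => -[[|]].
rewrite sat_All_le lenE; split=> all j /all.
  by rewrite scons_nth => /(K (c, j)).
by rewrite scons_nth => Yj; apply/(K (c, j)).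
Qed.

Lemma Def_bex k (T : ctx k -> M) (Y : ctx k -> M -> Prop) : DefT T ->
  Def true (fun c : ctx k.+1 => Y c.1 c.2) -> Def true (fun c => exists j, lep j (T c) /\ Y c j).
Proof.
case=> t H [A [bA K]]; exists (Ex_le t A); split=> [|c]; first by constructor.
rewrite sat_Ex_le H; split=> -[j [le Aj]]; exists j; split=> //; move: Aj.
  by rewrite scons_nth => /(K (c, j)).
by rewrite scons_nth => Yj; apply/(K (c, j)).
Qed.

Lemma pind (X : M -> Prop) : Def true (fun c : ctx 1 => X c.2) ->
  X m0 -> (forall x, X (mhalf x) -> X x) -> forall x, X x.
Proof.
case=> A [bA H] X0 Xhalf.
have XE x s : (fun i => eval_term (nth m0 ps) (s i)) = nth m0 (x :: ps) :> (nat -> M) ->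
   sat (nth m0 ps) (subst s A) <-> X x.
  by move=> E; rewrite sat_subst E -(H (tt, x)).
have := modelP (S12_pind bA) (nth m0 ps) => /=.
rewrite {1}/inst sat_subst => /(_ _ _) ind x.
have E0 : (fun i => eval_term (S := M) (nth m0 ps) (if i is j.+1 then Var j else tzero)) = nth m0 (m0 :: ps).
  by apply/funext => -[|i] //; apply: eval_zero.
apply/(H (tt, x)); rewrite -scons_nth; apply: ind => [|y].
  by rewrite E0; apply/(H (tt, m0)).
rewrite /repl0 sat_subst scons_nth => /= Hy; apply/(H (tt, y))/Xhalf/(H (tt, mhalf y)).
move: Hy; congr (sat _ A); apply/funext => -[|i] //=.
by apply: interp_ap => -[[|]].
Qed.

Lemma Def_len (X : M -> Prop) :
  Def true (fun c : ctx 1 => X c.2) -> Def true (fun c : ctx 1 => X (mlen c.2)).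
Proof.
case=> A [bA H]; exists (repl0 (app pv_len [tuple Var 0]) A); split; first exact: bounded1_subst.
move=> [[] x]; rewrite /repl0 sat_subst -(H (tt, mlen x)) /=.
set r := (fun i => _); suff -> : r = nth m0 (mlen x :: ps) by [].
by apply/funext => -[|i] //=; apply: interp_ap => -[[|]].
Qed.

End Definable.

Ltac deft := solve [repeat first
  [ simple apply DefT_var | simple apply DefT_var1 | simple apply DefT_var2 | simple apply DefT_var3
  | simple apply DefT_zero
  | exact (DefT_const _ 0 _) | exact (DefT_const _ 1 _) | exact (DefT_const _ 2 _)
  | exact (DefT_const _ 3 _) | exact (DefT_const _ 4 _) | exact (DefT_const _ 5 _)
  | exact (DefT_const _ 6 _) | exact (DefT_const _ 7 _) | exact (DefT_const _ 8 _)
  | exact (DefT_const _ 9 _) | exact (DefT_const _ 10 _) | exact (DefT_const _ 11 _)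
  | apply DefL_params | exact (DefL_behead _ _) | apply DefT_ap | apply DefL_nil | apply DefL_cons ]].
Ltac def := repeat (cbn beta; first
  [ apply Def_eq; [deft|deft] | apply Def_le; [deft|deft] | apply Def_bot
  | apply Def_and | apply Def_or | apply Def_sall; [deft|] | apply Def_bex; [deft|]
  | apply Def_not | apply Def_imp ]).

(** * Polynomial-time functions *)

Definition pcall m n (f : pv m) (gs : m.-tuple (pv n)) : pv n := pv_comp f (tnth gs).

Definition pzero {n} : pv n := pcall pv_zero [tuple].
(* Only meant for [i < n]. *)
Definition parg n i : pv n := if insub i is Some j then pv_proj j else pzero.
Notation "''p_' i" := (parg _ i) (at level 8, i at level 2, format "''p_' i").
Definition prest k n : n.-tuple (pv (k + n)) := mktuple (fun i => pv_proj (rshift k i)).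

Definition psucc n (f : pv n) : pv n := pcall pv_succ [tuple f].
Definition pone {n} : pv n := psucc pzero.
Definition ptwo {n} : pv n := psucc pone.
Definition pthree {n} : pv n := psucc ptwo.
Definition padd n (f g : pv n) : pv n := pcall pv_add [tuple f; g].
Definition pmul n (f g : pv n) : pv n := pcall pv_mul [tuple f; g].
Definition psmash n (f g : pv n) : pv n := pcall pv_smash [tuple f; g].
Definition phalf n (f : pv n) : pv n := pcall pv_half [tuple f].
Definition plen n (f : pv n) : pv n := pcall pv_len [tuple f].

(** Yields the second argument if the first is 0 and the third otherwise: 0 stands for truth
    throughout. The sum bounds both results. *)
Definition f_cond : pv 3 := pv_limrec 'p_0 'p_3 'p_3 (padd 'p_1 'p_2).
Definition pcond n (t a b : pv n) : pv n := pcall f_cond [tuple t; a; b].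
Definition f_parity : pv 1 := pv_limrec pzero pzero pone pone.
(** Comparison comes from the minimum built into limited recursion: at 0 the base value 'p_0 is
    limited by 'p_2, the second of the two numbers. *)
Definition f_min : pv 2 := pcall (pv_limrec 'p_0 'p_0 'p_0 'p_2) [tuple pzero; 'p_0; 'p_1].
(* u <= v iff the minimum of 2 * u and 2 * v + 1 is even. *)
Definition f_leq : pv 2 :=
  pcall f_parity [tuple pcall f_min [tuple pmul ptwo 'p_0; psucc (pmul ptwo 'p_1)]].
Definition pifle n (u v a b : pv n) : pv n := pcond (pcall f_leq [tuple u; v]) a b.

(* Drops the |u| low-order bits of x; the arguments are u and x. *)
Definition f_msp : pv 2 := pv_limrec 'p_0 (phalf 'p_1) (phalf 'p_1) 'p_1.

(* The arguments of [f_bsearch f] are u, U and the remaining arguments of [f];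
   the search interval left after |u| steps has length U / 2 ^ |u| + 1. *)
Definition f_bsearch n (f : pv n.+1) : pv n.+2 :=
  let t := padd 'p_1 (psucc (phalf (pcall f_msp [tuple 'p_0; 'p_2]))) in
  let h : pv n.+3 := pcond (pcall f [tuple of t :: prest 3 n]) t 'p_1 in
  pv_limrec pzero h h 'p_1.
Definition pbsearch k n (f : pv n.+1) (U : pv k) (gs : n.-tuple (pv k)) : pv k :=
  pcall (f_bsearch f) [tuple of U :: U :: gs].

(** * Order and defining equations *)

Section Order.

Local Open Scope m_scope.
Variable M : model.
Implicit Types (x y z u v : M) (s : seq M).

Lemma lem_refl x : x <= x.
Proof. by case: (lem_total x x). Qed.
Lemma lem_trans y x z : x <= y -> y <= z -> x <= z.
Proof. by move=> xy yz; apply: (@lem_trans' _ _ y). Qed.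
Lemma ltm_nle x y : x < y <-> ~ y <= x.
Proof.
split=> [/ltmP [xy nxy] yx|nyx]; first by apply/nxy/lem_anti.
apply/ltmP; case: (lem_total x y) => // xy; split=> // E; apply: nyx.
by rewrite E; apply: lem_refl.
Qed.
Lemma ltm_leW x y : x < y -> x <= y.
Proof. by case/ltmP. Qed.
Lemma leq_ltm x y : x <= y \/ y < x.
Proof. by case: (EM (x <= y)) => [|/ltm_nle]; auto. Qed.
Lemma msuccE x : x.+1 = 1 + x.
Proof. by rewrite maddC maddxS maddx0. Qed.
Lemma leSS x y : x <= y -> x.+1 <= y.+1.
Proof. by rewrite (msuccE x) (msuccE y) => xy; apply/lem_add2l. Qed.
Lemma le_SS x y : x.+1 <= y.+1 -> x <= y.
Proof. by rewrite (msuccE x) (msuccE y) => /lem_add2l. Qed.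
Lemma S_inj x y : x.+1 = y.+1 -> x = y.
Proof. by move=> E; apply: lem_anti; split; apply: le_SS; rewrite E; apply: lem_refl. Qed.
Lemma neq0_ge1 x : x <> 0 <-> 1 <= x.
Proof.
split=> [nx|/ltmP [_ n0] E]; last by apply: n0.
by apply/ltmP; split; [apply: le0m | move=> E; apply: nx].
Qed.
Lemma S_neq0 x : x.+1 <> 0.
Proof. by apply/neq0_ge1/leSS/le0m. Qed.
Lemma lem0 x : x <= 0 -> x = 0.
Proof. by move=> x0; apply: lem_anti; split=> //; apply: le0m. Qed.
Lemma leSP x y : x <= y.+1 -> x <= y \/ x = y.+1.
Proof.
move=> le; case: (leq_ltm x y) => [|lt]; [by left | right].
by apply: lem_anti.
Qed.
Lemma lem_add2r x y z : x <= y -> x + z <= y + z.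
Proof. by rewrite ![_ + z]maddC => xy; apply/lem_add2l. Qed.
Lemma lem_add x y u v : x <= y -> u <= v -> x + u <= y + v.
Proof. by move=> xy uv; apply: lem_trans (lem_add2r _ xy) _; apply/lem_add2l. Qed.
Lemma addm_inj x y z : x + y = x + z -> y = z.
Proof.
by move=> E; apply: lem_anti; split; apply/(@lem_add2l _ x); rewrite E; apply: lem_refl.
Qed.

Lemma mul1m x : 1 * x = x.
Proof. by rewrite mmulC mmulxS mmulx0 maddC maddx0. Qed.
Lemma doubleE x : 2 * x = x + x.
Proof. by rewrite mmulC !mmulxS mmulx0 -[0 + x]maddC maddx0. Qed.
Lemma halfE x : x = 2 * mhalf x \/ x = (2 * mhalf x).+1.
Proof. by case: (halfP (mhalf x) x) => /(_ erefl) [] H _; [left | right]. Qed.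
Lemma half_double x : mhalf (2 * x) = x.
Proof. by symmetry; apply/halfP; left. Qed.
Lemma half_doubleS x : mhalf (2 * x).+1 = x.
Proof. by symmetry; apply/halfP; right. Qed.
Lemma half0 : mhalf 0 = (0 : M).
Proof. by rewrite -{1}(mmulx0 2) half_double. Qed.
Lemma half_le x : mhalf x <= x.
Proof.
case: (halfE x) => {2}->; rewrite doubleE; last apply: leS; apply: lem_addr.
Qed.

(** Not among the BASIC axioms. PIND on the last factor, where distributivity handles the
    doubling. *)
Lemma mmulA x y z : (x * y) * z = x * (y * z).
Proof.
move: z; apply: (@pind M [:: x; y]) => [| |z IH]; first by def.
  by rewrite !mmulx0.
case: (halfE z) => ->; rewrite ?mmulxS doubleE !mmulDr; by rewrite !IH // -mmulDr.
Qed.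

Lemma ap_pcall m n (f : pv m) (gs : m.-tuple (pv n)) s :
  ap f (map (fun g => ap g s) gs) = ap (pcall f gs) s.
Proof.
have := modelP (S12_comp f (tnth gs) (fun i => Var i)) (nth m0 s) => /= E.
rewrite [RHS]E; apply/esym/interp_ap => i.
by rewrite (nth_map (pzero : pv n)) ?size_tuple // (tnth_nth (pzero : pv n)).
Qed.

Lemma ap_proj n (i : 'I_n) s : ap (pv_proj i) s = nth m0 s i.
Proof. exact: (modelP (S12_proj i (fun i => Var i)) (nth m0 s)). Qed.

Lemma ap_pzero n s : ap (@pzero n) s = 0.
Proof. by rewrite -ap_pcall /=; congr interp; apply/funext => -[]. Qed.

Lemma ap_parg n i s : (i < n)%N -> ap (parg n i) s = nth m0 s i.
Proof. by rewrite /parg; case: insubP => [j _ <- _|/negPf ->//]; apply: ap_proj. Qed.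

Lemma map_prest k n s : size s = (k + n)%N -> map (fun g => ap g s) (prest k n) = drop k s.
Proof.
move=> sz; apply: (@eq_from_nth _ m0) => [|i]; rewrite size_map size_tuple.
  by rewrite size_drop sz addKn.
move=> lt; rewrite (nth_map pzero) ?size_tuple //.
by rewrite -[i]/(val (Ordinal lt)) -tnth_nth tnth_mktuple ap_proj nth_drop.
Qed.

Lemma ap_psucc n (f : pv n) s : ap (psucc f) s = (ap f s).+1.
Proof. by rewrite -ap_pcall. Qed.
Lemma ap_pone n s : ap (@pone n) s = 1.
Proof. by rewrite ap_psucc ap_pzero. Qed.
Lemma ap_ptwo n s : ap (@ptwo n) s = 2.
Proof. by rewrite ap_psucc ap_pone. Qed.
Lemma ap_pthree n s : ap (@pthree n) s = 3.
Proof. by rewrite ap_psucc ap_ptwo. Qed.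
Lemma ap_padd n (f g : pv n) s : ap (padd f g) s = ap f s + ap g s.
Proof. by rewrite -ap_pcall. Qed.
Lemma ap_pmul n (f g : pv n) s : ap (pmul f g) s = ap f s * ap g s.
Proof. by rewrite -ap_pcall. Qed.
Lemma ap_psmash n (f g : pv n) s : ap (psmash f g) s = ap f s # ap g s.
Proof. by rewrite -ap_pcall. Qed.
Lemma ap_phalf n (f : pv n) s : ap (phalf f) s = mhalf (ap f s).
Proof. by rewrite -ap_pcall. Qed.
Lemma ap_plen n (f : pv n) s : ap (plen f) s = mlen (ap f s).
Proof. by rewrite -ap_pcall. Qed.

Definition is_minm z x y := (x <= y -> z = x) /\ (~ x <= y -> z = y).

Lemma sat_is_min r a b c :
  sat (S := M) r (is_min a b c) = is_minm (eval_term r a) (eval_term r b) (eval_term r c).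
Proof. by []. Qed.

Lemma is_minm_le z x y : is_minm z x y -> z <= y.
Proof.
case: (leq_ltm x y) => [xy|/ltm_nle xy] [H1 H2]; first by rewrite H1.
by rewrite H2 //; apply: lem_refl.
Qed.

Section Limrec.

Variables (n : nat) (g : pv n) (h0 h1 : pv n.+2) (k : pv n.+1).
Local Notation f := (pv_limrec g h0 h1 k).

(** Axioms speak of terms. Instances at variables, read in an environment listing the arguments,
    cover all elements of the model. *)
Let vars : n.-tuple term := mktuple (fun i => Var i.+1).

Lemma eval_vars x s : size s = n -> map (eval_term (S := M) (nth m0 (x :: s))) vars = s.
Proof.
move=> sz; apply: (@eq_from_nth _ m0) => [|i]; rewrite size_map size_tuple // => lt.
by rewrite (nth_map tzero) ?size_tuple // -[i]/(val (Ordinal lt)) -tnth_nth tnth_mktuple.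
Qed.

Lemma eval_app r m (p : pv m) (ts : m.-tuple term) :
  eval_term (S := M) r (app p ts) = ap p (map (eval_term r) ts).
Proof.
apply: interp_ap => i; rewrite (tnth_nth tzero) (nth_map tzero) // size_tuple.
by case: i.
Qed.

Lemma eval_double r (t : term) : eval_term (S := M) r (tdouble t) = 2 * eval_term r t.
Proof. rewrite /tdouble eval_app; congr (ap _ [:: _; _]).
by rewrite eval_app; congr (ap _ [:: _]); rewrite eval_app; congr (ap _ [:: _]); apply: eval_zero. Qed.

Lemma eval_double1 r (t : term) : eval_term (S := M) r (tdouble1 t) = (2 * eval_term r t).+1.
Proof. by rewrite /tdouble1 eval_app -eval_double. Qed.

Lemma eval_cons x s (t : term) : size s = n ->
  map (eval_term (S := M) (nth m0 (x :: s))) [tuple of t :: vars] = eval_term (nth m0 (x :: s)) t :: s.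
Proof. by move=> sz; congr (_ :: _); apply: eval_vars. Qed.

Lemma eval_cons2 x s (t u : term) : size s = n ->
  map (eval_term (S := M) (nth m0 (x :: s))) [tuple of t :: u :: vars]
  = [:: eval_term (nth m0 (x :: s)) t, eval_term (nth m0 (x :: s)) u & s].
Proof. by move=> sz; congr [:: _, _ & _]; apply: eval_vars. Qed.

Lemma limrec0 s : size s = n -> is_minm (ap f (0 :: s)) (ap g s) (ap k (0 :: s)).
Proof.
move=> sz; have := modelP (S12_rec0 g h0 h1 k vars) (nth m0 (0 :: s)).
by rewrite sat_is_min !eval_app !eval_cons // eval_vars // eval_zero.
Qed.

Lemma limrec_even x s : size s = n -> x <> 0 ->
  is_minm (ap f (2 * x :: s)) (ap h0 [:: x, ap f (x :: s) & s]) (ap k (2 * x :: s)).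
Proof.
move=> sz nx; have := modelP (S12_rec_even g h0 h1 k (Var 0) vars) (nth m0 (x :: s)).
set r := nth m0 (x :: s).
rewrite -[sat _ _]/((eval_term r (Var 0) = eval_term r tzero -> False) -> sat r (is_min _ _ _)).
rewrite eval_zero => /(_ nx); rewrite sat_is_min !eval_app.
by rewrite !eval_cons2 // !eval_cons // eval_double eval_app eval_cons.
Qed.

Lemma limrec_odd x s : size s = n ->
  is_minm (ap f ((2 * x).+1 :: s)) (ap h1 [:: x, ap f (x :: s) & s]) (ap k ((2 * x).+1 :: s)).
Proof.
move=> sz; have := modelP (S12_rec_odd g h0 h1 k (Var 0) vars) (nth m0 (x :: s)).
move: (tdouble1 _) (eval_double1 (nth m0 (x :: s)) (Var 0)) => t Et.
by rewrite sat_is_min !eval_app !eval_cons2 // !eval_cons // eval_app eval_cons // Et.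
Qed.

End Limrec.

Lemma half_cases x : x <> 0 ->
  (x = 2 * mhalf x /\ mhalf x <> 0) \/ x = (2 * mhalf x).+1.
Proof.
move=> nx; case: (halfE x) => E; [left | by right]; split=> // h0.
by apply: nx; rewrite E h0 mmulx0.
Qed.

(** Recursions with the same step for both parities obey one equation in terms of [mhalf], which
    matches the premise of [pind]. *)
Lemma limrec_half n (g : pv n) (h : pv n.+2) k x s : size s = n -> x <> 0 ->
  is_minm (ap (pv_limrec g h h k) (x :: s))
    (ap h [:: mhalf x, ap (pv_limrec g h h k) (mhalf x :: s) & s]) (ap k (x :: s)).
Proof.
move=> sz /half_cases [[E nh]|E]; rewrite {1 4}E.
  exact: limrec_even.
exact: limrec_odd.
Qed.

End Order.

Definition pvE := (ap_psucc, ap_pone, ap_ptwo, ap_pthree, ap_padd, ap_pmul, ap_psmash, ap_phalf, ap_plen, ap_pzero).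
Ltac pvs := repeat first
  [ rewrite ap_parg; [cbn [nth] | by []] | progress rewrite ?pvE
  | match goal with |- context [ap (@pcall ?m ?n ?f ?gs) ?s] =>
      rewrite -(@ap_pcall _ m n f gs s); cbn [map tval tuple] end ].

(** * Comparison, shifts and binary search *)

Section Functions.

Local Open Scope m_scope.
Variable M : model.
Implicit Types (x y z u v t : M) (s : seq M).

Lemma cond0 x y : ap f_cond [:: 0; x; y] = x.
Proof.
have [H _] := limrec0 'p_0 'p_3 'p_3 (padd 'p_1 'p_2) (erefl : size [:: x; y] = 2%N).
by rewrite H; pvs => //; apply: lem_addr.
Qed.

Lemma cond1 t x y : t <> 0 -> ap f_cond [:: t; x; y] = y.
Proof.
move=> /(limrec_half 'p_0 'p_3 (padd 'p_1 'p_2) (erefl : size [:: x; y] = 2%N)) [H _].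
by rewrite H; pvs => //; rewrite maddC; apply: lem_addr.
Qed.

Lemma ap_pcond n (a b c : pv n) s :
  ap (pcond a b c) s = ap f_cond [:: ap a s; ap b s; ap c s].
Proof. by rewrite -ap_pcall. Qed.

Lemma parity_even x : ap f_parity [:: 2 * x] = 0.
Proof.
case: (EM (x = 0)) => [->|nx].
  rewrite mmulx0; have [H _] := limrec0 pzero pzero pone pone (erefl : @size M [::] = 0%N).
  by rewrite H; pvs => //; apply: le0m.
have [H _] := limrec_even pzero pzero pone pone (erefl : size [::] = 0%N) nx.
by rewrite H; pvs => //; apply: le0m.
Qed.

Lemma parity_odd x : ap f_parity [:: (2 * x).+1] = 1.
Proof.
have [H _] := limrec_odd pzero pzero pone pone x (erefl : size [::] = 0%N).
by rewrite H; pvs => //; apply: lem_refl.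
Qed.

Lemma minP x y : is_minm (ap f_min [:: x; y]) x y.
Proof.
rewrite /f_min; pvs.
have := limrec0 'p_0 'p_0 'p_0 'p_2 (erefl : size [:: x; y] = 2%N); by pvs.
Qed.

Lemma le_double x y : x <= y -> 2 * x <= 2 * y.
Proof. by move=> xy; rewrite !doubleE; apply: lem_add. Qed.

Lemma f_leq_le u v : u <= v -> ap f_leq [:: u; v] = 0.
Proof.
move=> uv; rewrite /f_leq; pvs.
have [H _] := minP (2 * u) (2 * v).+1; rewrite H ?parity_even //.
exact/leS/le_double.
Qed.

Lemma f_leq_lt u v : v < u -> ap f_leq [:: u; v] <> 0.
Proof.
move=> /le_double; rewrite {1}doubleE maddxS maddC maddxS -doubleE => vu.
rewrite /f_leq; pvs.
have [_ H] := minP (2 * u) (2 * v).+1; rewrite H ?parity_odd; first exact: S_neq0.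
by apply/ltm_nle.
Qed.

Lemma ifle_le n (a b c d : pv n) s : ap a s <= ap b s -> ap (pifle a b c d) s = ap c s.
Proof. by move=> le; rewrite ap_pcond -ap_pcall /= f_leq_le ?cond0. Qed.

Lemma ifle_lt n (a b c d : pv n) s : ap b s < ap a s -> ap (pifle a b c d) s = ap d s.
Proof. by move=> lt; rewrite ap_pcond -ap_pcall /= cond1 //; apply: f_leq_lt. Qed.

Definition msp x u := ap f_msp [:: u; x].

Lemma msp0 x : msp x 0 = x.
Proof.
have [H _] := limrec0 'p_0 (phalf 'p_1) (phalf 'p_1) 'p_1 (erefl : size [:: x] = 1%N).
by rewrite /msp H; pvs => //; apply: lem_refl.
Qed.

Lemma msp_half x u : u <> 0 -> msp x u = mhalf (msp x (mhalf u)).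
Proof.
move=> nu; have bound t : msp x t <= x.
  case: (EM (t = 0)) => [->|nt]; first by rewrite msp0; apply: lem_refl.
  have /is_minm_le := limrec_half 'p_0 (phalf 'p_1) 'p_1 (erefl : size [:: x] = 1%N) nt.
  by pvs.
have [H _] := limrec_half 'p_0 (phalf 'p_1) 'p_1 (erefl : size [:: x] = 1%N) nu.
rewrite {1}/msp H; pvs => //.
exact: lem_trans (half_le _) (bound _).
Qed.

Lemma len_msp x u : mlen u <= mlen x -> mlen (msp x u) + mlen u = mlen x.
Proof.
move: u; apply: (@pind M [:: x]) => [| |u IH le]; first by def.
  by rewrite msp0 len0 maddx0.
case: (EM (u = 0)) => [->|nu]; first by rewrite msp0 len0 maddx0.
have lenu := len_half nu; rewrite lenu in le *.
have {}IH := IH (ltm_leW le); rewrite msp_half //.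
have nm : msp x (mhalf u) <> 0.
  move=> E; move: le; rewrite -IH E len0 maddC maddx0 => /ltm_nle; apply.
  exact: lem_refl.
by rewrite -IH (len_half nm) maddxS ![(_ .+1 + _)]maddC maddxS maddC.
Qed.

Lemma len_eq0 x : mlen x = 0 -> x = 0.
Proof. by move=> E; case: (EM (x = 0)) => // /len_half; rewrite E => /esym /S_neq0. Qed.

Lemma msp_self x : msp x x = 0.
Proof.
have := len_msp (lem_refl (mlen x)); rewrite -[RHS]maddx0 maddC.
by move=> /addm_inj /len_eq0.
Qed.

Section Search.

Variables (n : nat) (f : pv n.+1) (U : M) (s : seq M).
Hypotheses (sz : size s = n) (f0 : ap f (0 :: s) = 0) (fU : ap f (U.+1 :: s) <> 0)
  (mono : forall x y, x <= y -> ap f (y :: s) = 0 -> ap f (x :: s) = 0).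

(** The common tool for inverting monotone functions: subtraction, square root, division, a number
    of given length and the i-th zero are all found by it. *)
Lemma bsearchP :
  let r := ap (f_bsearch f) [:: U, U & s] in
  [/\ r <= U, ap f (r :: s) = 0 & ap f (r.+1 :: s) <> 0].
Proof.
set h : pv n.+3 := pcond (pcall f [tuple of padd 'p_1 (psucc (phalf (pcall f_msp [tuple 'p_0; 'p_2]))) :: prest 3 n])
  (padd 'p_1 (psucc (phalf (pcall f_msp [tuple 'p_0; 'p_2])))) 'p_1.
have szU : size (U :: s) = (n.+1)%N by rewrite /= sz.
pose F u := ap (f_bsearch f) [:: u, U & s].
have tU x : ap f (x :: s) = 0 -> x <= U.
  move=> fx; case: (leq_ltm x U) => // Ux; case: fU.
  exact: mono Ux fx.
have H u : ap f (F u :: s) = 0 /\ ap f ((F u + msp U u).+1 :: s) <> 0.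
  move: u; apply: (@pind M (U :: s)) => [| |u [IH1 IH2]].
  - rewrite /F; def; deft.
  - have [H _] := limrec0 pzero h h 'p_1 szU.
    rewrite /F H ap_pzero; last exact: le0m.
    by rewrite msp0 [0 + U]maddC maddx0.
  case: (EM (u = 0)) => [E|nu]; first by move: IH1 IH2; rewrite E half0.
  have [] := limrec_half pzero h 'p_1 szU nu.
  change (ap (pv_limrec _ _ _ _) [:: mhalf u, U & s]) with (F (mhalf u)).
  change (ap (pv_limrec _ _ _ _) [:: u, U & s]) with (F u).
  set r := F (mhalf u) in IH1 IH2 *; set p := msp U (mhalf u) in IH2 *.
  have -> : ap h [:: mhalf u, r, U & s] =
    ap f_cond [:: ap f (r + (mhalf p).+1 :: s); r + (mhalf p).+1; r].
    have ptE : ap (padd 'p_1 (psucc (phalf (pcall f_msp [tuple 'p_0; 'p_2]))) : pv n.+3)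
        [:: mhalf u, r, U & s] = r + (mhalf p).+1 by pvs.
    rewrite /h ap_pcond -(ap_pcall f) ptE; pvs.
    rewrite -[map _ _]/(ap (padd _ _ : pv n.+3) _ :: map _ (prest 3 n)).
    by rewrite map_prest /= ?sz // drop0 ptE.
  rewrite [ap 'p_1 _]ap_parg // [nth _ _ _]/=.
  rewrite msp_half // -/p.
  case: (EM (ap f (r + (mhalf p).+1 :: s) = 0)) => [ft|ft].
    rewrite ft cond0 => FE _; rewrite FE; last exact: tU.
    (* Since p <= 2 * [mhalf p] + 1, the new upper end is not below the old one, despite the
       rounding. *)
    split=> // /(mono _) H; apply/IH2/H/leSS; rewrite maddA; apply/lem_add2l.
    rewrite maddC maddxS -doubleE; case: (halfE p) => {1}->; first exact/leS/lem_refl.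
    exact: lem_refl.
  rewrite cond1 // => FE _; rewrite FE; last exact: tU.
  by split=> //; rewrite -maddxS.
have [f1 f2] := H U; split=> //; first exact: tU.
by move: f2; rewrite msp_self maddx0.
Qed.

End Search.

End Functions.

(** * Truncated subtraction *)

Definition f_sub : pv 2 :=
  pifle 'p_1 'p_0
    (pbsearch (pcall f_leq [tuple padd 'p_2 'p_0; 'p_1] : pv 3) 'p_0 [tuple 'p_0; 'p_1]) pzero.
Definition psub n (f g : pv n) : pv n := pcall f_sub [tuple f; g].

Section Subtraction.

Local Open Scope m_scope.
Variable M : model.
Implicit Types (x y z u v : M).

Lemma f_leqP u v : ap f_leq [:: u; v] = 0 <-> u <= v.
Proof.
split=> [E|]; last exact: f_leq_le.
by case: (leq_ltm u v) => // /f_leq_lt.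
Qed.

Definition msub x y := ap f_sub [:: x; y].

Lemma addm_sub x y : y <= x -> y + msub x y = x.
Proof.
move=> yx; rewrite /msub /f_sub ifle_le /pbsearch; pvs => //.
set f := pcall _ _; set r := ap _ _.
have fE s : ap f [:: s; x; y] = 0 <-> y + s <= x by rewrite /f; pvs; apply: f_leqP.
have [|||_ /fE le /fE gt] := @bsearchP M 2%N f x [:: x; y] erefl.
- by apply/fE; rewrite maddx0.
- move/fE; apply/ltm_nle; apply: lem_trans (lem_refl x.+1) _.
  by rewrite maddC; apply: lem_addr.
- by move=> s t st /fE le; apply/fE; apply: lem_trans le; apply/lem_add2l.
by apply: lem_anti; split=> //; move: gt; rewrite maddxS; case: (leq_ltm x (y + r)).
Qed.

Lemma msub_le0 x y : x <= y -> msub x y = 0.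
Proof.
case: (leq_ltm y x) => [yx xy|xy _]; last by rewrite /msub /f_sub ifle_lt; pvs.
have E : x = y by apply: lem_anti.
by apply: (@addm_inj _ y); rewrite addm_sub // E maddx0.
Qed.

End Subtraction.

(** * The ordered ring of integers of a model *)

Section Integers.

Local Open Scope m_scope.
Variable M : model.
Implicit Types (x y z u v : M) (a b c d : M * M).

Lemma M_semiring : semi_ring_theory 0 1 (@madd M) (@mmul M) eq.
Proof.
split.
- by move=> x; rewrite maddC maddx0.
- exact: maddC.
- by move=> x y z; rewrite maddA.
- exact: mul1m.
- by move=> x; rewrite mmulC mmulx0.
- exact: mmulC.
- by move=> x y z; rewrite mmulA.
- by move=> x y z; rewrite ![_ * z]mmulC mmulDr.
Qed.

Add Ring M_ring : M_semiring.

Definition zeq a b := a.1 + b.2 = b.1 + a.2.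

Lemma zeq_refl a : zeq a a.
Proof. by []. Qed.
Lemma zeq_sym a b : zeq a b -> zeq b a.
Proof. by rewrite /zeq => ->. Qed.
Lemma zeq_trans a b c : zeq a b -> zeq b c -> zeq a c.
Proof.
rewrite /zeq => ab bc; apply: (@addm_inj _ (b.1 + b.2)).
transitivity ((a.1 + b.2) + (b.1 + c.2)); first by semiring.
by rewrite ab bc; semiring.
Qed.

(** Formal differences turn the ordered semiring of the model into an ordered ring, where [ring],
    [lra] and [nra] apply. *)
Definition zint := quot zeq.
Definition zcl a : zint := class zeq a.

Lemma zcl_eq a b : zcl a = zcl b <-> zeq a b.
Proof. exact: (class_eq zeq_refl zeq_sym zeq_trans). Qed.

Lemma zint_ind (P : zint -> Prop) : (forall x y, P (zcl (x, y))) -> forall X, P X.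
Proof. by move=> H X; rewrite -(class_repr X); case: (repr X) => x y; apply: H. Qed.

Lemma repr_zcl a : zeq (repr (zcl a)) a.
Proof. by apply/zcl_eq; rewrite /zcl class_repr. Qed.

Definition zadd (X Y : zint) : zint := zcl ((repr X).1 + (repr Y).1, (repr X).2 + (repr Y).2).
Definition zmul (X Y : zint) : zint :=
  zcl ((repr X).1 * (repr Y).1 + (repr X).2 * (repr Y).2,
       (repr X).1 * (repr Y).2 + (repr X).2 * (repr Y).1).
Definition zopp (X : zint) : zint := zcl ((repr X).2, (repr X).1).
Definition zle (X Y : zint) : bool := `[< (repr X).1 + (repr Y).2 <= (repr Y).1 + (repr X).2 >].

Lemma zaddE a b : zadd (zcl a) (zcl b) = zcl (a.1 + b.1, a.2 + b.2).
Proof.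
have := repr_zcl a; have := repr_zcl b; rewrite /zadd.
case: (repr _) => b1 b2; case: (repr _) => a1 a2; rewrite /zeq /= => Eb Ea.
apply/zcl_eq; rewrite /zeq /=.
transitivity ((a1 + a.2) + (b1 + b.2)); first by semiring.
by rewrite Ea Eb; semiring.
Qed.

Lemma zoppE a : zopp (zcl a) = zcl (a.2, a.1).
Proof.
have := repr_zcl a; rewrite /zopp; case: (repr _) => a1 a2; rewrite /zeq /= => Ea.
by apply/zcl_eq; rewrite /zeq /= maddC -Ea maddC.
Qed.

Lemma zmulE a b :
  zmul (zcl a) (zcl b) = zcl (a.1 * b.1 + a.2 * b.2, a.1 * b.2 + a.2 * b.1).
Proof.
have := repr_zcl a; have := repr_zcl b; rewrite /zmul.
case: (repr _) => b1 b2; case: (repr _) => a1 a2; rewrite /zeq /= => Eb Ea.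
apply/zcl_eq; apply: (@zeq_trans _ (a.1 * b1 + a.2 * b2, a.1 * b2 + a.2 * b1)); rewrite /zeq /=.
  transitivity (b1 * (a1 + a.2) + b2 * (a.1 + a2)); first by semiring.
  by transitivity (b1 * (a.1 + a2) + b2 * (a1 + a.2)); [rewrite Ea | semiring].
transitivity (a.1 * (b1 + b.2) + a.2 * (b.1 + b2)); first by semiring.
by transitivity (a.1 * (b.1 + b2) + a.2 * (b1 + b.2)); [rewrite Eb | semiring].
Qed.

Lemma zleE a b : zle (zcl a) (zcl b) <-> a.1 + b.2 <= b.1 + a.2.
Proof.
have := repr_zcl a; have := repr_zcl b; rewrite /zle.
case: (repr _) => b1 b2; case: (repr _) => a1 a2; rewrite /zeq /= => Eb Ea.
have L : (a1 + a.2) + (b.1 + b2) + (a.1 + b.2) = (a.1 + a2) + (b1 + b.2) + (a.1 + b.2).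
  by rewrite Ea Eb.
split=> [/asboolP|] H; first apply/(@lem_add2l _ (a1 + b2)).
  have -> : a1 + b2 + (b.1 + a.2) = b1 + a2 + (a.1 + b.2).
    by transitivity ((a1 + a.2) + (b.1 + b2)); [semiring | rewrite Ea -Eb; semiring].
  exact: lem_add2r.
apply/asboolP; apply/(@lem_add2l _ (a.1 + b.2)).
have -> : a.1 + b.2 + (b1 + a2) = b.1 + a.2 + (a1 + b2).
  by transitivity ((a.1 + a2) + (b1 + b.2)); [semiring | rewrite -Ea Eb; semiring].
exact: lem_add2r.
Qed.

End Integers.

Section IntegerRing.

Local Open Scope m_scope.
Variable M : model.
Local Notation Z := (zint M).
Implicit Types (x y z u v : M) (X Y : Z).

Add Ring M_ring' : (M_semiring M).

HB.instance Definition _ := gen_eqMixin Z.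
HB.instance Definition _ := gen_choiceMixin Z.

Definition iz x : Z := zcl (x, 0).

Ltac zlaw := do ?[elim/zint_ind=> ? ?]; rewrite /iz; repeat progress rewrite ?zoppE ?zaddE ?zmulE;
  apply/zcl_eq; rewrite /zeq /=; semiring.

Lemma zaddA : associative (@zadd M). Proof. by zlaw. Qed.
Lemma zaddC : commutative (@zadd M). Proof. by zlaw. Qed.
Lemma zadd0 : left_id (iz 0) (@zadd M). Proof. by zlaw. Qed.
Lemma zaddN : left_inverse (iz 0) (@zopp M) (@zadd M). Proof. by zlaw. Qed.
HB.instance Definition _ := GRing.isZmodule.Build Z zaddA zaddC zadd0 zaddN.

Lemma zmulA : associative (@zmul M). Proof. by zlaw. Qed.
Lemma zmulC : commutative (@zmul M). Proof. by zlaw. Qed.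
Lemma zmul1 : left_id (iz 1) (@zmul M). Proof. by zlaw. Qed.
Lemma zmulD : left_distributive (@zmul M) (@zadd M).
Proof.
elim/zint_ind=> x1 x2; elim/zint_ind=> y1 y2; elim/zint_ind=> z1 z2.
rewrite (zaddE (x1, x2) (y1, y2)) !zmulE zaddE; apply/zcl_eq; rewrite /zeq /=; semiring.
Qed.

Lemma iz_inj : injective iz.
Proof. by move=> x y /zcl_eq; rewrite /zeq /= !maddx0. Qed.

Lemma zone_neq0 : iz 1 != iz 0.
Proof. by apply/eqP => /iz_inj /S_neq0. Qed.
HB.instance Definition _ := GRing.Zmodule_isComNzRing.Build Z zmulA zmulC zmul1 zmulD zone_neq0.

Lemma izD x y : iz (x + y) = (iz x + iz y)%R.
Proof. by rewrite -[RHS]/(zadd _ _) zaddE /= maddx0. Qed.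
Lemma izM x y : iz (x * y) = (iz x * iz y)%R.
Proof. by rewrite -[RHS]/(zmul _ _) zmulE /= !mmulx0 [0 * y]mmulC mmulx0 !maddx0. Qed.
Lemma iz0 : iz 0 = 0%R. Proof. by []. Qed.
Lemma izS x : iz x.+1 = (iz x + 1)%R.
Proof. by rewrite -[X in (_ + X)%R]/(iz 1) -izD maddxS maddx0. Qed.

Lemma zint_cases X : (exists x, X = iz x) \/ exists2 x, x <> 0 & X = (- iz x)%R.
Proof.
elim/zint_ind: X => x y; case: (leq_ltm y x) => [yx|xy].
  left; exists (msub x y); apply/zcl_eq; rewrite /zeq /= maddx0 [RHS]maddC addm_sub //.
right; exists (msub y x).
  by move=> E; have := addm_sub (ltm_leW xy); rewrite E maddx0 => E'; move: xy; rewrite E' => /ltm_nle; apply; apply: lem_refl.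
rewrite -[(- _)%R]/(zopp _) zoppE; apply/zcl_eq; rewrite /zeq /=.
by rewrite addm_sub ?[0 + _]maddC ?maddx0 //; apply: ltm_leW.
Qed.

(** An inverse function is part of the structures between rings and ordered domains; it is chosen
    classically. *)
Definition zunit X : bool := `[< exists Y, (Y * X = 1)%R >].
Definition zinv X : Z := if pselect (exists Y, (Y * X = 1)%R) is left ex then projT1 (cid ex) else X.

Lemma zmulVx : {in zunit, left_inverse 1%R zinv *%R}.
Proof. by move=> X /asboolP ex; rewrite /zinv; case: pselect => // ex'; case: cid. Qed.
Lemma zunitPl X Y : (Y * X = 1)%R -> zunit X.
Proof. by move=> E; apply/asboolP; exists Y. Qed.
Lemma zinv_out : {in [predC zunit], zinv =1 id}.
Proof. by move=> X /negP nX; rewrite /zinv; case: pselect => // ex; case: nX; apply/asboolP. Qed.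
HB.instance Definition _ := GRing.ComNzRing_hasMulInverse.Build Z zmulVx zunitPl zinv_out.

Lemma mulm_eq0 x y : x * y = 0 -> x = 0 \/ y = 0.
Proof.
move=> E; case: (EM (x = 0)) => [|/neq0_ge1 x1]; [by left | right].
by apply: lem0; apply/(lem_mul2l _ _ x1); rewrite E mmulx0; apply: lem_refl.
Qed.

Lemma zintegral X Y : (X * Y = 0)%R -> (X == 0)%R || (Y == 0)%R.
Proof.
have gen x y : (iz x * iz y = 0)%R -> (iz x == 0)%R || (iz y == 0)%R.
  by rewrite -izM => /iz_inj /mulm_eq0 [] ->; rewrite eqxx ?orbT.
case: (zint_cases X) => [[x ->]|[x _ ->]]; case: (zint_cases Y) => [[y ->]|[y _ ->]];
by move/eqP; rewrite ?GRing.mulNr ?GRing.mulrN ?GRing.opprK ?GRing.oppr_eq0 => /eqP /gen.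
Qed.
HB.instance Definition _ := GRing.ComUnitRing_isIntegral.Build Z zintegral.

Lemma zle_iz x y : zle (iz x) (iz y) <-> x <= y.
Proof. by rewrite zleE /= !maddx0. Qed.
Lemma zle0_cases X : zle 0%R X -> exists x, X = iz x.
Proof.
case: (zint_cases X) => // -[x nx ->]; rewrite -[(- _)%R]/(zopp _) zoppE zleE /= !maddx0.
by rewrite maddC maddx0 => /lem0.
Qed.
Lemma zle_sub X Y : zle 0%R (Y - X)%R = zle X Y.
Proof.
elim/zint_ind: X => x1 x2; elim/zint_ind: Y => y1 y2.
rewrite -[(_ - _)%R]/(zadd _ (zopp _)) zoppE zaddE; apply/idP/idP; rewrite !zleE /= maddx0 [0 + _]maddC maddx0;
by rewrite [y2 + x1]maddC.
Qed.
Lemma zle_add X Y : zle 0%R X -> zle 0%R Y -> zle 0%R (X + Y)%R.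
Proof. by move=> /zle0_cases [x ->] /zle0_cases [y ->]; rewrite -izD; apply/zle_iz/le0m. Qed.
Lemma zle_mul X Y : zle 0%R X -> zle 0%R Y -> zle 0%R (X * Y)%R.
Proof. by move=> /zle0_cases [x ->] /zle0_cases [y ->]; rewrite -izM; apply/zle_iz/le0m. Qed.
Lemma zle_anti X : zle 0%R X -> zle X 0%R -> X = 0%R.
Proof. by move=> /zle0_cases [x ->] /zle_iz /lem0 ->. Qed.
Lemma zle_total X : zle 0%R X || zle X 0%R.
Proof.
case: (zint_cases X) => [[x ->]|[x _ ->]]; apply/orP; [left | right].
  exact/zle_iz/le0m.
by rewrite -zle_sub GRing.sub0r GRing.opprK; apply/zle_iz/le0m.
Qed.
Definition zlt X Y := (Y != X) && zle X Y.
Definition znorm X := if zle 0%R X then X else (- X)%R.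
Lemma znormN X : znorm (- X)%R = znorm X.
Proof.
rewrite /znorm -{1}GRing.sub0r zle_sub; case: ifP => [nX|]; case: ifP => //.
- by move=> pX; rewrite (zle_anti pX nX) GRing.oppr0.
- by rewrite GRing.opprK.
by move=> pX nX; have := zle_total X; rewrite pX nX.
Qed.
Lemma znorm_ge0 X : zle 0%R X -> znorm X = X.
Proof. by rewrite /znorm => ->. Qed.
Lemma zlt_def X Y : zlt X Y = (Y != X) && zle X Y.
Proof. by []. Qed.
HB.instance Definition _ := Num.IntegralDomain_isLeReal.Build Z zle_add zle_mul zle_anti
  zle_sub zle_total znormN znorm_ge0 zlt_def.

Lemma iz_le x y : x <= y <-> (iz x <= iz y)%R.
Proof. by rewrite -zle_iz. Qed.
Lemma iz_ge0 x : (0 <= iz x)%R.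
Proof. exact/iz_le/le0m. Qed.

End IntegerRing.

Lemma iz_leE (M : model) (x y : M) : lep x y -> (iz x <= iz y)%R.
Proof. by move=> /iz_le. Qed.
Lemma iz_eqE (M : model) (x y : M) : x = y -> iz x = iz y.
Proof. by move=> ->. Qed.
Lemma iz_nleE (M : model) (x y : M) : ~ lep x y -> (iz y + 1 <= iz x)%R.
Proof. by move=> /ltm_nle /iz_le; rewrite izS. Qed.

Definition izE := (izS, izD, izM, iz0).

Ltac mz_hyps := repeat match goal with
  | H : lep _ _ |- _ => apply iz_leE in H; rewrite ?izE in H
  | H : ~ lep _ _ |- _ => apply iz_nleE in H; rewrite ?izE in H
  | H : @eq (carrier _) _ _ |- _ => apply iz_eqE in H; rewrite ?izE in H
  end.
Ltac mz_goal := lazymatch goal with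
  | |- lep _ _ => apply/iz_le; rewrite ?izE
  | |- ~ lep _ _ => apply/ltm_nle/iz_le; rewrite ?izE
  | |- @eq (carrier _) _ _ => apply: iz_inj; rewrite ?izE
  | |- False => idtac
  end.
Ltac mz_atoms := repeat match goal with
  | |- context [iz ?x] => lazymatch goal with H : is_true (0 <= iz x)%R |- _ => fail | _ => have := iz_ge0 x; intro end
  | _ : context [iz ?x] |- _ => lazymatch goal with H : is_true (0 <= iz x)%R |- _ => fail | _ => have := iz_ge0 x; intro end
  end.
Ltac mz_clear := repeat match goal with
  | H : ?P |- _ => lazymatch type of P with
      | Prop => lazymatch P with is_true _ => fail | @eq (zint _) _ _ => fail | _ => clear H end
      end
  end.
(** Carries equations and inequalities of the model over to its integers and records that every atom
    is nonnegative. *)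
Ltac mz := intros; mz_goal; mz_hyps; mz_clear; mz_atoms.
Ltac mlra := solve [mz; lra].
Ltac mnra := solve [mz; nra].
Ltac mring := solve [mz_goal; ring].

(** * Lengths and powers of two *)

Section Lengths.

Local Open Scope m_scope.
Variable M : model.
Implicit Types (x y z u v n i j : M) (ps : seq M).

Definition Log n := exists x, n = mlen x.

(** PIND on [x] for the condition at |x|: halving [x] lowers the length by one. *)
Lemma lind0 ps (X : M -> Prop) : Def ps true (fun c : ctx M 1 => X c.2) ->
  X 0 -> (forall i, X i -> X i.+1) -> forall n, Log n -> X n.
Proof.
move=> dX X0 XS _ [x ->]; move: x; apply: (pind (ps := ps)); first exact: Def_len.
  by rewrite len0.
move=> x IH; case: (EM (x = 0)) => [->|/len_half ->]; first by rewrite len0.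
exact: XS.
Qed.

(** Repeated halving of [x] passes through every smaller length. The bound [y <= x] on the witness
    makes the condition Sigma^b_1. *)
Lemma Log_le i n : Log n -> i <= n -> Log i.
Proof.
move=> [x ->]; suff H : forall j, j <= mlen x -> exists y, y <= x /\ mlen y = j.
  by move=> /H [y [_ <-]]; exists y.
move: x; apply: (@pind M [::]); first by def.
  by move=> j; rewrite len0 => /lem0 ->; exists 0; split; [apply: lem_refl | apply: len0].
move=> x IH j jx; case: (leq_ltm j (mlen (mhalf x))) => [/IH [y [yx <-]]|lt].
  by exists y; split=> //; apply: lem_trans yx (half_le _).
exists x; split; first exact: lem_refl.
apply: lem_anti; split=> //.
by case: (EM (x = 0)) => [->|/len_half ->//]; rewrite len0; apply: le0m.
Qed.

Lemma Log_len x : Log (mlen x).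
Proof. by exists x. Qed.

Lemma Log0 : Log 0.
Proof. by exists 0; rewrite len0. Qed.

Lemma LogS n : Log n -> Log n.+1.
Proof.
move=> [x ->]; case: (EM (x = 0)) => [->|nx]; first by exists 1; rewrite len0 len1.
by exists (2 * x); case: (len_double nx).
Qed.

(** This is the contribution of the smash function, and the reason why lengths of polynomial size
    exist. *)
Lemma LogM m n : Log m -> Log n -> Log (m * n).
Proof.
move=> [x ->] [y ->]; apply: (@Log_le _ (mlen (x # y))); first exact: Log_len.
by rewrite len_smash; apply/leS/lem_refl.
Qed.

Lemma LogD m n : Log m -> Log n -> Log (m + n).
Proof. by move=> /LogS Lm /LogS Ln; apply: Log_le (LogM Lm Ln) _; mnra. Qed.

Lemma lind ps (X : M -> Prop) n : Log n -> DefT ps (fun _ : ctx M 1 => n) ->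
  Def ps true (fun c : ctx M 1 => X c.2) ->
  X 0 -> (forall i, i < n -> X i -> X i.+1) -> forall i, i <= n -> X i.
Proof.
move=> Ln dn dX X0 XS i /[dup] le; apply: (lind0 (X := fun j => j <= n -> X j) (ps := ps) _ _ _ (Log_le Ln le)) => // [|j IH lt].
  by apply: Def_imp dX; apply: Def_le dn; apply: DefT_var.
by apply: XS => //; apply/IH/ltm_leW.
Qed.

Lemma lsind ps (X : M -> Prop) N : (forall k, DefT ps (fun _ : ctx M k => N)) ->
  (forall k, Def ps true (fun c : ctx M k.+1 => X c.2)) ->
  (forall i, i <= mlen N -> (forall j, j < i -> X j) -> X i) -> forall i, i <= mlen N -> X i.
Proof.
move=> dN dX step i le.
have : forall j, j <= mlen N -> j < (mlen N).+1 -> X j.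
  (* The quantifier over j is bounded by a length and so stays sharply bounded while n grows. *)
  apply: (lind0 (X := fun n => forall j, j <= mlen N -> j < n -> X j) (ps := ps) _ _ _ (LogS (Log_len N))).
  - by apply: Def_sall => //; apply: Def_imp; [apply: Def_le; deft | apply: dX].
  - by move=> j _ /lem0 /S_neq0.
  move=> n IH j jN /le_SS jn; apply: step => // k kj; apply: IH.
    by apply: lem_trans (ltm_leW kj) jN.
  exact: lem_trans kj jn.
by apply=> //; apply: leSS.
Qed.

Lemma p2_0 : 1 # 0 = 1 :> M.
Proof. by rewrite smashC smash0x. Qed.

(** Two axioms evaluate [2 # 1]: doubling gives [2 * (1 # 1)], and |2| = |1| + |1| gives
    [(1 # 1) * (1 # 1)]. Cancelling the nonzero [1 # 1] leaves the claim. *)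
Lemma p2_1 : 1 # 1 = 2 :> M.
Proof.
have [e1 _] := smash1_double (proj2 (neq0_ge1 _) (lem_refl (1 : M))).
have [l1 _] := len_double (proj2 (neq0_ge1 _) (lem_refl (1 : M))).
have e2 : (2 * 1) # 1 = (1 # 1) * (1 # 1) :> M.
  by apply: smash_addl; rewrite l1 len1; mring.
have n0 : 1 # 1 <> 0 :> M.
  by move=> E; have := len_smash (1 : M) 1; rewrite E len0 => /esym /S_neq0.
move: e1; rewrite smashC e2 => /iz_eqE; rewrite izM izM => /GRing.mulIf E.
by apply: iz_inj; rewrite E //; apply/eqP => /iz_inj.
Qed.

Lemma p2_half x : x <> 0 -> 1 # x = 2 * (1 # mhalf x).
Proof.
case/half_cases=> [[E nh]|E]; first by rewrite {1}E; case: (smash1_double nh).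
case: (EM (mhalf x = 0)) => [h0|nh]; last by rewrite {1}E; case: (smash1_double nh).
by rewrite h0 p2_0 E h0 mmulx0 p2_1; mring.
Qed.

Lemma lt_p2 x : x < 1 # x.
Proof.
move: x; apply: (@pind M [::]) => [| |x IH]; first by def.
  by rewrite p2_0; apply: lem_refl.
case: (EM (x = 0)) => [->|nx]; first by rewrite p2_0; apply: lem_refl.
by rewrite p2_half //; case: (halfE x) => E; mlra.
Qed.

Lemma p2_gt0 x : 1 <= 1 # x.
Proof. by have := lt_p2 x; mlra. Qed.

Lemma p2_le x : x <> 0 -> 1 # x <= 2 * x.
Proof.
suff H : x = 0 \/ 1 # x <= 2 * x by case: H.
move: x; apply: (@pind M [::]) => [| |x IH]; first by def.
  by left.
case: (EM (x = 0)) => [->|nx]; [by left | right].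
rewrite p2_half //; case: (half_cases nx) => [[E nh]|E]; first by case: IH => // IH; mlra.
by case: IH => [h0|IH]; last mlra; rewrite h0 p2_0; rewrite h0 in E; mlra.
Qed.

Lemma p2_add x y z : mlen z = mlen x + mlen y -> 1 # z = (1 # x) * (1 # y).
Proof. by rewrite ![1 # _]smashC; apply: smash_addl. Qed.

Lemma p2_le_mono x y : mlen x <= mlen y -> 1 # x <= 1 # y.
Proof.
move=> /len_msp E; rewrite (p2_add (esym E)).
by have := p2_gt0 (msp y x); mnra.
Qed.

Lemma p2S x : 1 # (2 * x).+1 = 2 * (1 # x).
Proof. by rewrite p2_half ?half_doubleS //; apply: S_neq0. Qed.

Lemma lenS x : mlen (2 * x).+1 = (mlen x).+1.
Proof.
case: (EM (x = 0)) => [->|/len_double [] //].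
by rewrite mmulx0 len0 len1.
Qed.

(** The bridge between lengths and sizes, as [1 # y] is 2 to the power |y|. *)
Lemma len_p2 x y : mlen x <= mlen y <-> x < 1 # y.
Proof.
split=> [/p2_le_mono|lt]; first by have := lt_p2 x; mlra.
case: (leq_ltm (mlen x) (mlen y)) => //; rewrite -lenS => /p2_le_mono; rewrite p2S => le.
have nx : x <> 0 by move=> E; move: le; rewrite E p2_0; have := p2_gt0 y; mlra.
by have := p2_le nx; mlra.
Qed.

Lemma len_add n x y : Log n -> mlen x <= n -> mlen y <= n -> mlen (x + y) <= n.+1.
Proof. by move=> [z ->] /len_p2 xz /len_p2 yz; rewrite -lenS; apply/len_p2; rewrite p2S; mlra. Qed.

Lemma len_mul x y : mlen (x * y) <= mlen x + mlen y.
Proof.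
have [z E] := LogD (Log_len x) (Log_len y); rewrite E; apply/len_p2; rewrite (p2_add (esym E)).
by have := lt_p2 x; have := lt_p2 y; mnra.
Qed.

(** A product loses at most one bit per factor; this gives the lower bound on the product of the B -
    r_i. *)
Lemma len_mul_ge x y : x <> 0 -> y <> 0 -> mlen x + mlen y <= (mlen (x * y)).+1.
Proof.
have [z E] := LogD (Log_len x) (Log_len y); rewrite E => /p2_le lx /p2_le ly.
case: (leq_ltm (mlen z) (mlen (x * y)).+1) => //; rewrite -!lenS => /p2_le_mono.
by rewrite !p2S (p2_add (esym E)) => le; have := lt_p2 (x * y); mnra.
Qed.

Lemma len_smash1 x : mlen (1 # x) = (mlen x).+1.
Proof. by rewrite len_smash len1 mul1m. Qed.

End Lengths.

(** * Coded sequences *)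

Definition f_sqrt : pv 1 := pbsearch (pcall f_leq [tuple pmul 'p_0 'p_0; 'p_1] : pv 2) 'p_0 [tuple 'p_0].
Definition ppair n (f g : pv n) : pv n := padd (pmul (padd f g) (padd f g)) f.
(** The code [(x + y) * (x + y) + x] lies below the square of x + y + 1, so its integer square root
    is x + y and both components can be read off. *)
Definition f_fst : pv 1 := psub 'p_0 (pmul (pcall f_sqrt [tuple 'p_0]) (pcall f_sqrt [tuple 'p_0])).
Definition f_snd : pv 1 := psub (pcall f_sqrt [tuple 'p_0]) (pcall f_fst [tuple 'p_0]).
Definition pfst n (f : pv n) : pv n := pcall f_fst [tuple f].
Definition psnd n (f : pv n) : pv n := pcall f_snd [tuple f].
Definition f_div : pv 2 := pbsearch (pcall f_leq [tuple pmul 'p_2 'p_0; 'p_1] : pv 3) 'p_0 [tuple 'p_0; 'p_1].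
Definition f_mod : pv 2 := psub 'p_0 (pmul 'p_1 (pcall f_div [tuple 'p_0; 'p_1])).
(* A number of length i, provided that i <= |w|. *)
Definition f_unlen : pv 2 :=
  pbsearch (pcall f_leq [tuple plen 'p_0; 'p_1] : pv 2) (psucc (pmul ptwo 'p_1)) [tuple 'p_0].
(** Entry i lies above i - 1 blocks, which takes a number [e] of length i - 1. The search for [e] is
    bounded by capping its length at |w|; entries from there on are 0 in any case. Index 0 yields
    0. *)
Definition f_nth : pv 2 :=
  let e := pcall f_unlen [tuple pcall f_min [tuple psub 'p_1 pone; plen 'p_0]; 'p_0] in
  pcond 'p_1 pzero
    (pcall f_mod [tuple pcall f_div [tuple psnd 'p_0; psmash e (pfst 'p_0)]; psmash pone (pfst 'p_0)]).
Definition pnth n (f g : pv n) : pv n := pcall f_nth [tuple f; g].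
Definition f_fit : pv 2 := pifle (psucc 'p_1) (psmash pone 'p_0) 'p_1 pzero.

(* Sequences defined by course-of-values recursion: the arguments of [f_seq f]
   are e, c and the remaining arguments of [f]; there are |e| entries, in
   blocks of |c| bits; an entry that does not fit is replaced with 0. *)
Definition f_blocks n (f : pv n.+2) : pv n.+2 :=
  let y : pv n.+3 := pcall f [tuple of psucc (plen 'p_0) :: ppair 'p_2 'p_1 :: prest 3 n] in
  let h : pv n.+3 := padd 'p_1 (pmul (pcall f_fit [tuple 'p_2; y]) (psmash 'p_0 'p_2)) in
  pv_limrec pzero h h (psmash 'p_0 'p_1).
Definition f_seq n (f : pv n.+2) : pv n.+2 := ppair 'p_1 (pcall (f_blocks f) [tuple of 'p_0 :: 'p_1 :: prest 2 n]).
Section Sequences.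

Local Open Scope m_scope.
Variable M : model.
Implicit Types (x y z u v w c e h l i j : M).

Definition mpair x y := (x + y) * (x + y) + x.
Definition mfst w := ap f_fst [:: w].
Definition msnd w := ap f_snd [:: w].
Definition mdiv x y := ap f_div [:: x; y].
Definition mmod x y := ap f_mod [:: x; y].
Definition mnth w i := ap f_nth [:: w; i].
Definition mfit c y := ap f_fit [:: c; y].

Lemma msub_add x y : msub (x + y) x = y.
Proof. by apply: (@addm_inj _ x); rewrite addm_sub //; apply: lem_addr. Qed.
Lemma msubS1 x : msub x.+1 1 = x.
Proof. by rewrite msuccE msub_add. Qed.

Lemma sqrtP w : let r := ap f_sqrt [:: w] in r * r <= w /\ w < r.+1 * r.+1.
Proof.
rewrite /f_sqrt /pbsearch; pvs; set f := pcall _ _.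
have fE s : ap f [:: s; w] = 0 <-> s * s <= w by rewrite /f; pvs; apply: f_leqP.
have [|||_ /fE le gt] := @bsearchP M 1%N f w [:: w] erefl.
- by apply/fE; rewrite mmulx0; apply: le0m.
- by move/fE; apply/ltm_nle; mnra.
- by move=> x y xy /fE le; apply/fE; mnra.
by split=> //; apply/ltm_nle => /fE.
Qed.

Lemma sqrt_uniq w r s : r * r <= w -> w < r.+1 * r.+1 -> s * s <= w -> w < s.+1 * s.+1 -> r = s.
Proof.
move=> r1 r2 s1 s2; apply: lem_anti; split.
  by case: (leq_ltm r s) => // lt; exfalso; mnra.
by case: (leq_ltm s r) => // lt; exfalso; mnra.
Qed.

Lemma sqrt_pair x y : ap f_sqrt [:: mpair x y] = x + y.
Proof.
have [le lt] := sqrtP (mpair x y).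
by apply: (@sqrt_uniq (mpair x y)) => //; rewrite /mpair; mnra.
Qed.

Lemma fst_pair x y : mfst (mpair x y) = x.
Proof.
rewrite /mfst /f_fst /psub; pvs; rewrite !sqrt_pair.
exact: msub_add.
Qed.

Lemma snd_pair x y : msnd (mpair x y) = y.
Proof.
rewrite /msnd /f_snd /psub; pvs; rewrite !sqrt_pair.
by rewrite -[ap f_fst _]/(mfst _) fst_pair; apply: msub_add.
Qed.

Lemma mpair_inj x y x' y' : mpair x y = mpair x' y' -> x = x' /\ y = y'.
Proof. by move=> E; rewrite -(fst_pair x y) -{2}(snd_pair x y) E fst_pair snd_pair. Qed.

Lemma divP x d : 1 <= d -> d * mdiv x d <= x /\ x < d * (mdiv x d).+1.
Proof.
move=> d1; rewrite /mdiv /f_div /pbsearch; pvs; set f := pcall _ _.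
have fE s : ap f [:: s; x; d] = 0 <-> d * s <= x by rewrite /f; pvs; apply: f_leqP.
have [|||_ /fE le gt] := @bsearchP M 2%N f x [:: x; d] erefl.
- by apply/fE; rewrite mmulx0; apply: le0m.
- by move/fE; apply/ltm_nle; mnra.
- by move=> y z yz /fE le; apply/fE; mnra.
by split=> //; apply/ltm_nle => /fE.
Qed.

Lemma mmodE x d : mmod x d = msub x (d * mdiv x d).
Proof. by rewrite /mmod /f_mod /psub; pvs. Qed.

Lemma div_mod x d : 1 <= d -> x = d * mdiv x d + mmod x d.
Proof. by move=> /(divP x) [le lt]; rewrite mmodE addm_sub. Qed.

Lemma ltm_mod x d : 1 <= d -> mmod x d < d.
Proof.
move=> d1; have := div_mod x d1; have [le lt] := divP x d1.
by rewrite mmulxS in lt; move=> E; mlra.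
Qed.

Lemma div_uniq x d q r : x = d * q + r -> r < d -> mdiv x d = q.
Proof.
move=> E rd; have d1 : 1 <= d by mlra.
have [le lt] := divP x d1; rewrite mmulxS in lt; apply: lem_anti; split.
  by case: (leq_ltm (mdiv x d) q) => // lt'; exfalso; mnra.
by case: (leq_ltm q (mdiv x d)) => // lt'; exfalso; mnra.
Qed.

Lemma mod_uniq x d q r : x = d * q + r -> r < d -> mmod x d = r.
Proof. by move=> E rd; rewrite mmodE (div_uniq E rd) E msub_add. Qed.

Lemma unlenP i w : i <= mlen w -> mlen (ap f_unlen [:: i; w]) = i.
Proof.
move=> iw; rewrite /f_unlen /pbsearch; pvs; set f := pcall _ _.
have fE s : ap f [:: s; i] = 0 <-> mlen s <= i by rewrite /f; pvs; apply: f_leqP.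
have [|||_ /fE le gt] := @bsearchP M 1%N f (2 * w).+1 [:: i] erefl.
- by apply/fE; rewrite len0; apply: le0m.
- move/fE; apply/ltm_nle; apply: lem_trans (leSS iw) _; rewrite -lenS.
  by apply: le_len; apply/leS/lem_refl.
- by move=> y z yz /fE le; apply/fE; apply: lem_trans (le_len yz) le.
apply: lem_anti; split=> //; set r := ap _ _ in le gt *.
have lt : i < mlen r.+1 by apply/ltm_nle => /fE.
have lenr : mlen r.+1 <= (mlen r).+1 by rewrite -lenS; apply: le_len; mlra.
by mlra.
Qed.

Lemma smash_ge1 x y : 1 <= x # y.
Proof. by apply/neq0_ge1 => E; have := len_smash x y; rewrite E len0 => /esym /S_neq0. Qed.

Lemma smash_mono_len x y z : mlen x <= mlen y -> x # z <= y # z.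
Proof.
move=> /len_msp /esym /smash_addl ->.
by have := smash_ge1 (msp y x) z; mnra.
Qed.

Lemma smash_ge_p2 x c : c <> 0 -> 1 # x <= x # c.
Proof.
move=> /neq0_ge1 nc; rewrite [x # c]smashC; apply: smash_mono_len.
by rewrite len1 -(len1 M); apply: le_len.
Qed.

Definition Entry w i y := exists c v e h l, w = mpair c v /\ i = (mlen e).+1 /\
  v = (h * (1 # c) + y) * (e # c) + l /\ l < e # c /\ y < 1 # c.

Lemma le_pair2 c v : v <= mpair c v.
Proof. by rewrite /mpair; case: (EM (v = 0)) => [->|/neq0_ge1]; mnra. Qed.
Lemma le_pair1 c v : c <= mpair c v.
Proof. by rewrite /mpair; mnra. Qed.

Lemma nth0 w : mnth w 0 = 0.
Proof. by rewrite /mnth /f_nth ap_pcond; pvs; rewrite cond0. Qed.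

Lemma nthE c v e : mnth (mpair c v) (mlen e).+1 = mmod (mdiv v (e # c)) (1 # c).
Proof.
rewrite /mnth /f_nth /psub /psnd /pfst ap_pcond; pvs.
rewrite cond1; last exact: S_neq0.
rewrite -![ap f_fst _]/(mfst _) -![ap f_snd _]/(msnd _) -![ap f_sub _]/(msub _ _).
rewrite fst_pair snd_pair msubS1 -![ap f_mod _]/(mmod _ _) -![ap f_div _]/(mdiv _ _).
set w := mpair c v; case: (minP (mlen e) (mlen w)).
case: (leq_ltm (mlen e) (mlen w)) => [le|lt].
  move=> -> // _; rewrite (@smash_eql _ (ap f_unlen _) e) //; exact: unlenP.
move=> _ -> ; last by apply/ltm_nle.
(* Beyond |w| all blocks are 0: if c = 0 because a block has no bits, otherwise because [u # c]
   exceeds v. *)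
have big u : mlen w <= mlen u -> mmod (mdiv v (u # c)) (1 # c) = 0.
  move=> wu; case: (EM (c = 0)) => [->|nc].
    have := @ltm_mod (mdiv v (u # 0)) (1 # 0); rewrite p2_0 => /(_ (lem_refl _)) /le_SS.
    by rewrite -[msucc 0]p2_0 => /lem0.
  have lt' : v < u # c.
    have vw : v <= w by apply: le_pair2.
    have := smash_ge_p2 u nc; have /len_p2 := wu; mlra.
  rewrite (@div_uniq v _ 0 v) //; last by mring.
  by apply: (@mod_uniq _ _ 0 0); [mring | apply: p2_gt0].
by rewrite !big //; [apply: ltm_leW | rewrite unlenP; apply: lem_refl].
Qed.

Lemma entry_nth w i y : Entry w i y -> mnth w i = y.
Proof.
move=> [c [v [e [h [l [-> [-> [E [lt yc]]]]]]]]]; rewrite nthE.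
rewrite (@div_uniq v _ (h * (1 # c) + y) l) //; last by rewrite E; mring.
by apply: (@mod_uniq _ _ h y) => //; mring.
Qed.

Lemma nth_entry c v i : 1 <= i -> Log i -> Entry (mpair c v) i (mnth (mpair c v) i).
Proof.
move=> i1 Li; have [e E] : Log (msub i 1) by apply: Log_le Li _; have := addm_sub i1; mlra.
have {Li}-> : i = (mlen e).+1 by rewrite -E msuccE addm_sub.
rewrite nthE; exists c, v, e, (mdiv (mdiv v (e # c)) (1 # c)), (mmod v (e # c)).
have d1 := smash_ge1 e c; have d2 := p2_gt0 c.
split=> //; split=> //; split; last by split; apply: ltm_mod.
rewrite {1}(div_mod v d1) {1}(div_mod (mdiv v (e # c)) d2); mring.
Qed.

Lemma entry_iff c v i y : Entry (mpair c v) i y <-> [/\ 1 <= i, Log i & y = mnth (mpair c v) i].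
Proof.
split=> [ent|[i1 Li ->]]; last exact: nth_entry.
split; last by rewrite (entry_nth ent).
  by case: ent => ? [? [e [? [? [_ [-> _]]]]]]; apply/leSS/le0m.
by case: ent => ? [? [e [? [? [_ [-> _]]]]]]; apply/LogS/Log_len.
Qed.

Lemma nth_lt c v i : mnth (mpair c v) i < 1 # c.
Proof.
rewrite /mnth /f_nth /psub /psnd /pfst ap_pcond; pvs.
case: (EM (i = 0)) => [->|ni]; first by rewrite cond0; apply: p2_gt0.
rewrite cond1 // -![ap f_fst _]/(mfst _) fst_pair.
by apply: ltm_mod; apply: p2_gt0.
Qed.

Lemma entry_le w i y : Entry w i y -> y <= w.
Proof.
move=> [c [v [e [h [l [-> [_ [E _]]]]]]]]; apply: lem_trans (le_pair2 c v).
by rewrite E; have := smash_ge1 e c; move: (h * _) (e # c) => H s s1; mnra.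
Qed.

Lemma fit_lt c y : y < 1 # c -> mfit c y = y.
Proof. by move=> lt; rewrite /mfit /f_fit ifle_le; pvs. Qed.
Lemma fit_ge c y : 1 # c <= y -> mfit c y = 0.
Proof. by move=> le; rewrite /mfit /f_fit ifle_lt; pvs => //; apply: leSS. Qed.
Lemma fit_ltp2 c y : mfit c y < 1 # c.
Proof.
by case: (leq_ltm (1 # c) y) => [/fit_ge ->|/[dup] /fit_lt -> //]; apply: p2_gt0.
Qed.

Section Rec.

Variables (n : nat) (f : pv n.+2) (c : M) (s : seq M).
Hypothesis sz : size s = n.

Definition blocks x := ap (f_blocks f) [:: x, c & s].
Definition new_entry x := mfit c (ap f [:: (mlen x).+1, mpair c (blocks x) & s]).

Let szc : size (c :: s) = (n.+1)%N. Proof. by rewrite /= sz. Qed.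

Lemma ap_ppair k (g h : pv k) t : ap (ppair g h) t = mpair (ap g t) (ap h t).
Proof. by rewrite /ppair; pvs. Qed.

Lemma blocks0 : blocks 0 = 0.
Proof.
set y : pv n.+3 := pcall f [tuple of psucc (plen 'p_0) :: ppair 'p_2 'p_1 :: prest 3 n].
set h : pv n.+3 := padd 'p_1 (pmul (pcall f_fit [tuple 'p_2; y]) (psmash 'p_0 'p_2)).
have [H _] := limrec0 pzero h h (psmash 'p_0 'p_1) szc.
by rewrite /blocks H; pvs => //; apply: le0m.
Qed.

Lemma smash_half x : x <> 0 -> x # c = (1 # c) * (mhalf x # c).
Proof. by move=> nx; apply: smash_addl; rewrite len_half // len1; mring. Qed.

Lemma blocks_min x : x <> 0 ->
  is_minm (blocks x) (blocks (mhalf x) + new_entry (mhalf x) * (mhalf x # c)) (x # c).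
Proof.
move=> nx.
set y : pv n.+3 := pcall f [tuple of psucc (plen 'p_0) :: ppair 'p_2 'p_1 :: prest 3 n].
set h : pv n.+3 := padd 'p_1 (pmul (pcall f_fit [tuple 'p_2; y]) (psmash 'p_0 'p_2)).
have := limrec_half pzero h (psmash 'p_0 'p_1) szc nx.
rewrite -[ap _ [:: x, c & s]]/(blocks x); congr (is_minm _ _ _); last by pvs.
rewrite -[ap _ [:: mhalf x, c & s]]/(blocks (mhalf x)) /h; pvs; congr (_ + mfit c _ * _).
rewrite /y -ap_pcall -[map _ _]/([:: _, _ & map _ (prest 3 n)]) map_prest ?[size _]/= ?sz //.
by rewrite ap_ppair; pvs; rewrite /= drop0.
Qed.

Lemma block_lt u v d p : u < d -> v < p -> u + v * d < p * d.
Proof. by move=> ud vp; mnra. Qed.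

Lemma blocks_lt x : blocks x < x # c.
Proof.
move: x; apply: (@pind M (c :: s)) => [| |x IH]; first by rewrite /blocks; def.
  by rewrite blocks0 smash0x; apply: lem_refl.
case: (EM (x = 0)) => [->|nx]; first by rewrite blocks0 smash0x; apply: lem_refl.
have := blocks_min nx; have := fit_ltp2 c (ap f [:: (mlen (mhalf x)).+1, mpair c (blocks (mhalf x)) & s]).
rewrite -/(new_entry (mhalf x)) (smash_half nx) => lt.
have {}lt := block_lt IH lt.
by case=> H _; rewrite H //; apply: ltm_leW lt.
Qed.

(** The limit [x # c] of the recursion is never active: a fitted entry on top of blocks below
    [mhalf x # c] stays below [x # c]. *)
Lemma blocks_half x : x <> 0 ->
  blocks x = blocks (mhalf x) + new_entry (mhalf x) * (mhalf x # c).
Proof.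
move=> nx; case: (blocks_min nx) => H _; apply: H; rewrite (smash_half nx).
have := fit_ltp2 c (ap f [:: (mlen (mhalf x)).+1, mpair c (blocks (mhalf x)) & s]).
by move=> /(block_lt (blocks_lt (mhalf x))); apply: ltm_leW.
Qed.

(** The new block is added on top. Its place value is a multiple of the place value just above entry
    j, so it only changes the high part [h] of the decomposition at j. *)
Lemma nth_blocks_half x j : j <= mlen (mhalf x) ->
  mnth (mpair c (blocks x)) j = mnth (mpair c (blocks (mhalf x))) j.
Proof.
move=> jx; case: (EM (x = 0)) => [->|nx]; first by rewrite half0.
case: (EM (j = 0)) => [->|/neq0_ge1 j1]; first by rewrite !nth0.
have [c' [v [e [h [l [/mpair_inj [<- <-] [E [Eb [le yc]]]]]]]]] :=
  nth_entry c (blocks (mhalf x)) j1 (Log_le (Log_len _) jx).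
have [r Er] : Log (msub (mlen (mhalf x)) j).
  by apply: Log_le (Log_len (mhalf x)) _; have := addm_sub jx; mlra.
have Ex : mhalf x # c = (r # c) * ((1 # c) * (e # c)).
  have [r' Er'] := LogS (Log_len e).
  have -> : (1 # c) * (e # c) = r' # c.
    by apply/esym/smash_addl; rewrite -Er' len1; mring.
  by apply: smash_addl; rewrite -Er -Er'; have := addm_sub jx; rewrite E => H; mlra.
apply: entry_nth; exists c, (blocks x), e, (h + new_entry (mhalf x) * (r # c)), l.
split=> //; split=> //; split; last by [].
by rewrite blocks_half // {1}Eb Ex; mring.
Qed.

Lemma nth_blocks_new x : x <> 0 ->
  mnth (mpair c (blocks x)) (mlen x) = new_entry (mhalf x).
Proof.
move=> nx; apply: entry_nth; exists c, (blocks x), (mhalf x), 0, (blocks (mhalf x)).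
split=> //; split; first exact: len_half.
split; last by split; [apply: blocks_lt | apply: fit_ltp2].
by rewrite blocks_half //; mring.
Qed.

End Rec.

Lemma seqE n (f : pv n.+2) e c s : size s = n ->
  ap (f_seq f) [:: e, c & s] = mpair c (blocks f c s e).
Proof.
move=> sz; rewrite /f_seq ap_ppair; pvs; congr mpair.
by rewrite map_prest /= ?sz // drop0.
Qed.

(** Course-of-values equation: [w] is the sequence at the moment when entry j was computed, and it
    agrees with the final one below j. *)
Lemma seqP n (f : pv n.+2) e c s j : size s = n -> 1 <= j -> j <= mlen e ->
  exists w, (forall i, i < j -> mnth w i = mnth (ap (f_seq f) [:: e, c & s]) i) /\
    mnth (ap (f_seq f) [:: e, c & s]) j = mfit c (ap f [:: j, w & s]).
Proof.
move=> sz j1 je.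
(* The bounds [x <= e] and [k <= mlen e] make this condition Sigma^b_1. *)
suff H : forall i, i <= mlen e -> i = 0 \/ exists x, x <= e /\
    ((forall k, k <= mlen e -> k < i -> mnth (ap (f_seq f) [:: x, c & s]) k = mnth (ap (f_seq f) [:: e, c & s]) k)
    /\ mnth (ap (f_seq f) [:: e, c & s]) i = ap f_fit [:: c; ap f [:: i, ap (f_seq f) [:: x, c & s] & s]]).
  case: (H j je) => [E|[x [_ [Hx Ej]]]]; first by move/neq0_ge1: j1.
  exists (ap (f_seq f) [:: x, c & s]); split=> // i ij; apply: Hx => //.
  exact: lem_trans (ltm_leW ij) je.
move: e {j1 je}; apply: (@pind M (c :: s)) => [| |e IH]; first by def.
  by move=> i; rewrite len0 => /lem0; left.
case: (EM (e = 0)) => [->|ne]; first by move=> i; rewrite len0 => /lem0; left.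
have He := len_half ne.
move=> i ie; case: (leq_ltm i (mlen (mhalf e))) => [le|lt].
  case: (IH i le) => [|[x [xe [Hx Ei]]]]; [by left | right].
  exists x; split; first exact: lem_trans xe (half_le e).
  split=> [k ke ki|]; last by rewrite -Ei !seqE // nth_blocks_half.
  have kh : k <= mlen (mhalf e) by mlra.
  by rewrite Hx // !seqE // [RHS]nth_blocks_half.
have Ei : i = mlen e by apply: lem_anti; split=> //; rewrite He.
right; exists (mhalf e); split; first exact: half_le.
split=> [k ke ki|]; last by rewrite !seqE // Ei nth_blocks_new // /new_entry -He.
have kh : k <= mlen (mhalf e) by mlra.
by rewrite !seqE // [RHS]nth_blocks_half.
Qed.

End Sequences.

(** * The meaning of the formulas in a model *)

Section Semantics.

Local Open Scope m_scope.
Variable M : model.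

Definition In_range (i t : M) : Prop := 1 <= i /\ i <= t.

Definition Tuple_eq (n u v : M) : Prop :=
  forall i, In_range i n -> exists y, Entry u i y /\ Entry v i y.

Definition Is_int (z : M) : Prop := z <> 1.

Definition Int_parts (z p m : M) : Prop :=
  (z = 2 * p /\ m = 0) \/ (z = (2 * m).+1 /\ p = 0 /\ m <> 0).

Definition Int_add (x y z : M) : Prop :=
  exists px mx py my pz mz,
    Int_parts x px mx /\ Int_parts y py my /\ Int_parts z pz mz /\
    pz + (mx + my) = (px + py) + mz.

Definition Int_mul (x y z : M) : Prop :=
  exists px mx py my pz mz,
    Int_parts x px mx /\ Int_parts y py my /\ Int_parts z pz mz /\
    pz + (px * my + mx * py) = (px * py + mx * my) + mz.

Definition mvar (i : M) : M := mpair 0 i.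

Definition mpar (i : M) : M := mpair 1 i.

Definition madd_gate (l r : M) : M := mpair 2 (mpair l r).

Definition mmul_gate (l r : M) : M := mpair 3 (mpair l r).

Definition mcircuit (e f c G : M) : M := mpair e (mpair f (mpair c G)).

Definition Is_circuit (N P : M) : Prop :=
  exists e f c G, P = mcircuit e f c G /\ e <> 0 /\
    (forall i, In_range i (mlen f) -> exists z, Entry c i z /\ Is_int z) /\
    (forall j, In_range j (mlen e) -> exists g, Entry G j g /\
      ((exists i, In_range i (mlen N) /\ g = mvar i) \/
       (exists i, In_range i (mlen f) /\ g = mpar i) \/
       (exists l r, 1 <= l /\ l < j /\ 1 <= r /\ r < j /\
          (g = madd_gate l r \/ g = mmul_gate l r)))).

Definition Run (leaf : M -> M -> M -> Prop) (plus times : M -> M -> M -> Prop)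
    (P v : M) : Prop :=
  exists e f c G w, P = mcircuit e f c G /\ Entry w (mlen e) v.+1 /\
    forall j x, In_range j (mlen e) -> Entry w j x.+1 ->
      exists g, Entry G j g /\
        (leaf c g x \/
         (exists l r y z, Entry w l y.+1 /\ Entry w r z.+1 /\
            ((g = madd_gate l r /\ plus y z x) \/
             (g = mmul_gate l r /\ times y z x)))).

Definition Eval (P a v : M) : Prop :=
  Run (fun c g x => (exists i, g = mvar i /\ Entry a i x) \/
                    (exists i, g = mpar i /\ Entry c i x))
      Int_add Int_mul P v.

Definition Is_max (x y z : M) : Prop := (z = x /\ y <= x) \/ (z = y /\ x <= y).

Definition Degree (u P v : M) : Prop :=
  Run (fun _ g x => (exists i, g = mvar i \/ g = mpar i) /\
                    ((g = u /\ x = 1) \/ (g <> u /\ x = 0)))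
      Is_max (fun x y z => z = x + y) P v.

Definition In_Ckt (N D P : M) : Prop :=
  Is_circuit N P /\
  (forall i, In_range i (mlen N) -> exists v, Degree (mvar i) P v /\ v <= mlen D) /\
  (exists e f c G, P = mcircuit e f c G /\
    forall i, In_range i (mlen f) -> exists v, Degree (mpar i) P v /\ v <= mlen D).

Definition In_Zn (N a : M) : Prop :=
  forall i, In_range i (mlen N) -> exists z, Entry a i z /\ Is_int z.

Definition In_S (Q z : M) : Prop := exists r, r < mlen Q /\ z = 2 * r.

Definition In_Sn (N Q b : M) : Prop :=
  forall i, In_range i (mlen N) -> exists z, Entry b i z /\ In_S Q z.

Definition In_ZPq (N Q P b : M) : Prop := In_Sn N Q b /\ Eval P b 0.

Definition mtriple (k i c : M) : M := mpair k (mpair i c).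

Definition In_C (N D Q x : M) : Prop :=
  exists k i c, x = mtriple k i c /\ In_range k (mlen N) /\ In_range i (mlen D) /\
    forall j, 1 <= j -> j < mlen N -> exists z, Entry c j z /\ In_S Q z.

Definition Is_hybrid (N b k z a h : M) : Prop :=
  forall j, In_range j (mlen N) -> exists y, Entry h j y /\
    (j < k -> Entry b j y) /\ (j = k -> y = z) /\ (k < j -> Entry a j y).

Definition Hybrid_zero (N P b k z a : M) : Prop :=
  exists h, Is_hybrid N b k z a h /\ Eval P h 0.

Definition Root_list (N Q P b k a m w : M) : Prop :=
  m <= mlen Q /\
  (forall j, In_range j m ->
     exists z, Entry w j z /\ In_S Q z /\ Hybrid_zero N P b k z a) /\
  (forall j, 1 <= j -> j < m ->
     exists y z, Entry w j y /\ Entry w j.+1 z /\ y < z) /\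
  (forall z, In_S Q z -> Hybrid_zero N P b k z a ->
     exists j, In_range j m /\ Entry w j z).

Definition Switch (N P a b k : M) : Prop :=
  exists y z, Entry a k y /\ Entry b k z /\
    ~ Hybrid_zero N P b k y a /\ Hybrid_zero N P b k z a.

Definition Enc_default (N x : M) : Prop :=
  exists c, x = mtriple 1 1 c /\
    forall j, 1 <= j -> j < mlen N -> Entry c j 0.

Definition Is_delete (N k b c : M) : Prop :=
  forall j, 1 <= j -> j < mlen N -> exists y, Entry c j y /\
    (j < k -> Entry b j y) /\ (k <= j -> Entry b j.+1 y).

Definition Is_insert (N k r c y : M) : Prop :=
  forall j, In_range j (mlen N) -> exists z, Entry y j z /\
    (j < k -> Entry c j z) /\ (j = k -> z = r) /\
    (forall i, k < j -> j = i.+1 -> Entry c i z).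

Definition Is_zero_tuple (N y : M) : Prop :=
  forall j, In_range j (mlen N) -> Entry y j 0.

Definition Enc_graph (N D Q P a b x : M) : Prop :=
  (~ (~ Eval P a 0 /\ Eval P b 0) /\ Enc_default N x) \/
  ((~ Eval P a 0 /\ Eval P b 0) /\
   exists k, In_range k (mlen N) /\ Switch N P a b k /\
     (forall j, 1 <= j -> j < k -> ~ Switch N P a b j) /\
     exists m w z i, Root_list N Q P b k a m w /\
       Entry b k z /\ In_range i m /\ Entry w i z /\
       ((mlen D < i /\ Enc_default N x) \/
        (i <= mlen D /\ exists c, x = mtriple k i c /\ Is_delete N k b c))).

Definition Dec_graph (N Q P a k i c y : M) : Prop :=
  (Eval P a 0 /\ Is_zero_tuple N y) \/
  (~ Eval P a 0 /\
   exists m w, Root_list N Q P c k a m w /\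
     ((m < i /\ Is_zero_tuple N y) \/
      (i <= m /\ exists r, Entry w i r /\ Is_insert N k r c y))).

Definition Ev_spec (ev : pv 4) : Prop :=
  forall N D P a, In_Ckt N D P -> In_Zn N a ->
    Eval P a (ap ev [:: N; D; P; a]).

Definition Enc_spec (enc : pv 6) : Prop :=
  forall N D Q P a b, In_Ckt N D P -> In_Zn N a -> In_Sn N Q b ->
    Enc_graph N D Q P a b (ap enc [:: N; D; Q; P; a; b]).

Definition Dec_spec (dec : pv 6) : Prop :=
  forall N D Q P a k i c, In_Ckt N D P -> In_Zn N a -> In_C N D Q (mtriple k i c) ->
    Dec_graph N Q P a k i c (ap dec [:: N; D; Q; P; a; mtriple k i c]).

Definition Schwartz_zippel (enc dec : pv 6) : Prop :=
  forall N D Q P, In_Ckt N D P ->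
    (forall a, In_Zn N a -> Eval P a 0) \/
    (forall a, In_Zn N a -> ~ Eval P a 0 ->
      (forall x, In_C N D Q x -> 1 <= mlen Q ->
         In_Sn N Q (ap dec [:: N; D; Q; P; a; x])) /\
      (forall b, In_ZPq N Q P b ->
         exists x, In_C N D Q x /\
           Tuple_eq (mlen N) (ap dec [:: N; D; Q; P; a; x]) b) /\
      (forall b, In_ZPq N Q P b ->
         In_C N D Q (ap enc [:: N; D; Q; P; a; b]) /\
         Tuple_eq (mlen N)
           (ap dec [:: N; D; Q; P; a; ap enc [:: N; D; Q; P; a; b]]) b)).

End Semantics.

Ltac td_call := simple apply TD_call; cbn [TDs tval tuple].
Ltac tdc := solve [repeat first
  [ assumption | simple apply TD_zero | simple apply TD_succ | simple apply TD_half
  | simple apply TD_len | simple apply TD_add | simple apply TD_mul | simple apply TD_smash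
  | split | td_call | simple apply TD_cons ]].
Ltac fd_spec := repeat first
  [ simple apply FD_bot | simple apply FD_eq; [tdc|tdc] | simple apply FD_le; [tdc|tdc]
  | simple apply FD_neg | simple apply FD_and | simple apply FD_or
  | simple apply FD_all; intros ? ? ? | simple apply FD_ex; intros ? ? ? | simple apply FD_imp ].
Ltac unfold_spec := unfold Defs.schwartz_zippel, Defs.dec_spec, Defs.enc_spec, Defs.ev_spec,
  Defs.dec_graph, Defs.enc_graph, Defs.is_zero_tuple, Defs.is_insert, Defs.is_delete,
  Defs.enc_default, Defs.switch, Defs.root_list, Defs.hybrid_zero, Defs.is_hybrid, Defs.in_C,
  Defs.triple, Defs.in_ZPq, Defs.in_Sn, Defs.in_S, Defs.in_Zn, Defs.in_Ckt, Defs.degree,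
  Defs.is_max, Defs.eval, Defs.run, Defs.is_circuit, Defs.circuit_code, Defs.mul_gate,
  Defs.add_gate, Defs.par_gate, Defs.var_gate, Defs.int_mul, Defs.int_add, Defs.int_parts,
  Defs.is_int, Defs.tuple_eq, Defs.in_range, Defs.entry, Defs.cpair, Defs.three, Defs.two, Defs.one,
  Schwartz_zippel, Dec_spec, Enc_spec, Ev_spec, Dec_graph, Enc_graph, Is_zero_tuple, Is_insert,
  Is_delete, Enc_default, Switch, Root_list, Hybrid_zero, Is_hybrid, In_C, mtriple, In_ZPq, In_Sn,
  In_S, In_Zn, In_Ckt, Degree, Is_max, Eval, Run, Is_circuit, mcircuit, mmul_gate, madd_gate, mpar,
  mvar, Int_mul, Int_add, Int_parts, Is_int, Tuple_eq, In_range, Entry, mpair.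

Lemma FD_spec_ev (M : model) env ev : FD (M := M) env (ev_spec ev) [::] (Ev_spec M ev).
Proof. unfold_spec; fd_spec. Qed.
Lemma FD_spec_enc (M : model) env enc : FD (M := M) env (enc_spec enc) [::] (Enc_spec M enc).
Proof. unfold_spec; fd_spec. Qed.
Lemma FD_spec_dec (M : model) env dec : FD (M := M) env (dec_spec dec) [::] (Dec_spec M dec).
Proof. unfold_spec; fd_spec. Qed.
Lemma FD_spec_sz (M : model) env enc dec :
  FD (M := M) env (schwartz_zippel enc dec) [::] (Schwartz_zippel M enc dec).
Proof. unfold_spec; fd_spec. Qed.

(** Once [X M] is known to be the meaning of the sentence in M, all that remains is mathematics
    inside an arbitrary model. *)
Lemma S12_complete (A : hform) (X : model -> Prop) :
  (forall (M : model) env, FD (M := M) env A [::] (X M)) -> (forall M, X M) -> S12_proves A.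
Proof.
move=> AX valid; apply: completeness S12_subst _ => S modelS r.
exact: (proj2 (AX (@Model S modelS) r) (valid _)).
Qed.

(** * Integer codes *)

Definition f_pos : pv 1 := pcond (pcall f_parity [tuple 'p_0]) (phalf 'p_0) pzero.
Definition f_neg : pv 1 := pcond (pcall f_parity [tuple 'p_0]) pzero (phalf 'p_0).
Definition f_norm : pv 2 :=
  pifle 'p_1 'p_0 (pmul ptwo (psub 'p_0 'p_1)) (psucc (pmul ptwo (psub 'p_1 'p_0))).
Definition ppos n (f : pv n) : pv n := pcall f_pos [tuple f].
Definition pneg n (f : pv n) : pv n := pcall f_neg [tuple f].
Definition f_iadd : pv 2 :=
  pcall f_norm [tuple padd (ppos 'p_0) (ppos 'p_1); padd (pneg 'p_0) (pneg 'p_1)].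
Definition f_imul : pv 2 :=
  pcall f_norm [tuple padd (pmul (ppos 'p_0) (ppos 'p_1)) (pmul (pneg 'p_0) (pneg 'p_1));
                      padd (pmul (ppos 'p_0) (pneg 'p_1)) (pmul (pneg 'p_0) (ppos 'p_1))].

Section IntegerCodes.

Local Open Scope m_scope.
Variable M : model.
Implicit Types (x y z p m : M).

Definition mpos x := ap f_pos [:: x].
Definition mneg x := ap f_neg [:: x].
Definition miadd x y := ap f_iadd [:: x; y].
Definition mimul x y := ap f_imul [:: x; y].
Definition mval x : zint M := (iz (mpos x) - iz (mneg x))%R.

Lemma pos_even p : mpos (2 * p) = p.
Proof. by rewrite /mpos /f_pos ap_pcond; pvs; rewrite parity_even cond0 half_double. Qed.
Lemma neg_even p : mneg (2 * p) = 0.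
Proof. by rewrite /mneg /f_neg ap_pcond; pvs; rewrite parity_even cond0. Qed.
Lemma pos_odd m : mpos (2 * m).+1 = 0.
Proof. by rewrite /mpos /f_pos ap_pcond; pvs; rewrite parity_odd cond1 //; apply: S_neq0. Qed.
Lemma neg_odd m : mneg (2 * m).+1 = m.
Proof. by rewrite /mneg /f_neg ap_pcond; pvs; rewrite parity_odd cond1 ?half_doubleS //; apply: S_neq0. Qed.

Lemma Int_partsP z p m : Int_parts z p m <-> [/\ Is_int z, p = mpos z & m = mneg z].
Proof.
split=> [[[-> ->]|[-> [-> nm]]]|[nz -> ->]].
- split; rewrite ?pos_even ?neg_even // => E.
  by have := half_doubleS (0 : M); rewrite mmulx0 -E half_double => p0; move: E; rewrite p0 mmulx0 => /esym /S_neq0.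
- split; rewrite ?pos_odd ?neg_odd // => /S_inj E.
  by apply: nm; mlra.
case: (halfE z); move: (mhalf z) => h E; rewrite E in nz *; [left | right].
  by rewrite pos_even neg_even.
rewrite pos_odd neg_odd; do 2 split=> //; move=> h0.
by apply: nz; rewrite h0 mmulx0.
Qed.

Lemma mval_inj x y : Is_int x -> Is_int y -> mval x = mval y -> x = y.
Proof.
have even x' y' : mval (2 * x') = mval (2 * y') -> x' = y'.
  by rewrite /mval !pos_even !neg_even => E; apply: iz_inj; lra.
have odd x' y' : mval (2 * x').+1 = mval (2 * y').+1 -> x' = y'.
  by rewrite /mval !pos_odd !neg_odd => E; apply: iz_inj; lra.
have mix x' y' : Is_int (2 * y').+1 -> mval (2 * x') <> mval (2 * y').+1.
  rewrite /mval /Is_int pos_even neg_even pos_odd neg_odd => ny E; apply: ny.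
  have -> : y' = 0 by apply: iz_inj; have := iz_ge0 x'; have := iz_ge0 y'; rewrite !iz0 in E *; lra.
  by rewrite mmulx0.
case: (halfE x) => ->; case: (halfE y) => -> nx ny.
- by move/even ->.
- by move/(mix _ _ ny).
- by move/esym/(mix _ _ nx).
- by move/odd ->.
Qed.

(** Half of a code is the absolute value of the coded integer; sizes of integers are measured by
    it. *)
Lemma mval_half x : mval x = iz (mhalf x) \/ mval x = (- iz (mhalf x))%R.
Proof.
case: (halfE x); move: (mhalf x) => h ->; rewrite /mval ?pos_even ?neg_even ?pos_odd ?neg_odd iz0.
  by left; lra.
by right; lra.
Qed.

Lemma Int_addP x y z : Int_add x y z <->
  [/\ Is_int x, Is_int y, Is_int z & mval z = (mval x + mval y)%R].
Proof.
split=> [[px [mx [py [my [pz [mz]]]]]]|[ix iy iz_ E]].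
  move=> [/Int_partsP [ix -> ->] [/Int_partsP [iy -> ->] [/Int_partsP [iz_ -> ->]]]].
  by move/iz_eqE; rewrite !izD /mval => E; split=> //; lra.
exists (mpos x), (mneg x), (mpos y), (mneg y), (mpos z), (mneg z).
do 3 (split; first exact/Int_partsP).
by apply: iz_inj; move: E; rewrite /mval !izD => E; lra.
Qed.

Lemma Int_mulP x y z : Int_mul x y z <->
  [/\ Is_int x, Is_int y, Is_int z & mval z = (mval x * mval y)%R].
Proof.
split=> [[px [mx [py [my [pz [mz]]]]]]|[ix iy iz_ E]].
  move=> [/Int_partsP [ix -> ->] [/Int_partsP [iy -> ->] [/Int_partsP [iz_ -> ->]]]].
  by move/iz_eqE; rewrite !(izD, izM) /mval => E; split=> //; nra.
exists (mpos x), (mneg x), (mpos y), (mneg y), (mpos z), (mneg z).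
do 3 (split; first exact/Int_partsP).
by apply: iz_inj; move: E; rewrite /mval !(izD, izM) => E; nra.
Qed.

Lemma norm_int p m : Is_int (ap f_norm [:: p; m]) /\ mval (ap f_norm [:: p; m]) = (iz p - iz m)%R.
Proof.
rewrite /f_norm /psub; case: (leq_ltm m p) => [le|lt].
  rewrite ifle_le; pvs => //; set s := ap f_sub _; have E : m + s = p by apply: addm_sub.
  have [i _ _] : [/\ Is_int (2 * s), s = mpos (2 * s) & 0 = mneg (2 * s)].
    by apply/Int_partsP; left.
  by split=> //; rewrite /mval pos_even neg_even -E izD iz0; ring.
rewrite ifle_lt; pvs => //; set s := ap f_sub _; have E : p + s = m by apply/addm_sub/ltm_leW.
have ns : s <> 0 by move=> s0; move: lt; rewrite -E s0 => lt; mlra.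
have [i _ _] : [/\ Is_int (2 * s).+1, 0 = mpos (2 * s).+1 & s = mneg (2 * s).+1].
  by apply/Int_partsP; right.
by split=> //; rewrite /mval pos_odd neg_odd -E izD iz0; ring.
Qed.

Lemma iadd_int x y : Is_int x -> Is_int y -> Int_add x y (miadd x y).
Proof.
move=> ix iy; apply/Int_addP; rewrite /miadd /f_iadd /ppos /pneg; pvs.
have [i ->] := norm_int (mpos x + mpos y) (mneg x + mneg y).
by split=> //; rewrite /mval !izD; ring.
Qed.

Lemma imul_int x y : Is_int x -> Is_int y -> Int_mul x y (mimul x y).
Proof.
move=> ix iy; apply/Int_mulP; rewrite /mimul /f_imul /ppos /pneg; pvs.
have [i ->] := norm_int (mpos x * mpos y + mneg x * mneg y) (mpos x * mneg y + mneg x * mpos y).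
by split=> //; rewrite /mval !(izD, izM); ring.
Qed.

Lemma int_even x : Is_int (2 * x).
Proof. by case/Int_partsP: (or_introl (conj erefl erefl) : Int_parts (2 * x) x 0). Qed.

Lemma int0 : Is_int (0 : M).
Proof. by move=> /esym /S_neq0. Qed.

Lemma mval_even x : mval (2 * x) = iz x.
Proof. by rewrite /mval pos_even neg_even iz0; ring. Qed.

Lemma mval0 : mval (0 : M) = 0%R.
Proof. by rewrite -(mmulx0 (2 : M)) mval_even. Qed.

Lemma mval_eq0 x : Is_int x -> mval x = 0%R <-> x = 0.
Proof.
by move=> ix; split=> [E|->]; [apply: mval_inj => //; rewrite ?mval0 //; apply: int0 | apply: mval0].
Qed.

Lemma half_iadd x y z : Int_add x y z -> mhalf z <= mhalf x + mhalf y.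
Proof.
case/Int_addP => _ _ _; have := iz_ge0 (mhalf x); have := iz_ge0 (mhalf y).
by case: (mval_half x) => ->; case: (mval_half y) => ->; case: (mval_half z) => -> *; apply/iz_le; rewrite izD; lra.
Qed.

Lemma half_imul x y z : Int_mul x y z -> mhalf z = mhalf x * mhalf y.
Proof.
case/Int_mulP => _ _ _; have := iz_ge0 (mhalf x); have := iz_ge0 (mhalf y); have := iz_ge0 (mhalf z).
by case: (mval_half x) => ->; case: (mval_half y) => ->; case: (mval_half z) => -> *; apply: iz_inj; rewrite izM; nra.
Qed.

(* The bound on the quotient makes this a Sigma^b_1 condition. *)
Definition Cong m x y :=
  exists s, s <= mpos x + mneg y + (mpos y + mneg x) /\
    (mpos x + mneg y = mpos y + mneg x + m * s \/ mpos y + mneg x = mpos x + mneg y + m * s).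

Lemma CongP m x y : Cong m x y <-> exists S, (mval x - mval y = iz m * S)%R.
Proof.
split=> [[s [_ [/iz_eqE|/iz_eqE]]]|[S]].
- by rewrite !(izD, izM) => E; exists (iz s); rewrite /mval; lra.
- by rewrite !(izD, izM) => E; exists (- iz s)%R; rewrite /mval; lra.
(* For m = 0 the given quotient is arbitrary and is replaced with 0. For m >= 1 the bound follows
   from s <= m * s. *)
case: (EM (m = 0)) => [->|nm].
  rewrite GRing.mul0r /mval => E; exists 0; split; first exact: le0m.
  by left; rewrite mmulx0 maddx0; apply: iz_inj; rewrite !izD; lra.
have m1 : (1 <= iz m)%R by have /neq0_ge1 /iz_leE := nm; rewrite izS iz0; lra.
have := iz_ge0 (mpos x); have := iz_ge0 (mpos y); have := iz_ge0 (mneg x); have := iz_ge0 (mneg y).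
case: (zint_cases S) => [[s ->]|[s _ ->]] p1 p2 p3 p4; rewrite /mval => E; exists s; have s0 := iz_ge0 s.
  have E' : mpos x + mneg y = mpos y + mneg x + m * s.
    by apply: iz_inj; rewrite !(izD, izM); lra.
  by split; [rewrite E'; apply/iz_le; rewrite !(izD, izM); nra | left].
have E' : mpos y + mneg x = mpos x + mneg y + m * s.
  by apply: iz_inj; rewrite !(izD, izM); lra.
by split; [rewrite E'; apply/iz_le; rewrite !(izD, izM); nra | right].
Qed.

Lemma Cong_refl m x : Cong m x x.
Proof. by apply/CongP; exists 0%R; ring. Qed.

Lemma Cong0 x y : Is_int x -> Is_int y -> Cong 0 x y -> x = y.
Proof. by move=> ix iy /CongP [S]; rewrite iz0 => E; apply: mval_inj => //; lra. Qed.

Lemma Cong_add m x y z x' y' z' : Int_add x y z -> Int_add x' y' z' ->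
  Cong m x x' -> Cong m y y' -> Cong m z z'.
Proof.
move=> /Int_addP [_ _ _ E] /Int_addP [_ _ _ E'] /CongP [S ES] /CongP [S' ES'].
by apply/CongP; exists (S + S')%R; rewrite E E'; lra.
Qed.

Lemma Cong_mul m x y z x' y' z' : Int_mul x y z -> Int_mul x' y' z' ->
  Cong m x x' -> Cong m y y' -> Cong m z z'.
Proof.
move=> /Int_mulP [_ _ _ E] /Int_mulP [_ _ _ E'] /CongP [S ES] /CongP [S' ES'].
apply/CongP; exists (S * mval y + mval x' * S')%R; rewrite E E'.
transitivity ((mval x - mval x') * mval y + mval x' * (mval y - mval y'))%R; first by ring.
by rewrite ES ES'; ring.
Qed.

End IntegerCodes.

(** * Evaluation of circuits *)

(* The arguments are j, w, G and the remaining arguments of [leaf], [plus] and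
   [times]; entry j of the trace is computed from the earlier entries w. *)
Definition f_gate n (leaf : pv n.+1) (plus times : pv n.+2) : pv n.+3 :=
  let g := pnth 'p_2 'p_0 in
  let l := pnth 'p_1 (pfst (psnd g)) in
  let r := pnth 'p_1 (psnd (psnd g)) in
  pifle (pfst g) pone (pcall leaf [tuple of g :: prest 3 n])
    (pifle (pfst g) ptwo (pcall plus [tuple of l :: r :: prest 3 n])
       (pcall times [tuple of l :: r :: prest 3 n])).
Definition f_trace n (leaf : pv n.+1) (plus times : pv n.+2) : pv n.+3 :=
  f_seq (f_gate leaf plus times).

(* In a value trace x + 1 stands for the value x, and 0 for "not computed". *)
Definition f_value_leaf : pv 3 :=
  pcond (pfst 'p_0) (psucc (pnth 'p_2 (psnd 'p_0))) (psucc (pnth 'p_1 (psnd 'p_0))).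
Definition f_value_op (op : pv 2) : pv 4 :=
  pcond 'p_0 pzero (pcond 'p_1 pzero
    (psucc (pcall op [tuple psub 'p_0 pone; psub 'p_1 pone]))).
Definition f_value_trace : pv 5 := f_trace f_value_leaf (f_value_op f_iadd) (f_value_op f_imul).

(* The total degree in the first m1 variables and m2 constants, capped at K; the
   arguments after those of the gate are m1, m2 and K. *)
Definition f_degree_leaf : pv 4 :=
  pcond (pfst 'p_0) (pifle (psnd 'p_0) 'p_1 pone pzero) (pifle (psnd 'p_0) 'p_2 pone pzero).
Definition f_degree_plus : pv 5 := pifle 'p_0 'p_1 'p_1 'p_0.
Definition f_degree_times : pv 5 := pcall f_min [tuple padd 'p_0 'p_1; 'p_4].
Definition f_degree_trace : pv 6 := f_trace f_degree_leaf f_degree_plus f_degree_times.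

Section Circuits.

Local Open Scope m_scope.
Variable M : model.
Implicit Types (x y z u v w g i j l r : M).

Lemma fst_var i : mfst (mvar i) = 0. Proof. exact: fst_pair. Qed.
Lemma fst_par i : mfst (mpar i) = 1. Proof. exact: fst_pair. Qed.
Lemma fst_add l r : mfst (madd_gate l r) = 2. Proof. exact: fst_pair. Qed.
Lemma fst_mul l r : mfst (mmul_gate l r) = 3. Proof. exact: fst_pair. Qed.

Lemma ge1S x : 1 <= x -> exists y, x = y.+1.
Proof. by move=> x1; exists (msub x 1); rewrite msuccE addm_sub. Qed.

Lemma fit_le C y : mfit C y <= y.
Proof.
by case: (leq_ltm (1 # C) y) => [/fit_ge ->|/fit_lt ->]; [apply: le0m | apply: lem_refl].
Qed.

Variables (N e f c G : M).

Definition op_gate j l r g := [/\ 1 <= l, l < j, 1 <= r & r < j] /\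
  (g = madd_gate l r \/ g = mmul_gate l r).
Definition gate_kind j g :=
  (exists i, In_range i (mlen N) /\ g = mvar i) \/
  (exists i, In_range i (mlen f) /\ g = mpar i) \/ (exists l r, op_gate j l r g).

Hypothesis gateP : forall j, In_range j (mlen e) ->
  Entry G j (mnth G j) /\ gate_kind j (mnth G j).
Hypothesis constP : forall i, In_range i (mlen f) -> Entry c i (mnth c i) /\ Is_int (mnth c i).

Section Trace.

Variables (n : nat) (leaf : pv n.+1) (plus times : pv n.+2) (C : M) (s : seq M).
Hypothesis sz : size s = n.
Local Notation W := (ap (f_trace leaf plus times) [:: e, C, G & s]).

Lemma traceE j : In_range j (mlen e) -> exists w, (forall i, i < j -> mnth w i = mnth W i) /\
  mnth W j = mfit C (ap (f_gate leaf plus times) [:: j, w, G & s]).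
Proof. by move=> [j1 je]; apply: seqP => //=; rewrite sz. Qed.

Lemma map_prest3 w j : [seq ap p [:: j, w, G & s] | p <- prest 3 n] = s.
Proof. by rewrite map_prest /= ?sz // drop0. Qed.

Lemma trace_leaf j : In_range j (mlen e) -> mfst (mnth G j) <= 1 ->
  mnth W j = mfit C (ap leaf (mnth G j :: s)).
Proof.
move=> jr g1; have [w [_ ->]] := traceE jr; congr (mfit C _).
rewrite /f_gate ifle_le /pfst /psnd /pnth; pvs => //.
rewrite map_prest3; congr (ap leaf (_ :: _)); by pvs.
Qed.

Lemma trace_add j l r : In_range j (mlen e) -> l < j -> r < j -> mnth G j = madd_gate l r ->
  mnth W j = mfit C (ap plus [:: mnth W l, mnth W r & s]).
Proof.
move=> jr lj rj g; have [w [Hw ->]] := traceE jr; rewrite -(Hw l lj) -(Hw r rj); congr (mfit C _).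
have f2 := fst_add l r; rewrite /f_gate ifle_lt /pfst /psnd /pnth; pvs; last first.
  by rewrite -[ap f_nth _]/(mnth _ _) -[ap f_fst _]/(mfst _) g f2; apply: lem_refl.
rewrite ifle_le; pvs; last first.
  by rewrite -[ap f_nth _]/(mnth _ _) -[ap f_fst _]/(mfst _) g f2; apply: lem_refl.
rewrite map_prest3; congr (ap plus [:: _, _ & _]); pvs;
  rewrite -![ap f_nth [:: G; _]]/(mnth _ _) g -[ap f_snd [:: madd_gate l r]]/(msnd _) /madd_gate snd_pair.
  by rewrite -[ap f_fst _]/(mfst _) fst_pair.
by rewrite -[ap f_snd _]/(msnd _) snd_pair.
Qed.

Lemma trace_mul j l r : In_range j (mlen e) -> l < j -> r < j -> mnth G j = mmul_gate l r ->
  mnth W j = mfit C (ap times [:: mnth W l, mnth W r & s]).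
Proof.
move=> jr lj rj g; have [w [Hw ->]] := traceE jr; rewrite -(Hw l lj) -(Hw r rj); congr (mfit C _).
have f3 := fst_mul l r; rewrite /f_gate ifle_lt /pfst /psnd /pnth; pvs; last first.
  by rewrite -[ap f_nth _]/(mnth _ _) -[ap f_fst _]/(mfst _) g f3; apply/leS/lem_refl.
rewrite ifle_lt; pvs; last first.
  by rewrite -[ap f_nth _]/(mnth _ _) -[ap f_fst _]/(mfst _) g f3; apply: lem_refl.
rewrite map_prest3; congr (ap times [:: _, _ & _]); pvs;
  rewrite -![ap f_nth [:: G; _]]/(mnth _ _) g -[ap f_snd [:: mmul_gate l r]]/(msnd _) /mmul_gate snd_pair.
  by rewrite -[ap f_fst _]/(mfst _) fst_pair.
by rewrite -[ap f_snd _]/(msnd _) snd_pair.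
Qed.

End Trace.

(** The condition of [Run] on one entry, with the operands known to be earlier gates. [Run] leaves
    this to the form of the circuit, but induction along the gates relies on it. *)
Definition TR (leaf : M -> M -> Prop) (plus times : M -> M -> M -> Prop) w j :=
  mnth w j = 0 \/ exists x, mnth w j = x.+1 /\
    (leaf (mnth G j) x \/
     exists l r y z, [/\ 1 <= l, l < j, 1 <= r & r < j] /\ mnth w l = y.+1 /\ mnth w r = z.+1 /\
       ((mnth G j = madd_gate l r /\ plus y z x) \/ (mnth G j = mmul_gate l r /\ times y z x))).

Lemma num_neq : [/\ 0 <> 1 :> M, 0 <> 2 :> M, 0 <> 3 :> M & [/\ 1 <> 2 :> M, 1 <> 3 :> M & 2 <> 3 :> M]].
Proof.
have n0 x : 0 <> x.+1 by move=> /esym /S_neq0.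
split; [exact: n0 | exact: n0 | exact: n0 |].
by split; [move=> /S_inj /n0 | move=> /S_inj /n0 | move=> /S_inj /S_inj /n0].
Qed.

Lemma op_gate_uniq j l r l' r' g : op_gate j l r g ->
  g = madd_gate l' r' \/ g = mmul_gate l' r' -> [/\ 1 <= l', l' < j, 1 <= r' & r' < j].
Proof.
have [n01 n02 n03 [n12 n13 n23]] := num_neq.
by move=> [H [->|->]] [] /mpair_inj [E] => [/mpair_inj [<- <-]|_|_|/mpair_inj [<- <-]] //;
  case: n23; rewrite // E.
Qed.

Lemma gate_op j l r : In_range j (mlen e) ->
  mnth G j = madd_gate l r \/ mnth G j = mmul_gate l r -> [/\ 1 <= l, l < j, 1 <= r & r < j].
Proof.
have [n01 n02 n03 [n12 n13 n23]] := num_neq.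
move=> /gateP [_ [[i [_ ->]]|[[i [_ ->]]|[l' [r' op]]]]]; last exact: op_gate_uniq op.
  by case=> /mpair_inj [].
by case=> /mpair_inj [].
Qed.

Lemma Run_TR leaf plus times v : Run leaf plus times (mcircuit e f c G) v ->
  exists w, mnth w (mlen e) = v.+1 /\ forall j, In_range j (mlen e) -> TR (leaf c) plus times w j.
Proof.
move=> [e' [f' [c' [G' [w [/mpair_inj [<- /mpair_inj [_ /mpair_inj [<- <-]]] [out all]]]]]]].
exists w; split=> [|j jr]; first exact: entry_nth out.
case: (EM (mnth w j = 0)) => [|/neq0_ge1 /ge1S [x Ex]]; [by left | right; exists x; split=> //].
have wj : Entry w j x.+1.
  case: out => C [V [? [? [? [Ew _]]]]]; rewrite Ew in Ex *; apply/entry_iff; split=> //; first by case: jr.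
  by apply: Log_le (Log_len e) _; case: jr.
have [g [/entry_nth <- [H|[l [r [y [z [/entry_nth El [/entry_nth Er H]]]]]]]]] := all j x jr wj; [by left | right].
exists l, r, y, z; split; last by [].
by apply: gate_op => //; case: H => -[->]; [left | right].
Qed.

Lemma TR_Run leaf plus times C V v : e <> 0 -> let w := mpair C V in
  mnth w (mlen e) = v.+1 -> (forall j, In_range j (mlen e) -> TR (leaf c) plus times w j) ->
  Run leaf plus times (mcircuit e f c G) v.
Proof.
move=> ne w out all; exists e, f, c, G, w; split=> //.
have ent j : In_range j (mlen e) -> Entry w j (mnth w j).
  by move=> [j1 je]; apply: nth_entry => //; apply: Log_le (Log_len e) _.
have oute : In_range (mlen e) (mlen e).
  by split; [apply/neq0_ge1 => /len_eq0 | apply: lem_refl].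
split; first by rewrite -out; apply: ent.
move=> j x jr /entry_nth Ex; have [Gj _] := gateP jr; exists (mnth G j); split=> //.
case: (all j jr) => [E|[x' [Ex' H]]]; first by move: Ex; rewrite E => /esym /S_neq0.
have E' : x' = x by apply: S_inj; rewrite -Ex -Ex'.
move: H; rewrite E' => H.
case: H => [|[l [r [y [z [[l1 lj r1 rj] [El [Er H]]]]]]]]; [by left | right].
have je : j <= mlen e by case: jr.
exists l, r, y, z; rewrite -El -Er; split; last split=> //.
  by apply: ent; split=> //; apply: lem_trans (ltm_leW lj) je.
by apply: ent; split=> //; apply: lem_trans (ltm_leW rj) je.
Qed.

End Circuits.

(** * Total and individual degrees *)

Section CircuitBounds.

Local Open Scope m_scope.
Variable M : model.
Implicit Types (x y z u v w g i j l r a : M).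

Lemma leaf_cases N f j g : gate_kind N f j g ->
  (exists i, In_range i (mlen N) /\ g = mvar i) \/
  (exists i, In_range i (mlen f) /\ g = mpar i) \/
  (exists l r, [/\ 1 <= l, l < j, 1 <= r & r < j] /\ g = madd_gate l r) \/
  (exists l r, [/\ 1 <= l, l < j, 1 <= r & r < j] /\ g = mmul_gate l r).
Proof.
case=> [H|[H|[l [r [b [H|H]]]]]]; [by left | by right; left | right; right; left | right; right; right];
by exists l, r.
Qed.

Variables (N e f c G : M).
Hypothesis gateP : forall j, In_range j (mlen e) ->
  Entry G j (mnth G j) /\ gate_kind N f j (mnth G j).

Lemma range_lt j l : In_range j (mlen e) -> 1 <= l -> l < j -> In_range l (mlen e).
Proof. by move=> [j1 je] l1 lj; split=> //; apply: lem_trans (ltm_leW lj) je. Qed.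

Section Degrees.

Variable K : M.
Hypothesis K1 : 1 <= K.

(** [K] is both the cap and the block code, since numbers up to [K] fit in |K| bits. A cap is set
    because the degree hypothesis concerns the output only and other gates may exceed any bound
    derived from it. *)
Definition dtrace m1 m2 := ap f_degree_trace [:: e; K; G; m1; m2; K].
Definition weight m1 m2 g := ap f_degree_leaf [:: g; m1; m2; K].

Lemma weight_le1 m1 m2 g : weight m1 m2 g <= 1.
Proof.
rewrite /weight /f_degree_leaf ap_pcond; case: (EM (ap (pfst (parg 4 0)) [:: g; m1; m2; K] = 0)) => [->|nt]; rewrite ?cond0 ?cond1 //.
  case: (leq_ltm (msnd g) m1) => H; first by rewrite ifle_le /psnd; pvs => //; apply: lem_refl.
  by rewrite ifle_lt /psnd; pvs => //; apply: le0m.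
case: (leq_ltm (msnd g) m2) => H; first by rewrite ifle_le /psnd; pvs => //; apply: lem_refl.
by rewrite ifle_lt /psnd; pvs => //; apply: le0m.
Qed.

Lemma weight_var m1 m2 i : (i <= m1 -> weight m1 m2 (mvar i) = 1) /\ (m1 < i -> weight m1 m2 (mvar i) = 0).
Proof.
rewrite /weight /f_degree_leaf ap_pcond /pfst; pvs; rewrite -[ap f_fst _]/(mfst _) fst_var cond0.
split=> H; [rewrite ifle_le | rewrite ifle_lt]; rewrite /psnd; pvs => //;
by rewrite -[ap f_snd _]/(msnd _) snd_pair.
Qed.

Lemma weight_par m1 m2 i : (i <= m2 -> weight m1 m2 (mpar i) = 1) /\ (m2 < i -> weight m1 m2 (mpar i) = 0).
Proof.
rewrite /weight /f_degree_leaf ap_pcond /pfst; pvs; rewrite -[ap f_fst _]/(mfst _) fst_par cond1; last exact: S_neq0.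
split=> H; [rewrite ifle_le | rewrite ifle_lt]; rewrite /psnd; pvs => //;
by rewrite -[ap f_snd _]/(msnd _) snd_pair.
Qed.

Lemma fit_small y : y <= K -> mfit K y = y.
Proof. by move=> yK; apply: fit_lt; have := lt_p2 K; mlra. Qed.

Definition mmax x y := ap f_degree_plus [:: x; y; 0; 0; 0].
Definition mmin x y := ap f_min [:: x; y].

Lemma mmaxP x y : [/\ x <= mmax x y, y <= mmax x y & mmax x y = x \/ mmax x y = y].
Proof.
rewrite /mmax /f_degree_plus; case: (leq_ltm x y) => [le|lt].
  by rewrite ifle_le; pvs => //; split=> //; [apply: lem_refl | right].
by rewrite ifle_lt; pvs => //; split; [apply: lem_refl | apply: ltm_leW | left].
Qed.

Lemma mminP x y : [/\ mmin x y <= x, mmin x y <= y & mmin x y = x \/ mmin x y = y].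
Proof.
have [H1 H2] := minP x y; rewrite /mmin; case: (leq_ltm x y) => [le|lt].
  by rewrite H1 //; split=> //; [apply: lem_refl | left].
by rewrite H2; [split; [apply: ltm_leW | apply: lem_refl | right] | apply/ltm_nle].
Qed.

Lemma degree_plusE x y m1 m2 : ap f_degree_plus [:: x; y; m1; m2; K] = mmax x y.
Proof.
rewrite /mmax /f_degree_plus; case: (leq_ltm x y) => [le|lt].
  by rewrite !ifle_le; pvs.
by rewrite !ifle_lt; pvs.
Qed.

Lemma degree_timesE x y m1 m2 : ap f_degree_times [:: x; y; m1; m2; K] = mmin (x + y) K.
Proof. by rewrite /f_degree_times; pvs. Qed.

Lemma dtrace_eqs m1 m2 j : In_range j (mlen e) -> let T := dtrace m1 m2 in
  [/\ mnth T j <= K,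
      mfst (mnth G j) <= 1 -> mnth T j = weight m1 m2 (mnth G j),
      forall l r, mnth G j = madd_gate l r -> mnth T j = mmax (mnth T l) (mnth T r) &
      forall l r, mnth G j = mmul_gate l r -> mnth T j = mmin (mnth T l + mnth T r) K].
Proof.
move=> jr T; have leK : forall i, i <= mlen e -> 1 <= i -> mnth T i <= K.
  apply: (@lsind M [:: e; K; G; m1; m2]) => [k|k|i ie IH i1]; rewrite /T /dtrace; [deft | by def |].
  have ir : In_range i (mlen e) by [].
  have [_ /leaf_cases] := gateP ir.
  case=> [[k [_ g]]|[[k [_ g]]|[[l [r [[l1 li r1 ri] g]]]|[l [r [[l1 li r1 ri] g]]]]]].
  - rewrite trace_leaf //; last by rewrite g fst_var; apply: le0m.
    exact: lem_trans (fit_le _ _) (lem_trans (weight_le1 _ _ _) K1).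
  - rewrite trace_leaf //; last by rewrite g fst_par; apply: lem_refl.
    exact: lem_trans (fit_le _ _) (lem_trans (weight_le1 _ _ _) K1).
  - rewrite (trace_add _ _ _ _ _ ir li ri g) //; apply: lem_trans (fit_le _ _) _.
    by rewrite degree_plusE; case: (mmaxP (mnth T l) (mnth T r)) => _ _ [->|->]; apply: IH.
  rewrite (trace_mul _ _ _ _ _ ir li ri g) //; apply: lem_trans (fit_le _ _) _.
  by rewrite degree_timesE; case: (mminP (mnth T l + mnth T r) K).
have TK : mnth T j <= K by apply: leK; case: jr.
split=> // [g1|l r g|l r g].
- rewrite /T /dtrace trace_leaf // fit_small //.
  exact: lem_trans (weight_le1 _ _ _) K1.
- have [l1 lj r1 rj] := gate_op gateP jr (or_introl g).
  rewrite {1}/T /dtrace (trace_add _ _ _ _ _ jr lj rj g) // degree_plusE fit_small //.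
  have [_ le_l] := range_lt jr l1 lj; have [_ le_r] := range_lt jr r1 rj.
  by case: (mmaxP (mnth T l) (mnth T r)) => _ _ [->|->]; apply: leK.
have [l1 lj r1 rj] := gate_op gateP jr (or_intror g).
rewrite {1}/T /dtrace (trace_mul _ _ _ _ _ jr lj rj g) // degree_timesE fit_small //.
by case: (mminP (mnth T l + mnth T r) K).
Qed.

(** The start of the summation over inputs: nothing has weight yet. *)
Lemma dtrace00 : forall j, j <= mlen e -> 1 <= j -> mnth (dtrace 0 0) j = 0.
Proof.
apply: (@lsind M [:: e; K; G]) => [k|k|j je IH j1]; rewrite /dtrace; [deft | by def |].
have jr : In_range j (mlen e) by [].
have [_ Hleaf Hadd Hmul] := dtrace_eqs 0 0 jr.
have [_ /leaf_cases] := gateP jr.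
case=> [[i [[i1 _] g]]|[[i [[i1 _] g]]|[[l [r [[l1 lj r1 rj] g]]]|[l [r [[l1 lj r1 rj] g]]]]]].
- rewrite -/(dtrace 0 0) Hleaf g ?fst_var ?(proj2 (weight_var _ _ _)) //; exact: le0m.
- rewrite -/(dtrace 0 0) Hleaf g ?fst_par ?(proj2 (weight_par _ _ _)) //; exact: lem_refl.
- by rewrite -/(dtrace 0 0) (Hadd _ _ g); case: (mmaxP (mnth (dtrace 0 0) l) (mnth (dtrace 0 0) r)) => _ _ [->|->]; apply: IH.
rewrite -/(dtrace 0 0) (Hmul _ _ g) !IH //; apply: lem0; rewrite maddx0.
by case: (mminP 0 K).
Qed.

(** With weight 1 on every variable and every constant no gate has degree 0. The size bounds need
    this for leaves and additions. *)
Lemma dtrace_pos : forall j, j <= mlen e -> 1 <= j -> 1 <= mnth (dtrace (mlen N) (mlen f)) j.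
Proof.
apply: (@lsind M [:: e; K; G; N; f]) => [k|k|j je IH j1]; rewrite /dtrace; [deft | by def |].
have jr : In_range j (mlen e) by [].
have [_ Hleaf Hadd Hmul] := dtrace_eqs (mlen N) (mlen f) jr; rewrite -/(dtrace _ _).
have [_ /leaf_cases] := gateP jr.
case=> [[i [[_ iN] g]]|[[i [[_ iN] g]]|[[l [r [[l1 lj r1 rj] g]]]|[l [r [[l1 lj r1 rj] g]]]]]].
- by rewrite Hleaf g ?fst_var ?(proj1 (weight_var _ _ _)) //; [apply: lem_refl | apply: le0m].
- by rewrite Hleaf g ?fst_par ?(proj1 (weight_par _ _ _)) //; apply: lem_refl.
- by rewrite (Hadd _ _ g); case: (mmaxP (mnth (dtrace (mlen N) (mlen f)) l) (mnth (dtrace (mlen N) (mlen f)) r)) => _ _ [->|->]; apply: IH.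
rewrite (Hmul _ _ g); case: (mminP (mnth (dtrace (mlen N) (mlen f)) l + mnth (dtrace (mlen N) (mlen f)) r) K) => _ _ [->|->] //.
by apply: lem_trans (lem_addr _ _); apply: IH.
Qed.

Definition deg_leaf u g x := (exists i, g = mvar i \/ g = mpar i) /\
  ((g = u /\ x = 1) \/ (g <> u /\ x = 0)).

(* Giving weight to one more input [u] adds at most the individual degree in [u]. *)
Lemma dtrace_step m1 m2 m1' m2' u w :
  (forall j, In_range j (mlen e) -> TR G (deg_leaf u) (@Is_max M) (fun x y z => z = x + y) w j) ->
  (forall j, In_range j (mlen e) -> mfst (mnth G j) <= 1 ->
    weight m1' m2' (mnth G j) <= weight m1 m2 (mnth G j) \/
    mnth G j = u) ->
  forall j, j <= mlen e -> 1 <= j -> mnth w j <> 0 ->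
    mnth (dtrace m1' m2') j <= mnth (dtrace m1 m2) j + msub (mnth w j) 1.
Proof.
move=> tr wt.
apply: (@lsind M [:: e; K; G; m1; m2; m1'; m2'; w]) => [k|k|j je IH j1 nw]; rewrite /dtrace; [deft | by def |].
have jr : In_range j (mlen e) by [].
have [_ Hleaf Hadd Hmul] := dtrace_eqs m1 m2 jr; have [_ Hleaf' Hadd' Hmul'] := dtrace_eqs m1' m2' jr.
rewrite -!/(dtrace _ _); case: (tr j jr) => [//|[x [-> H]]]; rewrite msubS1.
case: H => [[[i gi] H]|[l [r [y [z [[l1 lj r1 rj] [El [Er H]]]]]]]].
  have g1 : mfst (mnth G j) <= 1.
    by case: gi => ->; rewrite ?fst_var ?fst_par; [apply: le0m | apply: lem_refl].
  rewrite Hleaf // Hleaf' //; case: H => [[_ ->]|[ng ->]].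
    by apply: lem_trans (weight_le1 _ _ _) _; rewrite maddC; apply: lem_addr.
  by case: (wt j jr g1) => //; rewrite maddx0.
have := IH l lj l1; have := IH r rj r1; rewrite El Er !msubS1 -!/(dtrace _ _).
move=> /(_ (@S_neq0 _ _)) Hr /(_ (@S_neq0 _ _)) Hl.
case: H => -[g op]; rewrite ?(Hadd _ _ g) ?(Hadd' _ _ g) ?(Hmul _ _ g) ?(Hmul' _ _ g).
  have [ml mr _] := mmaxP (mnth (dtrace m1 m2) l) (mnth (dtrace m1 m2) r).
  by case: (mmaxP (mnth (dtrace m1' m2') l) (mnth (dtrace m1' m2') r)) => _ _ [->|->]; case: op => -[-> le]; mlra.
rewrite op; have [m1le m2le _] := mminP (mnth (dtrace m1' m2') l + mnth (dtrace m1' m2') r) K.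
by case: (mminP (mnth (dtrace m1 m2) l + mnth (dtrace m1 m2) r) K) => _ _ [->|->]; mlra.
Qed.

End Degrees.

End CircuitBounds.

(** * Lengths of sums and products *)

Section Sizes.

Local Open Scope m_scope.
Variable M : model.
Implicit Types (x y z t l r j L B : M).

Lemma len_addS x y n : mlen x <= n -> mlen y <= n -> mlen (x + y) <= n.+1.
Proof.
wlog le : x y / mlen y <= mlen x.
  move=> gen xn yn; case: (leq_ltm (mlen y) (mlen x)) => [le|/ltm_leW le]; first exact: gen.
  by rewrite maddC; apply: gen.
move=> xn _; apply: lem_trans (leSS xn).
by apply: len_add => //; [apply: Log_len | apply: lem_refl].
Qed.

(** An addition costs at most one more bit, and the step from gates l and r to the later gate j pays
    for it, as t >= 1. *)
Lemma size_add_step x y z tl tr t l r j L B : Int_add x y z ->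
  mlen (mhalf x) <= tl * (L + l) + B -> mlen (mhalf y) <= tr * (L + r) + B ->
  tl <= t -> tr <= t -> 1 <= t -> l < j -> r < j -> mlen (mhalf z) <= t * (L + j) + B.
Proof.
move=> /half_iadd /le_len le xl yr tlt trt t1 lj rj; apply: lem_trans le _.
have grow s k : s <= t -> k < j -> (s * (L + k) + B).+1 <= t * (L + j) + B.
  by move=> st kj; apply: (@lem_trans _ (t * (L + k) + B).+1); [mnra | mnra].
have [n En] : exists n, t * (L + j) + B = n.+1 by apply: ge1S; have := grow _ _ tlt lj; mlra.
rewrite En; apply: len_addS; apply: le_SS; rewrite -En.
  exact: lem_trans (leSS xl) (grow _ _ tlt lj).
exact: lem_trans (leSS yr) (grow _ _ trt rj).
Qed.

(** Under multiplication lengths add up, and so do the degrees and the extra terms. *)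
Lemma size_mul_step x y z tl tr l r j L B B' : Int_mul x y z ->
  mlen (mhalf x) <= tl * (L + l) + B -> mlen (mhalf y) <= tr * (L + r) + B' ->
  l < j -> r < j -> mlen (mhalf z) <= (tl + tr) * (L + j) + (B + B').
Proof.
move=> /half_imul -> xl yr lj rj; apply: lem_trans (len_mul _ _) _.
apply: (@lem_trans _ (tl * (L + j) + B + (tr * (L + j) + B'))); last by mlra.
by apply: lem_add; [apply: lem_trans xl _ | apply: lem_trans yr _]; mnra.
Qed.

Lemma len_code z : mlen z.+1 <= (mlen (mhalf z)).+1.+1.
Proof. by rewrite -!lenS; apply: le_len; case: (halfE z) => E; mlra. Qed.

End Sizes.

(** * Sizes and congruences of circuit values *)

Section CircuitValues.

Local Open Scope m_scope.
Variable M : model.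
Implicit Types (x y z u v w g i j l r a : M).
Variables (N e f c G : M).
Hypothesis e1 : 1 <= e.
Hypothesis gateP : forall j, In_range j (mlen e) ->
  Entry G j (mnth G j) /\ gate_kind N f j (mnth G j).
Hypothesis constP : forall i, In_range i (mlen f) -> Entry c i (mnth c i) /\ Is_int (mnth c i).

Local Notation P := (mcircuit e f c G).

Lemma out_range : In_range (mlen e) (mlen e).
Proof. by split; [apply/neq0_ge1 => /len_eq0; apply/neq0_ge1 | apply: lem_refl]. Qed.

Lemma leaf_kind j : In_range j (mlen e) -> mfst (mnth G j) <= 1 ->
  (exists i, In_range i (mlen N) /\ mnth G j = mvar i) \/
  (exists i, In_range i (mlen f) /\ mnth G j = mpar i).
Proof.
move=> jr; have [_ /leaf_cases] := gateP jr.
case=> [[i [ir ->]]|[[i [ir ->]]|[[l [r [_ ->]]]|[l [r [_ ->]]]]]].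
- by move=> _; left; exists i.
- by move=> _; right; exists i.
- by rewrite fst_add => H; exfalso; mlra.
- by rewrite fst_mul => H; exfalso; mlra.
Qed.

Section TotalDegree.

Variables (K d : M).
Hypothesis K1 : 1 <= K.

Lemma dtrace_out m1 m2 m1' m2' u v : Degree u P v ->
  (forall i, In_range i (mlen N) -> weight K m1' m2' (mvar i) <= weight K m1 m2 (mvar i) \/ mvar i = u) ->
  (forall i, In_range i (mlen f) -> weight K m1' m2' (mpar i) <= weight K m1 m2 (mpar i) \/ mpar i = u) ->
  mnth (dtrace e G K m1' m2') (mlen e) <= mnth (dtrace e G K m1 m2) (mlen e) + v.
Proof.
move=> /(Run_TR gateP) [w [out tr]] wvar wpar.
rewrite -[v]msubS1 -out; apply: (dtrace_step gateP) (tr) _ _ _ _ _ => //.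
- move=> j jr g1; case: (leaf_kind jr g1) => -[i [ir ->]]; [exact: wvar | exact: wpar].
- exact: lem_refl.
- by case: out_range.
by rewrite out; apply: S_neq0.
Qed.

(** The inputs receive their weights one after another, first the variables and then the constants,
    and each adds at most its individual degree. Only two total degrees and one individual degree
    are compared at a time, so the induction condition is an inequality between terms. *)
Lemma degree_total :
  (forall i, In_range i (mlen N) -> exists v, Degree (mvar i) P v /\ v <= d) ->
  (forall i, In_range i (mlen f) -> exists v, Degree (mpar i) P v /\ v <= d) ->
  mnth (dtrace e G K (mlen N) (mlen f)) (mlen e) <= (mlen N + mlen f) * d.
Proof.
move=> dvar dpar.
have H1 : forall m, m <= mlen N -> mnth (dtrace e G K m 0) (mlen e) <= m * d.
  apply: (@lind M [:: e; K; G; d; N]); [exact: Log_len | deft | by rewrite /dtrace; def | |].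
    rewrite (dtrace00 gateP) //; [exact: le0m | exact: lem_refl | by case: out_range].
  move=> m mN IH; have [v [dv vd]] := dvar m.+1 (conj (leSS (le0m m)) mN).
  suff H : mnth (dtrace e G K m.+1 0) (mlen e) <= mnth (dtrace e G K m 0) (mlen e) + v.
    by apply: lem_trans H _; mlra.
  apply: (dtrace_out dv) => i [i1 iN].
    case: (leq_ltm i m) => [im|mi].
      by left; rewrite !(proj1 (weight_var _ _ _ _)) //; [apply: lem_refl | apply: leS].
    case: (leq_ltm i m.+1) => [im|mi']; first by right; congr mvar; apply: lem_anti.
    by left; rewrite (proj2 (weight_var _ _ _ _)) //; apply: le0m.
  by left; rewrite !(proj2 (weight_par _ _ _ _)) //; apply: lem_refl.
have H2 : forall m, m <= mlen f -> mnth (dtrace e G K (mlen N) m) (mlen e) <= (mlen N + m) * d.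
  apply: (@lind M [:: e; K; G; d; N; f]); [exact: Log_len | deft | by rewrite /dtrace; def | |].
    by rewrite maddx0; apply/H1/lem_refl.
  move=> m mf IH; have [v [dv vd]] := dpar m.+1 (conj (leSS (le0m m)) mf).
  suff H : mnth (dtrace e G K (mlen N) m.+1) (mlen e) <= mnth (dtrace e G K (mlen N) m) (mlen e) + v.
    by apply: lem_trans H _; mlra.
  apply: (dtrace_out dv) => i [i1 iN].
    by left; rewrite !(proj1 (weight_var _ _ _ _)) //; apply: lem_refl.
  case: (leq_ltm i m) => [im|mi].
    by left; rewrite !(proj1 (weight_par _ _ _ _)) //; [apply: lem_refl | apply: leS].
  case: (leq_ltm i m.+1) => [im|mi']; first by right; congr mpar; apply: lem_anti.
  by left; rewrite (proj2 (weight_par _ _ _ _)) //; apply: le0m.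
exact/H2/lem_refl.
Qed.

End TotalDegree.

Definition val_leaf a c' g x :=
  (exists i, g = mvar i /\ Entry a i x) \/ (exists i, g = mpar i /\ Entry c' i x).
Definition ValTR a w := forall j, In_range j (mlen e) ->
  TR G (val_leaf a c) (@Int_add M) (@Int_mul M) w j.

Lemma Eval_TR a v : Eval P a v -> exists w, mnth w (mlen e) = v.+1 /\ ValTR a w.
Proof. exact: (Run_TR gateP). Qed.

Section Size.

Variables (a w K L beta u dl : M).
Hypotheses (K1 : 1 <= K) (trw : ValTR a w).
Hypothesis Hleaf : forall j x, In_range j (mlen e) -> val_leaf a c (mnth G j) x ->
  mlen (mhalf x) <= L \/ mnth G j = u /\ mlen (mhalf x) <= L + beta.
Hypothesis Hdl : beta = 0 \/ forall j, In_range j (mlen e) ->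
  TR G (deg_leaf u) (@Is_max M) (fun x y z => z = x + y) dl j.

Local Notation T := (dtrace e G K (mlen N) (mlen f)).
Local Notation good j := (beta = 0 \/ mnth dl j <> 0).
Local Notation B j := (msub (mnth dl j) 1 * beta).

Lemma delta_cases j : In_range j (mlen e) -> good j ->
  [/\ mfst (mnth G j) <= 1 -> mnth G j = u -> beta <= B j,
      forall l r, mnth G j = madd_gate l r -> [/\ good l, good r, B l <= B j & B r <= B j] &
      forall l r, mnth G j = mmul_gate l r -> [/\ good l, good r & B j = B l + B r]].
Proof.
move=> jr gj; case: (EM (beta = 0)) => [b0|nb].
  split=> [_ _|l r _|l r _]; rewrite b0 ?mmulx0 ?maddx0.
  - exact: lem_refl.
  - by split; (try by left); apply: lem_refl.
  - by split; [left | left |].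
case: Hdl => [//|{}/(_ j jr)]; case: gj => // nd [//|[x [-> H]]]; rewrite msubS1.
have [n01 n02 n03 [n12 n13 n23]] := num_neq M.
case: H => [[[i gi] H]|[l' [r' [y [z [_ [El [Er H]]]]]]]].
  split=> [_ gu|l r g|l r g].
  - by case: H => [[_ ->]|[]//]; rewrite mul1m; apply: lem_refl.
  - by move: gi; rewrite g => -[] /mpair_inj [] => [/esym|/esym].
  - by move: gi; rewrite g => -[] /mpair_inj [] => [/esym|/esym].
have gy : mnth dl l' <> 0 by rewrite El; apply: S_neq0.
have gz : mnth dl r' <> 0 by rewrite Er; apply: S_neq0.
split=> [g1|l r g|l r g].
- have : 2 <= mfst (mnth G j).
    by case: H => -[-> _]; rewrite ?fst_add ?fst_mul; [apply: lem_refl | apply/leS/lem_refl].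
  by move=> g2; exfalso; mlra.
- case: H => -[]; rewrite g; last by move/mpair_inj => [].
  move=> /mpair_inj [_ /mpair_inj [-> ->]] op; split; try by right.
    by rewrite El msubS1; case: op => -[-> le]; mnra.
  by rewrite Er msubS1; case: op => -[-> le]; mnra.
case: H => -[]; rewrite g; first by move/mpair_inj => [/esym].
move=> /mpair_inj [_ /mpair_inj [-> ->]] op; split; try by right.
by rewrite El Er !msubS1 op; mring.
Qed.

(** Ordinary inputs of length at most L are charged with the total degree. The exceptional input
    [u], longer by beta, adds beta times the individual degree, which [dl] stores increased by one.
    With beta = 0 this is the plain bound. Below K the cap on the degree is not active, so degrees
    do add up at products. *)
Lemma size_bound : forall j, j <= mlen e -> 1 <= j -> mnth T j < K -> mnth w j <> 0 -> good j ->
  mlen (mhalf (msub (mnth w j) 1)) <= mnth T j * (L + j) + B j.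
Proof.
apply: (@lsind M [:: e; K; G; N; f; w; dl; L; beta]) => [k|k|j je IH j1 TK nw nd]; rewrite /dtrace; [deft | by def |].
rewrite -/(dtrace e G K (mlen N) (mlen f)).
have jr : In_range j (mlen e) by [].
have T1 : 1 <= mnth T j by apply: (dtrace_pos gateP).
have [_ _ Hadd Hmul] := dtrace_eqs gateP K1 (mlen N) (mlen f) jr.
have [Dleaf Dadd Dmul] := delta_cases jr nd.
case: (trw jr) => [//|[x [Ex H]]]; rewrite Ex msubS1.
case: H => [lf|[l [r [y [z [[l1 lj r1 rj] [El [Er H]]]]]]]].
  case: (Hleaf jr lf) => [le|[gu le]].
    by apply: lem_trans le _; move: (B j) => b; mnra.
  apply: lem_trans le _; apply: lem_add; first by mnra.
  apply: Dleaf => //.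
  by case: lf => -[i [-> _]]; rewrite ?fst_var ?fst_par; [apply: le0m | apply: lem_refl].
have nl : mnth w l <> 0 by rewrite El; apply: S_neq0.
have nr : mnth w r <> 0 by rewrite Er; apply: S_neq0.
case: H => -[g op].
  have [gl gr Bl Br] := Dadd _ _ g.
  have [Tl Tr _] := mmaxP (mnth T l) (mnth T r); rewrite -(Hadd _ _ g) in Tl Tr.
  have := IH l lj l1 (lem_trans (leSS Tl) TK) nl gl; have := IH r rj r1 (lem_trans (leSS Tr) TK) nr gr.
  rewrite El Er !msubS1 => Hr Hl.
  apply: (size_add_step op _ _ Tl Tr T1 lj rj); first by apply: lem_trans Hl _; apply/lem_add2l.
  by apply: lem_trans Hr _; apply/lem_add2l.
have [gl gr ->] := Dmul _ _ g.
have TE : mnth T j = mnth T l + mnth T r.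
  have := Hmul _ _ g; case: (mminP (mnth T l + mnth T r) K) => _ _ [] -> // TK'.
  by exfalso; rewrite TK' in TK; mlra.
have Tl : mnth T l < K by apply: lem_trans TK; rewrite TE; apply/leSS/lem_addr.
have Tr : mnth T r < K by apply: lem_trans TK; rewrite TE maddC; apply/leSS/lem_addr.
have := IH l lj l1 Tl nl gl; have := IH r rj r1 Tr nr gr.
rewrite El Er !msubS1 => Hr Hl; rewrite TE.
exact: size_mul_step op Hl Hr lj rj.
Qed.

End Size.

(** Both operations respect congruences, and the tag of the gate forces both traces to use the same
    clause, with the same operands or the same input. *)
Lemma trace_cong mu a a' w w' : ValTR a w -> ValTR a' w' ->
  (forall i x x', In_range i (mlen N) -> Entry a i x -> Entry a' i x' -> Cong mu x x') ->
  forall j, j <= mlen e -> 1 <= j -> mnth w j <> 0 -> mnth w' j <> 0 ->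
    Cong mu (msub (mnth w j) 1) (msub (mnth w' j) 1).
Proof.
move=> tr tr' aa'.
apply: (@lsind M [:: e; w; w'; mu]) => [k|k|j je IH j1 nw nw']; rewrite /Cong; [deft | by def |].
rewrite -/(Cong mu _ _); have jr : In_range j (mlen e) by [].
have [n01 n02 n03 [n12 n13 n23]] := num_neq M.
have [_ /leaf_cases kind] := gateP jr.
case: (tr _ jr) => [//|[x [-> H]]]; case: (tr' _ jr) => [//|[x' [-> H']]]; rewrite !msubS1.
case: H => [lf|[l [r [y [z [[l1 lj r1 rj] [El [Er H]]]]]]]].
  case: H' => [lf'|[l [r [y [z [_ [_ [_ Hg]]]]]]]]; last first.
    by case: lf => -[i [gi _]]; case: Hg => -[go _]; move: go; rewrite gi => /mpair_inj [].
  case: lf => -[i [gi /[dup] xi /entry_nth Ei]]; case: lf' => -[i' []]; rewrite gi.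
  - move=> /mpair_inj [_ <-] xi'; apply: aa' xi xi'.
    case: kind => [[k [kr]]|[[k [kr]]|[[k [k' [_]]]|[k [k' [_]]]]]]; rewrite gi => /mpair_inj [] //.
    by move=> _ ->.
  - by move/mpair_inj => [].
  - by move/mpair_inj => [/esym].
  by move=> /mpair_inj [_ <-] /entry_nth <-; rewrite -Ei; apply: Cong_refl.
case: H' => [lf'|[l' [r' [y' [z' [_ [El' [Er' H']]]]]]]].
  by case: lf' => -[i [gi _]]; case: H => -[go _]; move: go; rewrite gi => /mpair_inj [].
have := IH l lj l1; have := IH r rj r1; rewrite El Er !msubS1 -!/(Cong mu _ _).
case: H => -[g op]; case: H' => -[]; rewrite g => /mpair_inj [].
- move=> _ /mpair_inj [El2 Er2]; rewrite El2 Er2 El' Er' !msubS1 => op' Hr Hl.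
  by apply: (Cong_add op op'); [apply: Hl | apply: Hr]; apply: S_neq0.
- by [].
- by move/esym.
move=> _ /mpair_inj [El2 Er2]; rewrite El2 Er2 El' Er' !msubS1 => op' Hr Hl.
by apply: (Cong_mul op op'); [apply: Hl | apply: Hr]; apply: S_neq0.
Qed.

(** Serves two purposes: modulus 0 gives uniqueness of values, and the moduli B - r and B - y give
    the divisibilities on a line. *)
Lemma Eval_cong mu a a' v v' : Eval P a v -> Eval P a' v' ->
  (forall i x x', In_range i (mlen N) -> Entry a i x -> Entry a' i x' -> Cong mu x x') ->
  Cong mu v v'.
Proof.
move=> /Eval_TR [w [out tr]] /Eval_TR [w' [out' tr']] aa'.
rewrite -[v]msubS1 -[v']msubS1 -out -out'; apply: (trace_cong tr tr' aa').
- exact: lem_refl.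
- by case: out_range.
- by rewrite out; apply: S_neq0.
by rewrite out'; apply: S_neq0.
Qed.

Lemma Eval_int a v : In_Zn N a -> Eval P a v -> Is_int v.
Proof.
move=> az /Eval_TR [w [out tr]]; case: (tr _ out_range) => [E|[x []]].
  by move: out; rewrite E => /esym /S_neq0.
rewrite out => /S_inj <- []; last first.
  by case=> l [r [y [z [_ [_ [_]]]]]]; case=> -[_]; [case/Int_addP | case/Int_mulP].
case=> -[i [g /entry_nth Ei]].
  have [_ /leaf_cases] := gateP out_range.
  case=> [[k [kr]]|[[k [kr]]|[[k [k' [_]]]|[k [k' [_]]]]]]; rewrite g => /mpair_inj [E].
  - by move=> Ek; have [z [/entry_nth Ez iz_]] := az k kr; rewrite -Ei Ek Ez.
  - by have [n01 n02 n03 _] := num_neq M; case: n01.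
  - by have [n01 n02 n03 _] := num_neq M; case: n02.
  - by have [n01 n02 n03 _] := num_neq M; case: n03.
have [_ /leaf_cases] := gateP out_range.
have [n01 n02 n03 [n12 n13 n23]] := num_neq M.
case=> [[k [kr]]|[[k [kr]]|[[k [k' [_]]]|[k [k' [_]]]]]]; rewrite g => /mpair_inj [E] //.
- by case: n01.
by move=> Ek; have [_] := constP kr; rewrite -Ek Ei.
Qed.

End CircuitValues.

(* Any term whose length is polynomially large in |N|, |D|, |P| and |a| will do as a
   block size. *)
Definition p_block n (N D P a : pv n) : pv n :=
  let y := padd (padd (padd N D) (padd P a)) (pmul ptwo (pmul ptwo ptwo)) in
  let q := psmash y y in let r := psmash q q in psmash r r.
Definition f_ev : pv 4 :=
  let e := pfst 'p_2 in let c := pfst (psnd (psnd 'p_2)) in let G := psnd (psnd (psnd 'p_2)) in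
  psub (pnth (pcall f_value_trace [tuple e; p_block 'p_0 'p_1 'p_2 'p_3; G; c; 'p_3]) (plen e)) pone.

(** * The computed trace and its block size *)

Section Evaluation.

Local Open Scope m_scope.
Variable M : model.
Implicit Types (x y z u v w g i j l r a : M).

Definition mblock (N D P a : M) : M :=
  let y := N + D + (P + a) + 2 * (2 * 2) in
  let q := y # y in let r := q # q in r # r.

Section ValueTrace.

Variables (N e f c G a C : M).
Hypothesis gateP : forall j, In_range j (mlen e) ->
  Entry G j (mnth G j) /\ gate_kind N f j (mnth G j).
Hypothesis constP : forall i, In_range i (mlen f) -> Entry c i (mnth c i) /\ Is_int (mnth c i).
Hypothesis aP : In_Zn N a.

Definition vtrace := ap f_value_trace [:: e; C; G; c; a].

Lemma value_leaf_var i : ap f_value_leaf [:: mvar i; c; a] = (mnth a i).+1.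
Proof.
rewrite /f_value_leaf ap_pcond /pfst /psnd /pnth; pvs.
by rewrite -[ap f_fst _]/(mfst _) fst_var cond0 -[ap f_snd _]/(msnd _) snd_pair.
Qed.

Lemma value_leaf_par i : ap f_value_leaf [:: mpar i; c; a] = (mnth c i).+1.
Proof.
rewrite /f_value_leaf ap_pcond /pfst /psnd /pnth; pvs.
by rewrite -[ap f_fst _]/(mfst _) fst_par cond1 -?[ap f_snd _]/(msnd _) ?snd_pair //; apply: S_neq0.
Qed.

Lemma value_op op x y :
  (x = 0 \/ y = 0 -> ap (f_value_op op) [:: x; y; c; a] = 0) /\
  ap (f_value_op op) [:: x.+1; y.+1; c; a] = (ap op [:: x; y]).+1.
Proof.
rewrite /f_value_op ap_pcond /psub; pvs; split=> [[->|->]|].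
- by rewrite cond0.
- case: (EM (x = 0)) => [->|nx]; first by rewrite cond0.
  by rewrite cond1 // ap_pcond; pvs; rewrite cond0.
rewrite ap_pcond; pvs; rewrite cond1 ?ap_pcond; last exact: S_neq0.
pvs; rewrite cond1; last exact: S_neq0.
by rewrite -![ap f_sub _]/(msub _ _) !msubS1.
Qed.

Lemma fit_cases y : mfit C y = y \/ mfit C y = 0.
Proof. by case: (leq_ltm (1 # C) y) => [/fit_ge|/fit_lt]; [right | left]. Qed.

Definition vresult j v := exists x, v = x.+1 /\ Is_int x /\
  (val_leaf a c (mnth G j) x \/
   exists l r y z, [/\ 1 <= l, l < j, 1 <= r & r < j] /\ mnth vtrace l = y.+1 /\ mnth vtrace r = z.+1 /\
    ((mnth G j = madd_gate l r /\ Int_add y z x) \/ (mnth G j = mmul_gate l r /\ Int_mul y z x))).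

Lemma vtrace_cases j : In_range j (mlen e) ->
  (forall i, i < j -> 1 <= i -> mnth vtrace i <> 2) ->
  exists v, mnth vtrace j = mfit C v /\
    (vresult j v \/ v = 0 /\ exists l r, [/\ 1 <= l, l < j, 1 <= r & r < j] /\
       (mnth G j = madd_gate l r \/ mnth G j = mmul_gate l r) /\
       (mnth vtrace l = 0 \/ mnth vtrace r = 0)).
Proof.
move=> jr ints; have [_ /leaf_cases] := gateP jr.
case=> [[i [ir g]]|[[i [ir g]]|[[l [r [lr g]]]|[l [r [lr g]]]]]].
- exists (mnth a i).+1; split.
    by rewrite /vtrace trace_leaf // g ?fst_var ?value_leaf_var //; apply: le0m.
  have [x [/[dup] xi /entry_nth Ex ix]] := aP ir.
  by left; exists (mnth a i); rewrite Ex; do 2 split=> //; left; left; exists i.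
- exists (mnth c i).+1; split.
    by rewrite /vtrace trace_leaf // g ?fst_par ?value_leaf_par //; apply: lem_refl.
  have [xi ix] := constP ir.
  by left; exists (mnth c i); do 2 split=> //; left; right; exists i.
- have [l1 lj r1 rj] := lr.
  exists (ap (f_value_op f_iadd) [:: mnth vtrace l; mnth vtrace r; c; a]); split.
    by rewrite {1}/vtrace (trace_add _ _ _ _ _ jr lj rj g).
  case: (EM (mnth vtrace l = 0)) => [l0|/neq0_ge1 /ge1S [x Ex]].
    by right; split; [apply: (proj1 (value_op _ _ _)); left | exists l, r; do 2 split=> //; left].
  case: (EM (mnth vtrace r = 0)) => [r0|/neq0_ge1 /ge1S [y Ey]].
    by right; split; [apply: (proj1 (value_op _ _ _)); right | exists l, r; do 2 split=> //; [left | right]].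
  have op : Int_add x y (miadd x y).
    by apply: iadd_int => E; [apply: (ints l) | apply: (ints r)]; rewrite // ?Ex ?Ey E.
  left; exists (miadd x y); rewrite Ex Ey (proj2 (value_op _ _ _)); split=> //.
  split; first by case/Int_addP: op.
  by right; exists l, r, x, y; do 3 split=> //; left.
have [l1 lj r1 rj] := lr.
exists (ap (f_value_op f_imul) [:: mnth vtrace l; mnth vtrace r; c; a]); split.
  by rewrite {1}/vtrace (trace_mul _ _ _ _ _ jr lj rj g).
case: (EM (mnth vtrace l = 0)) => [l0|/neq0_ge1 /ge1S [x Ex]].
  by right; split; [apply: (proj1 (value_op _ _ _)); left | exists l, r; do 2 split=> //; [right | left]].
case: (EM (mnth vtrace r = 0)) => [r0|/neq0_ge1 /ge1S [y Ey]].
  by right; split; [apply: (proj1 (value_op _ _ _)); right | exists l, r; do 2 split=> //; right].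
have op : Int_mul x y (mimul x y).
  by apply: imul_int => E; [apply: (ints l) | apply: (ints r)]; rewrite // ?Ex ?Ey E.
left; exists (mimul x y); rewrite Ex Ey (proj2 (value_op _ _ _)); split=> //.
split; first by case/Int_mulP: op.
by right; exists l, r, x, y; do 3 split=> //; right.
Qed.

(** Entry 2 stands for the value 1, the excluded code of minus zero. Avoiding it is an atomic way of
    saying that all operands are integers. *)
Lemma vtrace_int : forall j, j <= mlen e -> 1 <= j -> mnth vtrace j <> 2.
Proof.
apply: (@lsind M [:: e; C; G; c; a]) => [k|k|j je IH j1]; rewrite /vtrace; [deft | by def |].
rewrite -/vtrace; have [v [-> H]] := vtrace_cases (conj j1 je) IH.
have [n01 n02 _ _] := num_neq M; case: (fit_cases v) => -> //.
by case: H => [[x [-> [ix _]]]|[-> _]] // /S_inj.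
Qed.

Lemma vtrace_eq j : In_range j (mlen e) ->
  exists v, mnth vtrace j = mfit C v /\
    (vresult j v \/ v = 0 /\ exists l r, [/\ 1 <= l, l < j, 1 <= r & r < j] /\
       (mnth G j = madd_gate l r \/ mnth G j = mmul_gate l r) /\
       (mnth vtrace l = 0 \/ mnth vtrace r = 0)).
Proof.
move=> [j1 je]; apply: vtrace_cases => // i ij; apply: vtrace_int.
exact: lem_trans (ltm_leW ij) je.
Qed.

(** True for every block size: an entry that does not fit becomes 0, which is admissible as not
    computed. The block size matters for definedness only. *)
Lemma vtrace_TR : ValTR e c G a vtrace.
Proof.
move=> j /vtrace_eq [v [Ev H]]; case: (EM (mnth vtrace j = 0)) => [|nv]; [by left | right].
case: H => [[x [Ex [ix H]]]|[v0 _]]; last by case: nv; case: (fit_cases v) => E; rewrite Ev E.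
exists x; split=> //; rewrite Ev -Ex; case: (fit_cases v) => // E.
by case: nv; rewrite Ev.
Qed.

Variables (K L : M).
Hypotheses (K1 : 1 <= K) (KC : (K * (L + mlen e)).+1.+1 <= mlen C).
Hypothesis Hleaf : forall j x, In_range j (mlen e) -> val_leaf a c (mnth G j) x -> mlen (mhalf x) <= L.

Local Notation T := (dtrace e G K (mlen N) (mlen f)).

(** Below K the operands are defined by induction, and [size_bound] applies to the partial trace
    itself, so the new value is short enough for its block. *)
Lemma vtrace_defined : forall j, j <= mlen e -> 1 <= j -> mnth T j < K -> mnth vtrace j <> 0.
Proof.
apply: (@lsind M [:: e; C; G; c; a; K; N; f]) => [k|k|j je IH j1 TK]; rewrite /vtrace /dtrace; [deft | by def |].
rewrite -/vtrace; have jr : In_range j (mlen e) by [].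
have T1 : 1 <= mnth T j by apply: (dtrace_pos gateP).
have [_ _ Hadd Hmul] := dtrace_eqs gateP K1 (mlen N) (mlen f) jr.
have TE l r : mnth G j = mmul_gate l r -> mnth T j = mnth T l + mnth T r.
  move=> g; have := Hmul _ _ g; case: (mminP (mnth T l + mnth T r) K) => _ _ [] -> // TK'.
  by exfalso; rewrite TK' in TK; mlra.
have TK_op l r : mnth G j = madd_gate l r \/ mnth G j = mmul_gate l r -> mnth T l < K /\ mnth T r < K.
  case=> g.
    have [Tl Tr _] := mmaxP (mnth T l) (mnth T r); rewrite -(Hadd _ _ g) in Tl Tr.
    by split; mlra.
  by have := TE _ _ g; split; mlra.
have [v [-> H]] := vtrace_eq jr; case: H => [[x [-> [_ H]]]|[_ [l [r [[l1 lj r1 rj] [g H]]]]]]; last first.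
  have [Tl Tr] := TK_op _ _ g.
  by case: H => E; [case: (IH l lj l1 Tl) | case: (IH r rj r1 Tr)].
suff small : mlen (mhalf x) <= mnth T j * (L + j).
  rewrite fit_lt; first exact: S_neq0.
  apply/len_p2; apply: lem_trans (len_code x) _; apply: lem_trans KC; do 2 apply: leSS.
  by apply: lem_trans small _; mnra.
case: H => [lf|[l [r [y [z [[l1 lj r1 rj] [El [Er H]]]]]]]].
  by apply: lem_trans (Hleaf jr lf) _; mnra.
(* The plain bound: beta = 0, with 0 in place of the exceptional input and of its degree trace. *)
have size k : k < j -> 1 <= k -> mnth T k < K -> mnth vtrace k <> 0 ->
    mlen (mhalf (msub (mnth vtrace k) 1)) <= mnth T k * (L + k) + 0.
  move=> kj k1 Tk nk; have Hl i x' : In_range i (mlen e) -> val_leaf a c (mnth G i) x' ->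
      mlen (mhalf x') <= L \/ mnth G i = 0 /\ mlen (mhalf x') <= L + 0.
    by move=> ir lf; left; apply: Hleaf lf.
  have ke : k <= mlen e by apply: lem_trans (ltm_leW kj) je.
  have := size_bound gateP K1 vtrace_TR Hl (or_introl erefl) ke k1 Tk nk (or_introl erefl).
  by move=> /(_ 0); rewrite mmulx0.
have := size l lj l1; have := size r rj r1; rewrite El Er !msubS1.
have [|Tl Tr] := TK_op l r; first by case: H => -[->]; [left | right].
move=> /(_ Tr (@S_neq0 _ _)) Hr /(_ Tl (@S_neq0 _ _)) Hl.
case: H => -[g op].
  have [Tl' Tr' _] := mmaxP (mnth T l) (mnth T r); rewrite -(Hadd _ _ g) in Tl' Tr'.
  by rewrite -[_ * _]maddx0; apply: (size_add_step op Hl Hr).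
by rewrite (TE _ _ g) -[_ * _]maddx0 -[in X in _ + X](maddx0 0); apply: (size_mul_step op Hl Hr).
Qed.

End ValueTrace.

Lemma len8 : mlen (2 * (2 * 2)) = 2 * 2 :> M.
Proof.
have n2 : 2 <> 0 :> M by apply: S_neq0.
have n4 : 2 * 2 <> 0 :> M by apply: mul2_neq0.
have [-> _] := len_double n4; have [-> _] := len_double n2.
have -> : 2 = 2 * 1 :> M by mring.
have [-> _] := len_double (@S_neq0 M 0); rewrite len1; mring.
Qed.

Lemma mul_le x y u v : x <= u -> y <= v -> x * y <= u * v.
Proof. by move=> xu yv; apply: (@lem_trans _ (u * y)); mnra. Qed.

(** The left side is about 6 l^3, while the three nested smashes in [mblock] give a polynomial of
    degree 8. The summand 8 in [mblock] ensures l >= 4, which absorbs the constants. *)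
Lemma poly_large l n u v d E a : 2 * 2 <= l -> n <= l -> u <= l -> v <= l -> E <= l -> d <= l -> a <= l ->
  ((((n + u) * d).+1 * (a + v + E)).+1).+1 <=
    (((l * l).+1 * (l * l).+1).+1 * ((l * l).+1 * (l * l).+1).+1).+1.
Proof.
move=> l4 nl ul vl El dl al; set A := l * l.
have K1 : (n + u) * d <= 2 * A.
  rewrite /A -mmulA; apply: mul_le dl; clear -nl ul; mlra.
have K2 : a + v + E <= 3 * l by clear -al vl El; mlra.
have A4 : 2 * 2 * l <= A by apply: mul_le l4 (lem_refl _).
have A1 : 1 <= A by clear -l4 A4; mlra.
have K3 : ((n + u) * d).+1 <= 3 * A by clear -K1 A1; mlra.
have K4 : ((n + u) * d).+1 * (a + v + E) <= 3 * A * (3 * l) by apply: mul_le.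
have B1 : A <= A * A by rewrite -{1}(mul1m A); apply: mul_le A1 (lem_refl _).
have B2 : 2 * 2 * l * A <= A * A by apply: mul_le A4 (lem_refl _).
have B3 : 2 * 2 * (2 * 2) <= A by apply: mul_le.
have B4 : 2 * 2 * (2 * 2) * (A * A) <= A * (A * A) by apply: mul_le B3 (lem_refl _).
have B5 : A * (A * A) <= A * A * (A * A) by apply: mul_le B1 (lem_refl _).
have B6 : 1 <= A * A by exact: lem_trans A1 B1.
have B7 : A * A <= (A.+1 * A.+1).+1 by apply/leS/mul_le; apply/leS/lem_refl.
apply: lem_trans (leS (mul_le B7 B7)).
by clearbody A; clear -K4 B2 B4 B5 B6; mlra.
Qed.

Lemma mblock_large N D P a n u v d E : mlen n <= mlen N -> mlen u <= mlen P -> mlen v <= mlen P ->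
  mlen d <= mlen D -> mlen E <= mlen P ->
  ((((mlen n + mlen u) * mlen d).+1 * (mlen a + mlen v + mlen E)).+1).+1 <= mlen (mblock N D P a).
Proof.
move=> nN uP vP dD EP; rewrite /mblock; set y := N + D + (P + a) + 2 * (2 * 2).
have yle x : x <= y -> mlen x <= mlen y by apply: le_len.
have l4 : 2 * 2 <= mlen y by rewrite -len8; apply: yle; rewrite /y; mlra.
have lN : mlen n <= mlen y by apply: lem_trans nN _; apply: yle; rewrite /y; mlra.
have lu : mlen u <= mlen y by apply: lem_trans uP _; apply: yle; rewrite /y; mlra.
have lv : mlen v <= mlen y by apply: lem_trans vP _; apply: yle; rewrite /y; mlra.
have lE : mlen E <= mlen y by apply: lem_trans EP _; apply: yle; rewrite /y; mlra.
have ld : mlen d <= mlen y by apply: lem_trans dD _; apply: yle; rewrite /y; mlra.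
have la : mlen a <= mlen y by apply: yle; rewrite /y; mlra.
rewrite !len_smash; move: (mlen y) (mlen n) (mlen u) (mlen v) (mlen d) (mlen E) (mlen a) l4 lN lu lv lE ld la => l n' u' v' d' E' a' l4 lN lu lv lE ld la.
exact: poly_large.
Qed.

Definition circuit_data N D P e f c G :=
  [/\ P = mcircuit e f c G, 1 <= e,
      forall j, In_range j (mlen e) -> Entry G j (mnth G j) /\ gate_kind N f j (mnth G j),
      forall i, In_range i (mlen f) -> Entry c i (mnth c i) /\ Is_int (mnth c i) &
      (forall i, In_range i (mlen N) -> exists v, Degree (mvar i) P v /\ v <= mlen D) /\
      (forall i, In_range i (mlen f) -> exists v, Degree (mpar i) P v /\ v <= mlen D)].

Lemma In_Ckt_data N D P : In_Ckt N D P -> exists e f c G, circuit_data N D P e f c G.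
Proof.
move=> [[e [f [c [G [EP [ne [consts gates]]]]]]] [dvar [e' [f' [c' [G' [EP' dpar]]]]]]].
exists e, f, c, G; split=> //.
- exact/neq0_ge1.
- move=> j jr; have [g [Gj kind]] := gates j jr; rewrite (entry_nth Gj); split=> //.
  case: kind => [H|[H|[l [r [l1 [lj [r1 [rj H]]]]]]]]; [by left | by right; left | right; right].
  by exists l, r.
- by move=> i ir; have [z [ci iz_]] := consts i ir; rewrite (entry_nth ci).
split=> //; have [_ /mpair_inj [-> _]] := mpair_inj (etrans (esym EP) EP').
exact: dpar.
Qed.

Definition mev N D P a := ap f_ev [:: N; D; P; a].

Lemma mevE N D e f c G a : let P := mcircuit e f c G in
  mev N D P a = msub (mnth (vtrace e c G a (mblock N D P a)) (mlen e)) 1.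
Proof.
have apf x y : ap f_fst [:: mpair x y] = x by exact: fst_pair.
have aps x y : ap f_snd [:: mpair x y] = y by exact: snd_pair.
(* Subroutines are generalized before an evaluation, so that simplification stops at them. *)
move=> P; rewrite /mev /f_ev /vtrace; move: f_value_trace => F.
by rewrite /psub /pnth /p_block /pfst /psnd; pvs; rewrite /P !(apf, aps).
Qed.

Lemma val_leaf_len a c g x : val_leaf a c g x -> mlen (mhalf x) <= mlen a + mlen c.
Proof.
have le u y i : Entry u i y -> mlen (mhalf y) <= mlen u.
  by move=> /entry_le yu; apply: le_len; apply: lem_trans (half_le y) yu.
case=> -[i [_ /le H]]; apply: lem_trans H _; first exact: lem_addr.
by rewrite maddC; apply: lem_addr.
Qed.

Lemma mev_correct N D P a : In_Ckt N D P -> In_Zn N a -> Eval P a (mev N D P a).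
Proof.
move=> /In_Ckt_data [e [f [c [G [EP e1 gateP constP [dvar dpar]]]]]] az; subst P.
rewrite mevE; set P := mcircuit e f c G in dvar dpar *; set W := vtrace _ _ _ _ _.
set K := ((mlen N + mlen f) * mlen D).+1; have K1 : 1 <= K by apply/leSS/le0m.
have eP : e <= P by apply: le_pair1.
have fP : f <= P by apply: lem_trans (le_pair2 _ _); apply: le_pair1.
have cP : c <= P.
  by do 2 (apply: lem_trans (le_pair2 _ _)); apply: le_pair1.
have KC : (K * (mlen a + mlen c + mlen e)).+1.+1 <= mlen (mblock N D P a).
  by apply: mblock_large; try exact: lem_refl; apply: le_len.
have out := out_range e1; have [out1 outle] := out.
have nW : mnth W (mlen e) <> 0.
  apply: (vtrace_defined gateP constP az K1 KC) outle out1 _ => [j x _|]; first exact: val_leaf_len.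
  apply: leSS; apply: (degree_total e1 gateP K1) => i ir.
    by apply: dvar.
  by apply: dpar.
have [x Ex] := ge1S (proj1 (neq0_ge1 _) nW); rewrite Ex msubS1.
have tr := vtrace_TR (mblock N D P a) gateP constP az.
clear nW; move: Ex tr; rewrite -/W {}/W /vtrace seqE //; set V := blocks _ _ _ _ => Ex tr.
apply: (TR_Run gateP) Ex tr.
by apply/neq0_ge1.
Qed.

End Evaluation.

(** * Restrictions to a line *)

(* Arguments: N, b, k, z, a. *)
Definition f_hybrid_entry : pv 6 :=
  pifle (psucc 'p_0) 'p_3 (pnth 'p_2 'p_0) (pifle 'p_0 'p_3 'p_4 (pnth 'p_5 'p_0)).
(** The entries of a tuple are bounded by its code, so blocks of |b + (z + a)| bits suffice. *)
Definition f_hybrid : pv 5 :=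
  pcall (f_seq f_hybrid_entry) [tuple 'p_0; padd 'p_1 (padd 'p_3 'p_4); 'p_1; 'p_2; 'p_3; 'p_4].

Section Hybrids.

Local Open Scope m_scope.
Variable M : model.
Implicit Types (x y z u v w i j l r : M).
Variables (N D P a b k : M).

Definition mhybrid z := ap f_hybrid [:: N; b; k; z; a].

Lemma mhybridE z : mhybrid z = ap (f_seq f_hybrid_entry) [:: N; b + (z + a); b; k; z; a].
Proof. by rewrite /mhybrid /f_hybrid; move: (f_seq f_hybrid_entry) => F; pvs. Qed.

Lemma hybrid_entryE j w z : ap f_hybrid_entry [:: j; w; b; k; z; a] =
  if pselect (j < k) then mnth b j else if pselect (j <= k) then z else mnth a j.
Proof.
rewrite /f_hybrid_entry /pnth; case: pselect => jk /=; first by rewrite ifle_le; pvs.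
rewrite ifle_lt; pvs; last by apply/ltm_nle.
by case: pselect => jk' /=; [rewrite ifle_le; pvs | rewrite ifle_lt; pvs => //; apply/ltm_nle].
Qed.

Lemma ltm_irr j : ~ j < j.
Proof. by move=> /ltm_nle; apply; apply: lem_refl. Qed.

Hypotheses (Ckt : In_Ckt N D P) (aP : In_Zn N a) (kr : In_range k (mlen N)).
(** Only the coordinates before k are constrained, because in decoding the tuple in this place is
    [c], which has n - 1 coordinates. *)
Hypothesis bP : forall j, 1 <= j -> j < k -> exists z, Entry b j z /\ Is_int z.

Lemma nth_hybrid j z : In_range j (mlen N) -> Entry (mhybrid z) j (mnth (mhybrid z) j) /\
  [/\ j < k -> mnth (mhybrid z) j = mnth b j, j = k -> mnth (mhybrid z) j = z &
      k < j -> mnth (mhybrid z) j = mnth a j].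
Proof.
move=> jr; have [j1 jN] := jr; split.
  by rewrite mhybridE seqE //; apply: nth_entry => //; apply: Log_le (Log_len N) jN.
rewrite mhybridE; have [w [_ ->]] := seqP f_hybrid_entry (b + (z + a)) (erefl : size [:: b; k; z; a] = 4%N) j1 jN.
rewrite hybrid_entryE; have lt x : x <= b + (z + a) -> x < 1 # (b + (z + a)).
  by have := lt_p2 (b + (z + a)); mlra.
split=> [jk|->|kj].
- case: pselect => //= _; apply/fit_lt/lt.
  have [x [/[dup] /entry_nth -> /entry_le]] := bP j1 jk; move=> xb; mlra.
- case: pselect => [E|nE] /=; first by case: (ltm_irr E).
  case: pselect => [E|nE'] /=; last by case: nE'; apply: lem_refl.
  by apply/fit_lt/lt; mlra.
case: pselect => [jk|_] /=; first by case: (@ltm_irr j); apply: lem_trans jk (ltm_leW kj).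
case: pselect => [jk|_] /=; first by case: (@ltm_irr j); apply: lem_trans (leSS jk) kj.
by apply/fit_lt/lt; have [x [/[dup] /entry_nth -> /entry_le]] := aP jr; move=> xa _; mlra.
Qed.

Lemma hybrid_cases j : j < k \/ j = k \/ k < j.
Proof.
case: (leq_ltm k j) => [kj|]; [right | by left].
by case: (leq_ltm j k) => [jk|]; [left; apply: lem_anti | right].
Qed.

Lemma Is_hybrid_hybrid z : Is_hybrid N b k z a (mhybrid z).
Proof.
move=> j jr; exists (mnth (mhybrid z) j); have [ent [lt eq gt]] := nth_hybrid z jr.
split=> //; split=> [jk|].
  by rewrite lt //; case: jr => j1 _; have [x [/[dup] /entry_nth ->]] := bP j1 jk.
by split=> [/eq //|kj]; rewrite gt //; have [x [/[dup] /entry_nth ->]] := aP jr.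
Qed.

Lemma Is_hybrid_nth z h j : Is_hybrid N b k z a h -> In_range j (mlen N) ->
  Entry h j (mnth (mhybrid z) j).
Proof.
move=> hyb jr; have [y [hy [lt [eq gt]]]] := hyb j jr.
have [_ [lt' eq' gt']] := nth_hybrid z jr.
suff -> : mnth (mhybrid z) j = y by [].
case: (hybrid_cases j) => [jk|[jk|kj]]; first by rewrite lt' // (entry_nth (lt jk)).
  by rewrite eq' // eq.
by rewrite gt' // (entry_nth (gt kj)).
Qed.

Lemma hybrid_Zn z : Is_int z -> In_Zn N (mhybrid z).
Proof.
move=> iz_ j jr; exists (mnth (mhybrid z) j); have [ent [lt eq gt]] := nth_hybrid z jr.
split=> //; case: (hybrid_cases j) => [jk|[jk|kj]].
- by rewrite lt //; case: jr => j1 _; have [x [/entry_nth ->]] := bP j1 jk.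
- by rewrite eq.
by rewrite gt //; have [x [/entry_nth ->]] := aP jr.
Qed.

Definition line_val z := mev N D P (mhybrid z).

Lemma Eval_line z : Is_int z -> Eval P (mhybrid z) (line_val z).
Proof. by move=> iz_; apply: mev_correct Ckt (hybrid_Zn iz_). Qed.

End Hybrids.

(** * Uniqueness of values and congruence along a line *)

Section EvalUnique.

Local Open Scope m_scope.
Variable M : model.
Implicit Types (N D P a v x i : M).

Lemma Eval_uniq N D P a a' v v' : In_Ckt N D P -> In_Zn N a ->
  (forall i x, In_range i (mlen N) -> Entry a i x -> Entry a' i x) ->
  Eval P a v -> Eval P a' v' -> v = v'.
Proof.
move=> /In_Ckt_data [e [f [c [G [-> e1 gateP constP _]]]]] aP aa' va va'.
have aP' : In_Zn N a' by move=> i ir; have [z [/(aa' _ _ ir) az iz_]] := aP i ir; exists z.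
apply: Cong0; first exact: Eval_int e1 gateP constP _ _ aP va.
  exact: Eval_int e1 gateP constP _ _ aP' va'.
apply: (Eval_cong e1 gateP) va va' _ => i x x' ir /(aa' _ _ ir) /entry_nth <- /entry_nth <-.
exact: Cong_refl.
Qed.

Lemma Eval_mev N D P a : In_Ckt N D P -> In_Zn N a -> Eval P a 0 <-> mev N D P a = 0.
Proof.
move=> ckt aP; have ev := mev_correct ckt aP; split=> [e0|<- //].
exact: Eval_uniq ckt aP (fun _ _ _ H => H) ev e0.
Qed.

Lemma mev_int N D P a : In_Ckt N D P -> In_Zn N a -> Is_int (mev N D P a).
Proof.
move=> ckt aP; have := mev_correct ckt aP.
have [e [f [c [G [EP e1 gateP constP _]]]]] := In_Ckt_data ckt; rewrite {1}EP.
exact: (Eval_int e1 gateP constP aP).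
Qed.

Variables (N D P a b k : M).
Hypotheses (Ckt : In_Ckt N D P) (aP : In_Zn N a) (kr : In_range k (mlen N)).
Hypothesis bP : forall j, 1 <= j -> j < k -> exists z, Entry b j z /\ Is_int z.

Local Notation q := (line_val N D P a b k).

Lemma Hybrid_zero_iff z : Is_int z -> Hybrid_zero N P b k z a <-> q z = 0.
Proof.
move=> iz_; split=> [[h [hyb e0]]|qz].
  apply: (Eval_uniq Ckt (hybrid_Zn aP bP iz_) _ (Eval_line Ckt aP bP iz_) e0) => i x ir.
  by move/entry_nth <-; apply: Is_hybrid_nth.
exists (mhybrid N a b k z); split; first exact: Is_hybrid_hybrid.
by rewrite -qz; apply: Eval_line.
Qed.

Lemma line_cong mu z z' : Is_int z -> Is_int z' -> Cong mu z z' -> Cong mu (q z) (q z').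
Proof.
move=> iz_ iz' cz; have [e [f [c [G [EP e1 gateP constP _]]]]] := In_Ckt_data Ckt.
have := Eval_line Ckt aP bP iz_; have := Eval_line Ckt aP bP iz'; rewrite {1 3}EP => ev' ev.
apply: (Eval_cong e1 gateP) ev ev' _ => i x x' ir /entry_nth <- /entry_nth <-.
have [_ [lt eq gt]] := nth_hybrid aP bP z ir; have [_ [lt' eq' gt']] := nth_hybrid aP bP z' ir.
case: (hybrid_cases k i) => [ik|[ik|ki]]; first by rewrite lt // lt' //; apply: Cong_refl.
  by rewrite eq // eq'.
by rewrite gt // gt' //; apply: Cong_refl.
Qed.

End EvalUnique.

(** * Counting roots *)

(* Partial products of the z - w_i / 2; the arguments are j, X, C, z, w. *)
Definition f_product_entry : pv 4 :=
  pmul (pifle 'p_0 pone pone (pnth 'p_1 (psub 'p_0 pone))) (psub 'p_2 (phalf (pnth 'p_3 'p_0))).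
Definition f_product : pv 5 :=
  pcond 'p_0 pone (pnth (pcall (f_seq f_product_entry) [tuple 'p_1; 'p_2; 'p_3; 'p_4]) 'p_0).

(** Leaves the arithmetic tactics only the facts moved to the goal beforehand, which keeps their
    search small. *)
Ltac mfocus := repeat match goal with
  | H : ?P |- _ => lazymatch type of P with Prop => clear H end
  end.
Ltac log := repeat first [apply: Log_len | assumption | apply: LogS | apply: LogD | apply: LogM | apply: Log0].

Section Products.

Local Open Scope m_scope.
Variable M : model.
Implicit Types (x y z u v i j r B Z : M).
Variables (X C w : M).

Definition mproduct z j := ap f_product [:: j; X; C; z; w].
Local Notation rho j := (mhalf (mnth w j)).

Lemma mproduct0 z : mproduct z 0 = 1.
Proof. by rewrite /mproduct /f_product ap_pcond; pvs; rewrite cond0. Qed.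

Lemma mproductE z j : j <> 0 -> mproduct z j = mnth (ap (f_seq f_product_entry) [:: X; C; z; w]) j.
Proof.
move=> nj; rewrite /mproduct /f_product ap_pcond /pnth; move: (f_seq f_product_entry) => F; pvs.
by rewrite cond1.
Qed.

Lemma mproductS z j : j < mlen X -> mproduct z j.+1 = mfit C (mproduct z j * msub z (rho j.+1)).
Proof.
move=> jX; rewrite mproductE; last exact: S_neq0.
have [v [Hv ->]] := seqP f_product_entry C (erefl : size [:: z; w] = 2%N) (leSS (le0m j)) jX.
congr (mfit C _); rewrite /f_product_entry /psub /pnth; pvs; congr (_ * msub z (mhalf _)).
case: (EM (j = 0)) => [->|nj].
  by rewrite ifle_le; pvs; rewrite ?mproduct0 //; apply: lem_refl.
rewrite ifle_lt; pvs; last by move/neq0_ge1 in nj; mlra.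
rewrite -[ap f_sub _]/(msub _ _) msubS1 mproductE // -Hv //; exact: lem_refl.
Qed.

Lemma len_mproduct z zeta : (forall j, j < mlen X -> mlen (msub z (rho j.+1)) <= zeta) ->
  forall j, j <= mlen X -> mlen (mproduct z j) <= j * zeta + 1.
Proof.
move=> Hz; apply: (@lind M [:: X; C; z; w; zeta]); [exact: Log_len | deft | by rewrite /mproduct; def | |].
  by rewrite mproduct0 len1; mlra.
move=> j jX IH; rewrite mproductS //; apply: lem_trans (le_len (fit_le _ _)) _.
apply: lem_trans (len_mul _ _) _; have := Hz j jX; mlra.
Qed.

(** Partial products are cut to |C| bits; with enough bits the recursion is exact. *)
Lemma mproduct_rec z zeta : (forall j, j < mlen X -> mlen (msub z (rho j.+1)) <= zeta) ->
  mlen X * zeta + 1 <= mlen C ->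
  forall j, j < mlen X -> mproduct z j.+1 = mproduct z j * msub z (rho j.+1).
Proof.
move=> Hz zC j jX; rewrite mproductS //; apply/fit_lt/len_p2.
apply: lem_trans (len_mul _ _) _; apply: lem_trans zC.
have := len_mproduct Hz (ltm_leW jX); have := Hz j jX; have : j.+1 * zeta <= mlen X * zeta by apply: mul_le jX (lem_refl _).
mlra.
Qed.

End Products.

(** * Divisibility without greatest common divisors *)

Section DivisibilityStep.

Local Open Scope m_scope.
Variable M : model.
Implicit Types (A B E F U Y x y s z t : M).

(** The bound on the quotient keeps the congruence a Sigma^b_1 condition in the induction over the
    factors. *)
Lemma product_cong A F x s t t' : 1 <= x -> A = F + x * s -> t' = x + t ->
  exists s', s' <= A * t' /\ A * t' = F * t + x * s'.
Proof.
move=> x1 EA Et; have E : A * t' = F * t + x * (A + s * t) by rewrite Et; transitivity (A * x + (F + x * s) * t); [rewrite -EA | ]; mring.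
exists (A + s * t); split=> //; rewrite E; apply: (@lem_trans _ (x * (A + s * t))); last by rewrite [F * t + _]maddC; apply: lem_addr.
by rewrite -{1}(mul1m (A + s * t)); apply: mul_le x1 (lem_refl _).
Qed.

(** From A U = E Y and A = F + x s it follows that x divides F U. With x U' = F U one gets A x U' =
    F A U = F E Y. The remainder F is the price for adjoining the divisor x. *)
Lemma divides_step A E F U Y x y s : 1 <= x -> A * U = E * Y -> A = F + x * s -> Y = x * y ->
  exists U', (A * x) * U' = (F * E) * Y.
Proof.
move=> x1 AU EA EY; have H : F * U + x * (s * U) = x * (E * y).
  by transitivity (A * U); [rewrite EA; mring | rewrite AU EY; mring].
have le : s * U <= E * y by apply/(lem_mul2l _ _ x1); rewrite -H maddC; apply: lem_addr.
have EU := addm_sub le; exists (msub (E * y) (s * U)); set U' := msub _ _ in EU *.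
have xU : x * U' = F * U by apply: (@addm_inj _ (x * (s * U))); rewrite -mmulDr EU -H; mring.
by rewrite mmulA xU; transitivity (F * (A * U)); [mring | rewrite AU; mring].
Qed.

Lemma quotient_ge0 x Y (S : zint M) : 1 <= x -> (iz Y = iz x * S)%R -> exists y, Y = x * y.
Proof.
move=> /iz_leE; rewrite izS iz0 => x1; case: (zint_cases S) => [[y ->]|[y ny ->]] E.
  by exists y; apply: iz_inj; rewrite izM.
have /neq0_ge1 /iz_leE := ny; rewrite izS iz0 => y1; have := iz_ge0 Y; rewrite E => H; exfalso; nra.
Qed.

End DivisibilityStep.

(** * A line with d + 1 roots *)

Section RootCounting.

Local Open Scope m_scope.
Variable M : model.
Implicit Types (x y z u v i j r B Z S : M).
Variables (N D P a b k : M).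
Hypotheses (Ckt : In_Ckt N D P) (aP : In_Zn N a) (kr : In_range k (mlen N)).
Hypothesis bP : forall j, 1 <= j -> j < k -> exists z, Entry b j z /\ Is_int z.

Local Notation q := (line_val N D P a b k).

Lemma q_int z : Is_int z -> Is_int (q z).
Proof. by move=> iz_; apply: mev_int Ckt (hybrid_Zn aP bP iz_). Qed.

(** The k-th variable is the exceptional input of [size_bound]. All other inputs go into [S], which
    is fixed before [Z]. *)
Lemma line_size : exists S, Log S /\
  forall Z, mlen (mhalf (q (2 * (1 # Z)))) <= S + mlen D * mlen Z.
Proof.
have [e [f [c [G [EP e1 gateP constP [dvar dpar]]]]]] := In_Ckt_data Ckt.
pose K := ((mlen N + mlen f) * mlen D).+1; have K1 : 1 <= K by apply/leSS/le0m.
(* The successor accounts for |B| = |Z| + 1. *)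
pose L := (mlen a + mlen b + mlen c).+1.
exists (K * (L + mlen e)); split; first by rewrite /K /L; log.
move=> Z; set B := 1 # Z.
have := Eval_line Ckt aP bP (@int_even _ B); rewrite {1}EP => /(Eval_TR gateP) [w [out tr]].
have [v [dv vd]] := dvar k kr; move: dv; rewrite {1}EP => /(Run_TR gateP) [dl [dout dtr]].
have [out1 outle] := out_range e1.
have TK : mnth (dtrace e G K (mlen N) (mlen f)) (mlen e) < K.
  by apply: leSS; apply: (degree_total (c := c) e1 gateP K1) => i ir; rewrite -EP; [apply: dvar | apply: dpar].
have Hleaf j x : In_range j (mlen e) -> val_leaf (mhybrid N a b k (2 * B)) c (mnth G j) x ->
    mlen (mhalf x) <= L \/ mnth G j = mvar k /\ mlen (mhalf x) <= L + mlen Z.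
  move=> jr [[i [g ix]]|[i [_ /entry_le xc]]]; last first.
    by left; apply: lem_trans (le_len (half_le x)) _; have := le_len xc; rewrite /L; mlra.
  have ir : In_range i (mlen N).
    have [n01 _ _ _] := num_neq M.
    case: (leaf_kind gateP jr); rewrite g ?fst_var; first exact: le0m.
      by case=> i' [ir /mpair_inj [_ ->]].
    by case=> i' [ir /mpair_inj []].
  have [_ [lt eq gt]] := nth_hybrid aP bP (2 * B) ir; rewrite -(entry_nth ix).
  case: (hybrid_cases k i) => [ik|[ik|ki]].
  - left; rewrite lt //; case: ir => i1 _; have [y [/[dup] /entry_nth -> /entry_le yb _]] := bP i1 ik.
    by apply: lem_trans (le_len (half_le y)) _; have := le_len yb; rewrite /L; mlra.
  - by right; rewrite eq // half_double g ik; split=> //; rewrite /B len_smash1 /L; mlra.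
  left; rewrite gt //; have [y [/[dup] /entry_nth -> /entry_le ya _]] := aP ir.
  by apply: lem_trans (le_len (half_le y)) _; have := le_len ya; rewrite /L; mlra.
have nw : mnth w (mlen e) <> 0 by rewrite out; apply: S_neq0.
have nd : mnth dl (mlen e) <> 0 by rewrite dout; apply: S_neq0.
have := size_bound gateP K1 tr Hleaf (or_intror dtr) outle out1 TK nw (or_intror nd).
rewrite out dout !msubS1 => le; apply: lem_trans le _.
by apply: lem_add; apply: mul_le => //; [exact: ltm_leW | exact: lem_refl | exact: lem_refl].
Qed.

Lemma pos_half y : mpos y <= mhalf y.
Proof.
case: (halfE y); move: (mhalf y) => h ->; rewrite ?pos_even ?pos_odd; first exact: lem_refl.
exact: le0m.
Qed.

(* If B - r divides the value at B for d + 1 small roots r, then up to a small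
   factor so does the product of the B - r, which exceeds the value at B. *)
Variables (Q w X : M).
Local Notation rho j := (mhalf (mnth w j)).
Hypothesis XD : mlen X = (mlen D).+1.
Hypothesis rootP : forall j, j < mlen X -> [/\ mnth w j.+1 = 2 * rho j.+1, rho j.+1 < mlen Q & q (mnth w j.+1) = 0].
Hypothesis monoP : forall j, j.+1 < mlen X -> mnth w j.+1 < mnth w j.+1.+1.

Lemma rho_mono i j : i < j -> j < mlen X -> rho i.+1 < rho j.+1.
Proof.
move=> ij jX; have H : forall j, j <= msub (mlen X) 1 -> i < j -> rho i.+1 < rho j.+1.
  have X1 : 1 <= mlen X by rewrite XD; apply/leSS/le0m.
  have EX := addm_sub X1.
  apply: (@lind M [:: X; i; w]); [by apply: Log_le (Log_len X) _; mlra | deft | by def | by move/lem0/S_neq0 |].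
  move=> l lX IH il; have lX' : l.+1 < mlen X by mlra.
  have lt : rho l.+1 < rho l.+1.+1.
    have [E1 _ _] := rootP (ltm_leW lX'); have [E2 _ _] := rootP lX'.
    case: (leq_ltm (rho l.+1.+1) (rho l.+1)) => // le; exfalso.
    by have lt := monoP lX'; mlra.
  case: (leq_ltm i.+1 l) => [il'|li]; first by have := IH il'; mlra.
  by have -> : i = l by apply: lem_anti; split; apply: le_SS.
by apply: H => //; have := addm_sub (lem_trans (leSS (le0m j)) jX); mlra.
Qed.

Lemma len_le x : mlen x <= x.
Proof.
move: x; apply: (@pind M [::]) => [| |x IH]; first by def.
  by rewrite len0; apply: lem_refl.
case: (EM (x = 0)) => [->|nx]; first by rewrite len0; apply: lem_refl.
by rewrite len_half //; case: (half_cases nx) => [[E /neq0_ge1 h1]|E]; mlra.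
Qed.

Lemma line_root y : Is_int y -> q y = 0.
Proof.
move=> iy; have [S [LS HS]] := line_size.
(* A difference of two roots has length at most q', so [W] bounds the length of F, the product of
   the r_j - r_i over i < j. *)
pose q' := mlen Q; pose W := mlen X * q' + 1.
(* |X| * W covers the accumulated factor E, [S] the constant part of |q(B)|, and |X| the bits lost
   in multiplying the B - r_i. The remaining terms make B large compared with the roots, y and
   q(y). *)
have [Z EZ] : Log (mlen X * W + S + mlen X + q' + mlen y + mlen (q y) + 3).
  by rewrite /W /q'; log.
pose B := 1 # Z; pose Y := mhalf (q (2 * B)).
have X1 : 1 <= mlen X by rewrite XD; apply/leSS/le0m.
have WX : mlen X * 1 <= mlen X * W by apply: mul_le (lem_refl _) _; rewrite /W maddC; apply: lem_addr.
have ZB : Z < B by apply: lt_p2.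
have q'Z : q' + 2 <= mlen Z by rewrite -EZ; mlra.
have nZ : Z <> 0 by move=> Z0; rewrite Z0 len0 in q'Z; mlra.
have EZh := len_half nZ.
have EB : B = 2 * (1 # mhalf Z) by apply: p2_half.
have qB : q' < 1 # mhalf Z.
  by apply: lem_trans (lt_p2 _); apply: leSS; apply: lem_trans (len_le _); rewrite EZh in q'Z; mlra.
have rhoq j : j < mlen X -> rho j.+1 < q' by case/rootP.
have rhoB j : j < mlen X -> rho j.+1 + (1 # mhalf Z) < B by move/rhoq => H; rewrite EB; mlra.
have [C EC] : Log (mlen X * (mlen Z).+1 + 1) by log.
have lenB : mlen B = (mlen Z).+1 by rewrite /B len_smash1.
have leB j : j < mlen X -> rho j.+1 <= B by move/rhoB => H; mlra.
have Bfactor j : j < mlen X -> mlen (msub B (rho j.+1)) <= (mlen Z).+1.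
  by move=> jX; rewrite -lenB; apply: le_len; have E := addm_sub (leB j jX); move: E; mfocus; mlra.
(* The root is below half of B, so B - r is at most one bit shorter than B. *)
have Bfactor_ge j : j < mlen X -> mlen Z <= mlen (msub B (rho j.+1)).
  move=> jX; rewrite EZh; case: (leq_ltm (mlen (msub B (rho j.+1))) (mlen (mhalf Z))) => //.
  by move=> /len_p2 H; have E := addm_sub (leB j jX); have H' := rhoB j jX; exfalso; move: H H' E; mfocus; mlra.
have Bfactor1 j : j < mlen X -> 1 <= msub B (rho j.+1).
  by move=> jX; have E := addm_sub (leB j jX); have H := rhoB j jX; move: E H; mfocus; mlra.
have sub_rho i j : j < mlen X -> msub (rho j.+1) (rho i.+1) < q'.
  move=> jX; have H := rhoq j jX; case: (leq_ltm (rho i.+1) (rho j.+1)) => [/addm_sub E|/ltm_leW /msub_le0 ->].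
    by move: H E; mfocus; mlra.
  by move: H; mfocus; mlra.
pose pr z j := mproduct X C w z j.
have prB := mproduct_rec Bfactor (eq_ind _ (fun t => t <= mlen C) (eq_ind _ (fun t => _ <= t) (lem_refl _) _ EC) _ erefl).
have prr j : j < mlen X -> forall i, i < mlen X ->
    pr (rho j.+1) i.+1 = pr (rho j.+1) i * msub (rho j.+1) (rho i.+1).
  move=> jX; apply: (@mproduct_rec _ X C w _ (mlen Z).+1); last by rewrite -EC; apply: lem_refl.
  by move=> i iX; apply: lem_trans (len_le _) _; have H := sub_rho i j jX; move: H q'Z; mfocus; mlra.
have lower : forall j, j <= mlen X -> pr B j <> 0 /\ j * mlen Z + 1 <= mlen (pr B j) + j.
  rewrite /pr; apply: (@lind M [:: X; C; w; B; Z]); [exact: Log_len | deft | by rewrite /mproduct; def | |].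
    by rewrite mproduct0 len1; split; [apply: S_neq0 | mfocus; mlra].
  move=> j jX [n0 le]; rewrite prB //; have nf : msub B (rho j.+1) <> 0 by apply/neq0_ge1/Bfactor1.
  split; first by move/mulm_eq0 => [].
  by have H1 := len_mul_ge n0 nf; have H2 := Bfactor_ge j jX; move: le H1 H2; mfocus; mlra.
(* The roots are distinct, so F is nonzero, and with it the accumulated factor [E]. *)
have prr_neq0 j : j < mlen X -> forall i, i <= j -> pr (rho j.+1) i <> 0.
  move=> jX; rewrite /pr; apply: (@lind M [:: X; C; w; j]); [ by apply: Log_le (Log_len X) (ltm_leW jX) | deft | by rewrite /mproduct; def | |].
    by rewrite mproduct0; apply: S_neq0.
  move=> i ij n0; have iX : i < mlen X by apply: lem_trans ij (ltm_leW jX).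
  have := prr j jX i iX; rewrite /pr => ->; case/mulm_eq0 => // E0.
  by have lt := rho_mono ij jX; have := addm_sub (ltm_leW lt); rewrite E0 => E; move: lt E; mfocus; mlra.
have prr_len j : j < mlen X -> forall i, i <= mlen X -> mlen (pr (rho j.+1) i) <= i * q' + 1.
  move=> jX; apply: len_mproduct => i iX; apply: lem_trans (len_le _) _.
  exact: ltm_leW (sub_rho i j jX).
have cong j : j < mlen X -> forall i, i <= j -> exists s, s <= pr B i /\
    pr B i = pr (rho j.+1) i + msub B (rho j.+1) * s.
  move=> jX; rewrite /pr; apply: (@lind M [:: X; C; w; j; B]); [ by apply: Log_le (Log_len X) (ltm_leW jX) | deft | by rewrite /mproduct; def | |].
    by exists 0; rewrite !mproduct0; split; [apply: le0m | mring].
  move=> i ij [s [_ Es]]; have iX : i < mlen X by apply: lem_trans ij (ltm_leW jX).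
  have := prr j jX i iX; rewrite /pr => ->; rewrite prB //.
  apply: product_cong Es _; first exact: Bfactor1.
  apply: (@addm_inj _ (rho i.+1)); rewrite (addm_sub (leB i iX)).
  have lt := rho_mono ij jX; have E1 := addm_sub (ltm_leW lt); have E2 := addm_sub (leB j jX).
  by rewrite -{1}E2 -{1}E1; mring.
have divY j : j < mlen X -> exists y', Y = msub B (rho j.+1) * y'.
  move=> jX; have x1 := Bfactor1 j jX; have [Ew _ qw] := rootP jX.
  have ir : Is_int (mnth w j.+1) by rewrite Ew; apply: int_even.
  have : Cong (msub B (rho j.+1)) (q (2 * B)) (q (mnth w j.+1)).
    apply: (line_cong Ckt aP bP) => //; first exact: int_even.
    apply/CongP; exists 1%R; rewrite Ew !mval_even half_double.
    by have /iz_eqE := addm_sub (leB j jX); rewrite izD GRing.mulr1 => <-; ring.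
  case/CongP => S'; rewrite qw mval0 GRing.subr0.
  case: (mval_half (q (2 * B))) => -> E; first exact: quotient_ge0 x1 E.
  by apply: (@quotient_ge0 _ _ _ (- S')%R) x1 _; rewrite GRing.mulrN -E GRing.opprK.
(* [1 # bE] bounds every accumulated factor, which makes the condition in [main] Sigma^b_1. *)
have [bE EbE] : Log (mlen X * W + 1) by rewrite /W /q'; log.
have main : forall j, j <= mlen X -> exists E, E <= 1 # bE /\ (E <> 0 /\ mlen E <= j * W + 1 /\
    exists U, U <= E * Y /\ pr B j * U = E * Y).
  rewrite /pr; apply: (@lind M [:: X; C; w; B; bE; Y; W]); [exact: Log_len | deft | by rewrite /mproduct; def | |].
    exists 1; split; first exact: p2_gt0; split; first exact: S_neq0.
    split; first by rewrite len1; mfocus; mlra.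
    by exists Y; rewrite mproduct0 mul1m; split; first exact: lem_refl.
  move=> j jX [E [_ [nE [lE [U [_ AU]]]]]].
  have [s [_ Es]] := cong j jX j (lem_refl j); have [y' Ey'] := divY j jX.
  have [U' AU'] := divides_step (Bfactor1 j jX) AU Es Ey'.
  have nF := prr_neq0 j jX j (lem_refl j); have lF := prr_len j jX j (ltm_leW jX).
  have lFE : mlen (pr (rho j.+1) j * E) <= j.+1 * W + 1.
    apply: lem_trans (len_mul _ _) _; apply: (@lem_trans _ ((mlen X * q' + 1) + (j * W + 1))).
      apply: lem_add => //; apply: lem_trans lF _; apply: lem_add2r.
      by apply: mul_le (lem_refl _); apply: ltm_leW.
    by rewrite -/W; mfocus; mlra.
  exists (pr (rho j.+1) j * E); split.
    apply: ltm_leW; apply/len_p2; rewrite -EbE; apply: lem_trans lFE _; apply: lem_add2r.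
    exact: mul_le jX (lem_refl _).
  split; first by move/mulm_eq0 => [].
  split=> //; exists U'; rewrite prB // AU'; split=> //; rewrite -AU' -{1}(mul1m U').
  apply: mul_le (lem_refl _); apply/neq0_ge1; rewrite -prB //.
  by case: (lower _ jX).
(* Otherwise (d + 1)(|Z| - 1) + 1 <= |E| + |Y| <= (d + 1) W + 1 + S + d |Z|, hence |Z| <= (d + 1) W
   + S + d + 1, against the choice of [Z]. *)
have Y0 : Y = 0.
  case: (EM (Y = 0)) => // nY; have [E [_ [nE [lE [U [_ AU]]]]]] := main _ (lem_refl _).
  have nU : U <> 0 by move=> U0; move: AU; rewrite U0 mmulx0 => /esym /mulm_eq0 [].
  have [nA lA] := lower _ (lem_refl _).
  have lAU : mlen (pr B (mlen X)) <= mlen E + mlen Y.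
    apply: lem_trans (len_mul E Y); rewrite -AU; apply: le_len.
    by rewrite -{1}[pr _ _]mul1m mmulC; apply: mul_le (lem_refl _) _; apply/neq0_ge1.
  have lY := HS Z; rewrite -/B -/Y in lY; rewrite XD in lA lAU lE EZ.
  by exfalso; move: lA lAU lE lY EZ; rewrite -/W; mfocus; move: (mlen (pr _ _)) (mlen E) => *; mlra.
have half_int0 x : Is_int x -> mhalf x = 0 -> x = 0.
  by move=> ix h0; apply/mval_eq0 => //; case: (mval_half x) => ->; rewrite h0 iz0 ?GRing.oppr0.
have q0 : q (2 * B) = 0 by apply: half_int0 Y0; apply/q_int/int_even.
have small x : mlen x <= mlen (mhalf Z) -> mhalf x < 1 # mhalf Z.
  by move=> le; apply: lem_trans (leSS (half_le x)) _; apply/len_p2.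
have ysmall : mhalf y < 1 # mhalf Z by apply: small; rewrite EZh in EZ; move: EZ WX; mfocus; mlra.
have qsmall : mhalf (q y) < 1 # mhalf Z by apply: small; rewrite EZh in EZ; move: EZ WX; mfocus; mlra.
have posB : mpos y <= B + mneg y.
  by have H := pos_half y; rewrite EB; move: H ysmall; mfocus; mlra.
(* [mu] is B - y for the signed integer y; it divides q(y) and exceeds its absolute value. *)
have Emu := addm_sub posB; set mu := msub _ _ in Emu.
have mu1 : mhalf (q y) < mu by have H := pos_half y; rewrite EB in Emu; move: H Emu ysmall qsmall; mfocus; mlra.
have : Cong mu (q (2 * B)) (q y).
  apply: (line_cong Ckt aP bP) => //; first exact: int_even.
  apply/CongP; exists 1%R; rewrite mval_even /mval.
  by have := iz_eqE Emu; rewrite !izD GRing.mulr1 => H; lra.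
case/CongP => S'; rewrite q0 mval0 GRing.sub0r => E.
have [y' Ey'] : exists y', mhalf (q y) = mu * y'.
  have mu0 : 1 <= mu by move: mu1; mfocus; mlra.
  case: (mval_half (q y)) => H; rewrite H in E.
    by apply: (@quotient_ge0 _ _ _ (- S')%R) mu0 _; rewrite GRing.mulrN -E GRing.opprK.
  by apply: (@quotient_ge0 _ _ _ S') mu0 _; rewrite -E GRing.opprK.
apply: half_int0; first exact: q_int.
case: (EM (y' = 0)) => [y0|/neq0_ge1 y1]; first by rewrite Ey' y0 mmulx0.
by exfalso; have := mul_le (lem_refl mu) y1; rewrite -Ey' => H; move: H mu1; mfocus; mlra.
Qed.

End RootCounting.

(** * Enumerating zeros *)

Definition f_count_entry n (f : pv n.+1) : pv n.+2 :=
  padd (pnth 'p_1 (psub 'p_0 pone)) (pcond (pcall f [tuple of 'p_0 :: prest 2 n]) pone pzero).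
(* The number of zeros i of [f] with 1 <= i <= j; the arguments are X, j, where
   j <= |X|, and the remaining arguments of [f]. *)
Definition f_count n (f : pv n.+1) : pv n.+2 :=
  pnth (pcall (f_seq (f_count_entry f)) [tuple of 'p_0 :: 'p_0 :: prest 2 n]) 'p_1.
(** The i-th zero comes right after the last t with fewer than i zeros up to t. The test is monotone
    in t and fails beyond |X|, as binary search requires. *)
Definition f_find_test n (f : pv n.+1) : pv n.+3 :=
  pifle 'p_0 (plen 'p_1)
    (pcall f_leq [tuple psucc (pcall (f_count f) [tuple of 'p_1 :: 'p_0 :: prest 3 n]); 'p_2]) pone.
(* The i-th zero of [f]; the arguments are X, i and the remaining arguments of [f]. *)
Definition f_find n (f : pv n.+1) : pv n.+2 :=
  psucc (pbsearch (f_find_test f) (plen 'p_0) [tuple of 'p_0 :: 'p_1 :: prest 2 n]).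

Section Counting.

Local Open Scope m_scope.
Variable M : model.
Implicit Types (x y z u v i j r : M).
Variables (n : nat) (f : pv n.+1) (X : M) (s : seq M).
Hypothesis sz : size s = n.

Local Notation zero i := (ap f (i :: s) = 0).
Definition mcount j := ap (f_count f) [:: X, j & s].
Definition mfind i := ap (f_find f) [:: X, i & s].

Lemma mcountE j : mcount j = mnth (ap (f_seq (f_count_entry f)) [:: X, X & s]) j.
Proof.
rewrite /mcount /f_count /pnth; move: (f_seq (f_count_entry f)) => F; pvs.
by rewrite map_prest /= ?sz // drop0.
Qed.

Lemma count0 : mcount 0 = 0.
Proof. by rewrite mcountE nth0. Qed.

Lemma count_fit j : j < mlen X -> mcount j.+1 = mfit X (mcount j + ap f_cond [:: ap f (j.+1 :: s); 1; 0]).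
Proof.
move=> jX; rewrite mcountE.
have [v [Hv ->]] := seqP (f_count_entry f) X sz (leSS (le0m j)) jX.
congr (mfit X _); rewrite /f_count_entry ap_padd /pnth /psub ap_pcond; pvs.
rewrite map_prest /= ?sz // drop0 -[ap f_sub _]/(msub _ _) msubS1; congr (_ + _).
by rewrite mcountE -Hv //; apply: lem_refl.
Qed.

Lemma count_bound : forall j, j <= mlen X -> mcount j <= j.
Proof.
apply: (@lind M (X :: s)) => [||||j jX IH]; first exact: Log_len.
- deft.
- by rewrite /mcount; def.
- by rewrite count0; apply: lem_refl.
rewrite count_fit //; apply: lem_trans (fit_le _ _) _; apply: (@lem_trans _ (j + 1)); last by mlra.
apply: lem_add => //.
case: (EM (zero j.+1)) => [->|nz]; first by rewrite cond0; apply: lem_refl.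
by rewrite cond1 //; apply: le0m.
Qed.

Lemma countS j : j < mlen X ->
  (zero j.+1 -> mcount j.+1 = (mcount j).+1) /\ (~ zero j.+1 -> mcount j.+1 = mcount j).
Proof.
move=> jX; have small x : x <= (mcount j).+1 -> x < 1 # X.
  by have := count_bound (ltm_leW jX); have := lt_p2 X; have := len_le X; mlra.
rewrite count_fit //; split=> [->|nz].
  by rewrite cond0 fit_lt; [mlra | apply: small; mlra].
by rewrite cond1 // maddx0; apply/fit_lt/small/leS/lem_refl.
Qed.

Lemma count_mono i j : i <= j -> j <= mlen X -> mcount i <= mcount j.
Proof.
move=> ij jX; suff H : forall j, j <= mlen X -> forall i, i <= mlen X -> i <= j -> mcount i <= mcount j.
  by apply: H => //; apply: lem_trans ij jX.
move=> {}j {}jX {i ij}; move: j jX.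
apply: (@lind M (X :: s)) => [||||j jX IH i iX ij]; first exact: Log_len.
- deft.
- by rewrite /mcount; def.
- by move=> i _ /lem0 ->; apply: lem_refl.
have le : mcount j <= mcount j.+1.
  have [H1 H2] := countS jX; case: (EM (zero j.+1)) => [/H1 ->|/H2 ->]; last exact: lem_refl.
  exact/leS/lem_refl.
case: (leSP ij) => [/(IH i iX) H|->]; last exact: lem_refl.
exact: lem_trans H le.
Qed.

Lemma find_testE t i : ap (f_find_test f) [:: t, X, i & s] = 0 <-> t <= mlen X /\ mcount t < i.
Proof.
rewrite /f_find_test /mcount; move: (f_count f) => F; case: (leq_ltm t (mlen X)) => [le|lt].
  rewrite ifle_le; last by pvs.
  by pvs; rewrite map_prest /= ?sz // drop0; split=> [/f_leqP|[_ H]] //; apply/f_leqP.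
rewrite ifle_lt; last by pvs.
by pvs; split=> [/S_neq0 //|[tX _]]; case/ltm_nle: lt.
Qed.

Lemma findE i : mfind i = (ap (f_bsearch (f_find_test f)) [:: mlen X, mlen X, X, i & s]).+1.
Proof.
rewrite /mfind /f_find /pbsearch; move: (f_bsearch _) => F; pvs.
by rewrite map_prest /= ?sz // drop0.
Qed.

Lemma findP i : 1 <= i -> i <= mcount (mlen X) ->
  exists r, [/\ mfind i = r.+1, r < mlen X, mcount r < i, mcount r.+1 = i & zero r.+1].
Proof.
move=> i1 iX; have sz' : size [:: X, i & s] = n.+2 by rewrite /= sz.
have [|||rX /find_testE [_ ri] nr] := @bsearchP M _ (f_find_test f) (mlen X) [:: X, i & s] sz'.
- by apply/find_testE; rewrite count0; split; first exact: le0m.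
- by move/find_testE => -[/ltm_irr].
- move=> x y xy /find_testE [yX yi]; apply/find_testE; split; first exact: lem_trans xy yX.
  by apply: lem_trans (leSS (count_mono xy yX)) yi.
rewrite findE; move: (ap _ _) rX ri nr => r rX ri nr; exists r.
have {}rX : r < mlen X.
  case: (leq_ltm (mlen X) r) => // Xr; case: (@ltm_irr _ i).
  by apply: lem_trans (leSS iX) _; have <- : r = mlen X by apply: lem_anti.
have ir : i <= mcount r.+1.
  by case: (leq_ltm i (mcount r.+1)) => // lt; case: nr; apply/find_testE.
have [H1 H2] := countS rX; case: (EM (zero r.+1)) => [/[dup] z0 /H1 E|/H2 E].
  by split=> //; apply: lem_anti; split=> //; rewrite E.
by case: (@ltm_irr _ i); apply: lem_trans (leSS ir) _; rewrite E.
Qed.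

Lemma find_count r : r < mlen X -> zero r.+1 ->
  [/\ 1 <= mcount r.+1, mcount r.+1 <= mcount (mlen X) & mfind (mcount r.+1) = r.+1].
Proof.
move=> rX z0; have [/(_ z0) E _] := countS rX.
have c1 : 1 <= mcount r.+1 by rewrite E; apply/leSS/le0m.
have cX := count_mono rX (lem_refl _); split=> //.
have [r' [-> r'X lt E' _]] := findP c1 cX; congr msucc.
have le x y : x < mlen X -> y < mlen X -> mcount x < mcount y.+1 -> x <= y.
  move=> xX yX lxy; case: (leq_ltm x y) => // yx; case: (@ltm_irr _ (mcount x)).
  exact: lem_trans lxy (count_mono yx (ltm_leW xX)).
by apply: lem_anti; split; apply: le => //; rewrite E' E; apply: lem_refl.
Qed.

End Counting.

(* The value at the root candidate 2 (j - 1); the arguments are j, N, D, P, a, b, k. *)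
Definition f_root_test : pv 7 :=
  pcall f_ev [tuple 'p_1; 'p_2; 'p_3;
    pcall f_hybrid [tuple 'p_1; 'p_5; 'p_6; pmul ptwo (psub 'p_0 pone); 'p_4]].
(* Arguments: j, w, Q, N, D, P, a, b, k. *)
Definition f_root_entry : pv 9 :=
  pmul ptwo (psub (pcall (f_find f_root_test) [tuple 'p_2; 'p_0; 'p_3; 'p_4; 'p_5; 'p_6; 'p_7; 'p_8]) pone).

Section Roots.

Local Open Scope m_scope.
Variable M : model.
Implicit Types (x y z u v i j r m w : M).
Variables (N D Q P a b k : M).
Hypotheses (Ckt : In_Ckt N D P) (aP : In_Zn N a) (kr : In_range k (mlen N)).
Hypothesis bP : forall j, 1 <= j -> j < k -> exists z, Entry b j z /\ Is_int z.

Local Notation q := (line_val N D P a b k).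
Local Notation cnt := (mcount f_root_test Q [:: N; D; P; a; b; k]).
Local Notation fnd := (mfind f_root_test Q [:: N; D; P; a; b; k]).

Lemma root_testE r : ap f_root_test [:: r.+1; N; D; P; a; b; k] = q (2 * r).
Proof.
rewrite /f_root_test /line_val /mev /mhybrid; move: f_ev f_hybrid => F H.
by rewrite /psub; pvs; rewrite -[ap f_sub _]/(msub _ _) msubS1.
Qed.

Lemma Root_list_exists : exists w, Root_list N Q P b k a (cnt (mlen Q)) w /\
  forall j, In_range j (cnt (mlen Q)) -> Entry w j (2 * msub (fnd j) 1).
Proof.
have sz : size [:: N; D; P; a; b; k] = 6%N by [].
(* Roots have codes 2 r with r < |Q|, so |2 * Q| bits suffice for each. *)
set m := cnt (mlen Q); set w := ap (f_seq f_root_entry) [:: Q; 2 * Q; Q; N; D; P; a; b; k].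
have mQ : m <= mlen Q by apply: count_bound => //; apply: lem_refl.
have ent j : In_range j m -> exists r, [/\ Entry w j (2 * r), r < mlen Q, cnt r.+1 = j, q (2 * r) = 0 & fnd j = r.+1].
  move=> [j1 jm]; have [r [fj rQ _ cr]] := findP sz j1 jm; rewrite root_testE => qr.
  exists r; split=> //; have -> : 2 * r = mnth w j.
    have [v [_ ->]] := seqP f_root_entry (2 * Q) (erefl : size [:: Q; N; D; P; a; b; k] = 7%N) j1 (lem_trans jm mQ).
    have -> : ap f_root_entry [:: j; v; Q; N; D; P; a; b; k] = 2 * r.
      move: fj; rewrite /f_root_entry /mfind; move: (f_find f_root_test) => F fj.
      by rewrite /psub; pvs; rewrite fj -[ap f_sub _]/(msub _ _) msubS1.
    by rewrite fit_lt //; have := lt_p2 (2 * Q); have := len_le Q; mlra.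
  rewrite /w seqE //; apply: nth_entry => //; apply: Log_le (Log_len Q) _; exact: lem_trans jm mQ.
exists w; split=> [|j jr]; last by have [r [H _ _ _ ->]] := ent j jr; rewrite msubS1.
have zero r : Hybrid_zero N P b k (2 * r) a <-> q (2 * r) = 0.
  by apply: (Hybrid_zero_iff Ckt aP bP (@int_even _ r)).
split=> //; split=> [j jr|].
  have [r [H rQ _ /zero z0 _]] := ent j jr; exists (2 * r); split=> //; split=> //.
  by exists r.
split=> [j j1 jm|_ [r [rQ ->]] /zero].
  have [r [H rQ cr _ _]] := ent j (conj j1 (ltm_leW jm)).
  have [r' [H' rQ' cr' _ _]] := ent j.+1 (conj (leS j1) jm).
  exists (2 * r), (2 * r'); split=> //; split=> //.
  have rr' : r < r'.
    case: (leq_ltm r' r) => // le; case: (@ltm_irr _ j); rewrite -{1}cr' -cr.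
    by apply: count_mono => //; apply: leSS.
  mlra.
rewrite -root_testE => z0; have [c1 cm fc] := find_count sz rQ z0.
exists (cnt r.+1); split=> //; have [r' [H _ _ _ ]] := ent _ (conj c1 cm).
by rewrite fc => /S_inj E; rewrite -E in H.
Qed.

End Roots.

(** * Encoding and decoding *)

(* Arguments: j, w, k, b. *)
Definition f_delete_entry : pv 4 := pifle (psucc 'p_0) 'p_2 (pnth 'p_3 'p_0) (pnth 'p_3 (psucc 'p_0)).
(* Arguments: N, k, b. *)
Definition f_delete : pv 3 := pcall (f_seq f_delete_entry) [tuple 'p_0; 'p_2; 'p_1; 'p_2].
(* Arguments: j, w, k, r, c. *)
Definition f_insert_entry : pv 5 :=
  pifle (psucc 'p_0) 'p_2 (pnth 'p_4 'p_0) (pifle 'p_0 'p_2 'p_3 (pnth 'p_4 (psub 'p_0 pone))).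
(* Arguments: N, k, r, c. *)
Definition f_insert : pv 4 :=
  pcall (f_seq f_insert_entry) [tuple 'p_0; padd 'p_2 'p_3; 'p_1; 'p_2; 'p_3].
(* P(b_1, ..., b_j, a_{j+1}, ..., a_n); the arguments are j, N, D, P, a, b. *)
Definition f_switch_test : pv 6 :=
  pcall f_ev [tuple 'p_1; 'p_2; 'p_3; pcall f_hybrid [tuple 'p_1; 'p_5; 'p_0; pnth 'p_5 'p_0; 'p_4]].

(** The position of b_k is the number of roots up to it. Candidate j stands for the value j - 1,
    hence the successor of half of the code of b_k. *)
Definition f_enc : pv 6 :=
  let k := pcall (f_find f_switch_test) [tuple 'p_0; pone; 'p_0; 'p_1; 'p_3; 'p_4; 'p_5] in
  let i := pcall (f_count f_root_test)
    [tuple 'p_2; psucc (phalf (pnth 'p_5 k)); 'p_0; 'p_1; 'p_3; 'p_4; 'p_5; k] in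
  let default := ppair pone (ppair pone pzero) in
  pcond (pcall f_ev [tuple 'p_0; 'p_1; 'p_3; 'p_4]) default
    (pcond (pcall f_ev [tuple 'p_0; 'p_1; 'p_3; 'p_5])
       (pifle i (plen 'p_1) (ppair k (ppair i (pcall f_delete [tuple 'p_0; k; 'p_5]))) default)
       default).

Definition f_dec : pv 6 :=
  let k := pfst 'p_5 in let i := pfst (psnd 'p_5) in let c := psnd (psnd 'p_5) in
  let m := pcall (f_count f_root_test) [tuple 'p_2; plen 'p_2; 'p_0; 'p_1; 'p_3; 'p_4; c; k] in
  let r := pmul ptwo (psub (pcall (f_find f_root_test) [tuple 'p_2; i; 'p_0; 'p_1; 'p_3; 'p_4; c; k]) pone) in
  pcond (pcall f_ev [tuple 'p_0; 'p_1; 'p_3; 'p_4]) pzero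
    (pifle i m (pcall f_insert [tuple 'p_0; k; r; c]) pzero).

(** * Deleting and inserting coordinates *)

Section Insertion.

Local Open Scope m_scope.
Variable M : model.
Implicit Types (N x y z u v i j r w b c k : M).

Definition mdelete N k b := ap f_delete [:: N; k; b].
Definition minsert N k r c := ap f_insert [:: N; k; r; c].

Lemma Log_range N j : In_range j (mlen N) -> Log j.
Proof. by case=> _; apply: Log_le (Log_len N). Qed.

Lemma entry_lt_p2 w c j y : w <= c -> Entry w j y -> y < 1 # c.
Proof. by move=> wc /entry_le yw; have := lt_p2 c; mlra. Qed.

Lemma Is_delete_delete N k b : (forall j, In_range j (mlen N) -> exists y, Entry b j y) ->
  Is_delete N k b (mdelete N k b).
Proof.
move=> bP j j1 jN; have [x xb] := bP j (conj j1 (ltm_leW jN)); have [y yb] := bP j.+1 (conj (leS j1) jN).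
have nE : mnth (mdelete N k b) j = mfit b (if pselect (j < k) then x else y).
  rewrite /mdelete /f_delete; have := @seqP M _ f_delete_entry N b [:: k; b] j erefl j1 (ltm_leW jN).
  move: (f_seq f_delete_entry) => F [v [_ E]]; pvs; rewrite E; congr (mfit b _).
  rewrite /f_delete_entry /pnth; case: pselect => jk /=.
    by rewrite ifle_le; pvs => //; apply: entry_nth.
  by rewrite ifle_lt; pvs; [apply: entry_nth | apply/ltm_nle].
have ent : Entry (mdelete N k b) j (mnth (mdelete N k b) j).
  rewrite /mdelete /f_delete; move: (@seqE M _ f_delete_entry N b [:: k; b] erefl).
  move: (f_seq f_delete_entry) => F E; pvs; rewrite E.
  by apply: nth_entry => //; apply: Log_range (conj j1 (ltm_leW jN)).
exists (mnth (mdelete N k b) j); split=> //; rewrite nE; case: pselect => jk /=.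
  rewrite fit_lt; last exact: entry_lt_p2 (lem_refl b) xb.
  by split=> // kj; case: (@ltm_irr _ j); apply: lem_trans jk kj.
by rewrite fit_lt; last exact: entry_lt_p2 (lem_refl b) yb.
Qed.

Lemma Is_insert_insert N k r c : In_range k (mlen N) ->
  (forall j, 1 <= j -> j < mlen N -> exists y, Entry c j y) ->
  Is_insert N k r c (minsert N k r c).
Proof.
move=> [k1 kN] cP j [j1 jN].
have cC : c <= r + c by rewrite maddC; apply: lem_addr.
have nE : mnth (minsert N k r c) j = mfit (r + c)
    (if pselect (j < k) then mnth c j else if pselect (j <= k) then r else mnth c (msub j 1)).
  rewrite /minsert /f_insert; have := @seqP M _ f_insert_entry N (r + c) [:: k; r; c] j erefl j1 jN.
  move: (f_seq f_insert_entry) => F [v [_ E]]; pvs; rewrite E; congr (mfit _ _).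
  rewrite /f_insert_entry /pnth /psub; case: pselect => jk /=; first by rewrite ifle_le; pvs.
  rewrite ifle_lt; pvs; last by apply/ltm_nle.
  by case: pselect => jk' /=; [rewrite ifle_le; pvs | rewrite ifle_lt; pvs => //; apply/ltm_nle].
have ent : Entry (minsert N k r c) j (mnth (minsert N k r c) j).
  rewrite /minsert /f_insert; move: (@seqE M _ f_insert_entry N (r + c) [:: k; r; c] erefl).
  move: (f_seq f_insert_entry) => F E; pvs; rewrite E.
  by apply: nth_entry => //; apply: Log_range (conj j1 jN).
exists (mnth (minsert N k r c) j); split=> //; rewrite nE; case: pselect => jk /=.
  have [x xc] := cP j j1 (lem_trans jk kN); rewrite (entry_nth xc) fit_lt; last exact: entry_lt_p2 cC xc.
  split=> //; split=> [E|i kj]; first by case: (@ltm_irr _ k); rewrite -{1}E.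
  by case: (@ltm_irr _ j); apply: lem_trans jk (ltm_leW kj).
case: pselect => jk' /=.
  rewrite fit_lt; last by have := lt_p2 (r + c); have := lem_addr r c; mlra.
  by split=> //; split=> // i kj; case: (@ltm_irr _ j); apply: lem_trans (leSS jk') kj.
split=> //; split=> [E|i kj E]; first by case: jk'; rewrite E; apply: lem_refl.
have i1 : 1 <= i by move: kj; rewrite E => /le_SS; apply: lem_trans.
have [|x xc] := cP i i1; first by rewrite -E.
by rewrite E msubS1 (entry_nth xc) fit_lt; last exact: entry_lt_p2 cC xc.
Qed.

Lemma mpair0 : mpair 0 0 = 0 :> M.
Proof. by rewrite /mpair; mring. Qed.

(** 0 is [mpair 0 0], a tuple with blocks of no bits, and so it codes the zero tuple of every
    length. The default outputs rely on it. *)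
Lemma entry0 j : 1 <= j -> Log j -> Entry 0 j 0.
Proof.
move=> j1 Lj; have := nth_entry 0 0 j1 Lj; have := nth_lt 0 0 j.
by rewrite p2_0 !mpair0 => /le_SS /lem0 ->.
Qed.

Lemma Enc_default_triple N : Enc_default N (mtriple 1 1 0).
Proof.
by exists 0; split=> // j j1 jN; apply: entry0 => //; apply: Log_range (conj j1 (ltm_leW jN)).
Qed.

Lemma Is_zero_tuple0 N : Is_zero_tuple N 0.
Proof. by move=> j [j1 jN]; apply: entry0 => //; apply: Log_range (conj j1 jN). Qed.

End Insertion.

Section Coding.

Local Open Scope m_scope.
Variable M : model.
Implicit Types (x y z u v i j r m w b c k : M).
Variables (N D Q P a : M).
Hypotheses (Ckt : In_Ckt N D P) (aP : In_Zn N a).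

Lemma In_S_int z : In_S Q z -> Is_int z.
Proof. by move=> [r [_ ->]]; apply: int_even. Qed.

Lemma line_val_eq b k z h v : (forall j, 1 <= j -> j < k -> exists z, Entry b j z /\ Is_int z) ->
  Is_int z -> Is_hybrid N b k z a h -> Eval P h v -> line_val N D P a b k z = v.
Proof.
move=> bP iz_ hyb; apply: (Eval_uniq Ckt (hybrid_Zn aP bP iz_) _ (Eval_line Ckt aP bP iz_)) => i x ir.
by move/entry_nth <-; apply: Is_hybrid_nth hyb _.
Qed.

(** The encoder restricts P with [b], the decoder with the shorter tuple [c]. They agree before k,
    so both see the same univariate polynomial. *)
Lemma line_val_ext b c k z : (forall j, 1 <= j -> j < k -> exists z, [/\ Entry b j z, Entry c j z & Is_int z]) ->
  Is_int z -> line_val N D P a b k z = line_val N D P a c k z.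
Proof.
move=> bc iz_.
have bP j : 1 <= j -> j < k -> exists z, Entry b j z /\ Is_int z.
  by move=> j1 jk; have [y [yb yc iy]] := bc j j1 jk; exists y.
have cP j : 1 <= j -> j < k -> exists z, Entry c j z /\ Is_int z.
  by move=> j1 jk; have [y [yb yc iy]] := bc j j1 jk; exists y.
apply: (line_val_eq bP iz_ _ (Eval_line Ckt aP cP iz_)) => j jr.
have [y [ey [lt rest]]] := Is_hybrid_hybrid aP cP z jr; exists y; split=> //; split=> // jk.
by case: jr => j1 _; have [x [xb xc _]] := bc j j1 jk; have := lt jk => /entry_nth <-; rewrite (entry_nth xc).
Qed.

(** * The first switch *)

Section Encoding.

Variable b : M.
Hypotheses (bS : In_Sn N Q b) (na : ~ Eval P a 0) (b0 : Eval P b 0).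

Let bP j : In_range j (mlen N) -> exists z, Entry b j z /\ Is_int z.
Proof. by move=> /bS [z [zb /In_S_int iz_]]; exists z. Qed.

Let bPk k : In_range k (mlen N) -> forall j, 1 <= j -> j < k -> exists z, Entry b j z /\ Is_int z.
Proof. by move=> [_ kN] j j1 jk; apply: bP; split=> //; apply: lem_trans (ltm_leW jk) kN. Qed.

Local Notation line k := (line_val N D P a b k).

Lemma switch_testE j : ap f_switch_test [:: j; N; D; P; a; b] = line j (mnth b j).
Proof.
by rewrite /f_switch_test /line_val /mev /mhybrid /pnth; move: f_ev f_hybrid => F H; pvs.
Qed.

(** Without variables [a] and [b] agree vacuously, so P could not vanish at one of them only. *)
Lemma N_gt0 : 1 <= mlen N.
Proof.
apply/neq0_ge1 => N0; apply: na; have ev := mev_correct Ckt aP.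
rewrite -(Eval_uniq Ckt aP _ ev b0) // => i x [i1]; rewrite N0 => /lem0 i0.
by move: i1; rewrite i0 => /lem0 /S_neq0.
Qed.

Lemma line_first y : Entry a 1 y -> line 1 y <> 0.
Proof.
move=> ya L0; apply: na; have ir : In_range 1 (mlen N) by split; [apply: lem_refl | apply: N_gt0].
have iy : Is_int y by have [x [/entry_nth <- iy]] := aP ir; rewrite -(entry_nth ya).
have ev := mev_correct Ckt aP; have := line_val_eq (bPk ir) iy _ ev; rewrite L0 => -> // j jr.
have [x [xa _]] := aP jr; exists x; split=> //; split=> [lt|].
  by case: jr => j1 _; case: (@ltm_irr _ j); apply: lem_trans lt j1.
by split=> // E; move: ya; rewrite -E => /entry_nth <-; rewrite (entry_nth xa).
Qed.

(** The line at k + 1 starts where the line at k ends, at (b_1, ..., b_k, a_{k+1}, ..., a_n). *)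
Lemma line_next k y : In_range k (mlen N) -> k < mlen N -> Entry a k.+1 y -> line k.+1 y = line k (mnth b k).
Proof.
move=> kr kN ya; have kr' : In_range k.+1 (mlen N) by split=> //; apply/leSS/le0m.
have iy : Is_int y by have [x [/entry_nth <- iy]] := aP kr'; rewrite -(entry_nth ya).
have [z [zb iz_]] := bP kr; have ez := entry_nth zb.
apply: (line_val_eq (bPk kr') iy _ (Eval_line Ckt aP (bPk kr) _)); last by rewrite ez.
move=> j jr; have [x [ex [lt [eq gt]]]] := Is_hybrid_hybrid aP (bPk kr) (mnth b k) jr; exists x; split=> //.
split=> [/le_SS jk|].
  case: (leq_ltm k j) => [kj|]; last exact: lt.
  have E : j = k by apply: lem_anti.
  by rewrite (eq E) E ez.
split=> [E|/ltm_leW]; last exact: gt.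
have /entry_nth <- := gt (eq_ind_r (fun t => k < t) (lem_refl _) E).
by rewrite E (entry_nth ya).
Qed.

Lemma line_last : line (mlen N) (mnth b (mlen N)) = 0.
Proof.
have nr : In_range (mlen N) (mlen N) by split; [apply: N_gt0 | apply: lem_refl].
have [z [zb iz_]] := bP nr; rewrite (entry_nth zb).
apply: (line_val_eq (bPk nr) iz_ _ b0) => j jr; have [x [xb _]] := bP jr; exists x; split=> //.
split=> //; split=> [E|lt]; first by rewrite -(entry_nth zb) -E (entry_nth xb).
by case: (@ltm_irr _ j); case: jr => _ jN; apply: lem_trans (leSS jN) lt.
Qed.

Local Notation k := (mfind f_switch_test N [:: N; D; P; a; b] 1).

(** The least j with P(b_1, ..., b_j, a_{j+1}, ..., a_n) = 0 exists because j = n gives P(b). It is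
    a switch, since the value one step before is nonzero, or is P(a) at the start; an earlier switch
    would be an earlier zero. *)
Lemma switch_exists : [/\ In_range k (mlen N), Switch N P a b k &
  forall j, 1 <= j -> j < k -> ~ Switch N P a b j].
Proof.
have sz : size [:: N; D; P; a; b] = 5%N by [].
have [n0 En] : exists n0, mlen N = n0.+1.
  by exists (msub (mlen N) 1); rewrite msuccE addm_sub //; apply: N_gt0.
have c1 : 1 <= mcount f_switch_test N [:: N; D; P; a; b] (mlen N).
  have [||//] := @find_count M _ f_switch_test N _ sz n0; first by rewrite En; apply: lem_refl.
    by rewrite -En switch_testE line_last.
  by rewrite -En.
have [r [-> rN /le_SS cr _]] := findP sz (lem_refl 1) c1; rewrite switch_testE => z0.
have kr : In_range r.+1 (mlen N) by split=> //; apply/leSS/le0m.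
have nz j : 1 <= j -> j < r.+1 -> line j (mnth b j) <> 0.
  move=> j1 jr; have [i Ei] : exists i, j = i.+1 by exists (msub j 1); rewrite msuccE addm_sub.
  rewrite -switch_testE Ei => L0; have iN : i < mlen N by rewrite -Ei; apply: lem_trans (ltm_leW jr) rN.
  have [c1' _ _] := find_count sz iN L0; case: (@ltm_irr _ (0 : M)); apply: lem_trans c1' _.
  apply: lem_trans cr; apply: count_mono => //; last exact: ltm_leW.
  by rewrite -Ei; apply: le_SS.
split=> // [|j j1 jr [y [z [_ [/entry_nth zb [_ /Hybrid_zero_iff]]]]]]; last first.
  have jr' : In_range j (mlen N) by split=> //; apply: lem_trans (ltm_leW jr) rN.
  move=> /(_ D Ckt aP (bPk jr')) H; apply: (nz j j1 jr); rewrite zb; apply: H.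
  by have [x [/entry_nth <- ix]] := bP jr'; rewrite -zb.
have [y [ya iy]] := aP kr; have [z [zb iz_]] := bP kr; exists y, z; split=> //; split=> //.
have zero x : Is_int x -> Hybrid_zero N P b r.+1 x a <-> line r.+1 x = 0.
  by apply: (Hybrid_zero_iff Ckt aP (bPk kr)).
split; last by apply/zero => //; rewrite -(entry_nth zb).
move/(zero _ iy); case: (EM (r = 0)) => [E|/neq0_ge1 r1].
  by move: ya; rewrite E => /line_first.
have rr : In_range r (mlen N) by split=> //; apply: ltm_leW.
by rewrite (line_next rr rN ya); apply: nz => //; apply: lem_refl.
Qed.

End Encoding.

End Coding.

(** * Correctness of the encoder and the decoder *)

Section Specifications.

Local Open Scope m_scope.
Variable M : model.
Implicit Types (N D Q P x y z u v i j r m w a b c k : M).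

Definition enc_k N D P a b := mfind f_switch_test N [:: N; D; P; a; b] 1.
Definition enc_i N D Q P a b k := mcount f_root_test Q [:: N; D; P; a; b; k] (mhalf (mnth b k)).+1.

Lemma encE N D Q P a b : ap f_enc [:: N; D; Q; P; a; b] =
  let k := enc_k N D P a b in let i := enc_i N D Q P a b k in
  ap f_cond [:: mev N D P a; mtriple 1 1 0; ap f_cond [:: mev N D P b;
    if pselect (i <= mlen D) then mtriple k i (mdelete N k b) else mtriple 1 1 0; mtriple 1 1 0]].
Proof.
rewrite /f_enc /enc_k /enc_i /mev /mfind /mcount /mdelete /pnth /mnth.
move: f_ev f_delete f_nth (f_find f_switch_test) (f_count f_root_test) => F1 F2 F3 F4 F5 /=.
rewrite ap_pcond ap_pcond; pvs; congr (ap f_cond [:: _; _; ap f_cond [:: _; _; _]]); rewrite ?ap_ppair; pvs => //.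
case: pselect => le /=; last by rewrite ifle_lt; pvs => //; apply/ltm_nle.
by rewrite ifle_le; pvs.
Qed.

Lemma decE N D Q P a k i c : ap f_dec [:: N; D; Q; P; a; mtriple k i c] =
  let s := [:: N; D; P; a; c; k] in
  ap f_cond [:: mev N D P a; 0;
    if pselect (i <= mcount f_root_test Q s (mlen Q))
    then minsert N k (2 * msub (mfind f_root_test Q s i) 1) c else 0].
Proof.
have apf x y : ap f_fst [:: mpair x y] = x by exact: fst_pair.
have aps x y : ap f_snd [:: mpair x y] = y by exact: snd_pair.
rewrite /f_dec /mev /mfind /mcount /minsert /mtriple /pfst /psnd /psub /msub.
move: f_ev f_insert f_sub (f_find f_root_test) (f_count f_root_test) f_fst f_snd apf aps => F1 F2 F3 F4 F5 F6 F7 apf aps /=.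
rewrite ap_pcond; pvs; congr (ap f_cond [:: _; _; _]).
case: pselect => le /=; last by rewrite ifle_lt; pvs; rewrite ?(apf, aps) //; apply/ltm_nle.
by rewrite ifle_le; pvs; rewrite ?(apf, aps).
Qed.

Section Point.

Variables (N D Q P a : M).
Hypotheses (Ckt : In_Ckt N D P) (aP : In_Zn N a).

Lemma In_Sn_Zn b : In_Sn N Q b -> In_Zn N b.
Proof. by move=> bS j /bS [z [zb /In_S_int iz_]]; exists z. Qed.

Lemma In_Sn_before b k : In_Sn N Q b -> In_range k (mlen N) ->
  forall j, 1 <= j -> j < k -> exists z, Entry b j z /\ Is_int z.
Proof. by move=> /In_Sn_Zn bP [_ kN] j j1 jk; apply: bP; split=> //; apply: lem_trans (ltm_leW jk) kN. Qed.

Section Code.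

Variable b : M.
Hypotheses (bS : In_Sn N Q b) (na : ~ Eval P a 0) (b0 : Eval P b 0).

Local Notation k := (enc_k N D P a b).
Local Notation i := (enc_i N D Q P a b k).
Local Notation m := (mcount f_root_test Q [:: N; D; P; a; b; k] (mlen Q)).

(* The coordinate b_k is the i-th root of the restriction to the k-th line, and
   this root list has at most d elements since the restriction is not zero. *)
Lemma enc_position : exists r, [/\ Entry b k (2 * r), r < mlen Q, line_val N D P a b k (2 * r) = 0,
  i = mcount f_root_test Q [:: N; D; P; a; b; k] r.+1 &
  [/\ 1 <= i, i <= m, i <= mlen D & mfind f_root_test Q [:: N; D; P; a; b; k] i = r.+1]].
Proof.
have [kr [y [z [ya [zb [ny z0]]]]] _] := switch_exists Ckt aP bS na b0.
have bPk := In_Sn_before bS kr.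
have [x [/entry_nth ex [r [rQ Ex]]]] := bS kr; have nE := entry_nth zb.
have Ez : z = 2 * r by rewrite -nE ex.
rewrite Ez in zb z0 nE; have q0 : line_val N D P a b k (2 * r) = 0.
  by apply/(Hybrid_zero_iff Ckt aP bPk (@int_even _ r)).
have Ei : i = mcount f_root_test Q [:: N; D; P; a; b; k] r.+1 by rewrite /enc_i nE half_double.
have [i1 im fi] := find_count (erefl : size [:: N; D; P; a; b; k] = 6%N) rQ (etrans (root_testE _ _ _ _ _ _ _) q0).
exists r; split=> //; rewrite -Ei in i1 im fi; split=> //.
case: (leq_ltm i (mlen D)) => // Di; case: ny.
have iy : Is_int y by have [t [/entry_nth <- iy]] := aP kr; rewrite -(entry_nth ya).
apply/(Hybrid_zero_iff Ckt aP bPk iy).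
have [w [[_ [rts [mono _]]] _]] := Root_list_exists Q Ckt aP bPk.
(* |X| = d + 1, so the first d + 1 entries of the root list are the ones counted. *)
have [X XD] := LogS (Log_len D); have Xm j : j < mlen X -> j.+1 <= m.
  by rewrite -XD => jD; apply: lem_trans jD (lem_trans Di im).
apply: (line_root Ckt aP kr bPk (X := X) (Q := Q) (w := w)) => // [j jX|j jX].
  have [x' [/entry_nth -> [[t [tQ ->]] H]]] := rts j.+1 (conj (leSS (le0m j)) (Xm j jX)).
  by rewrite half_double; split=> //; apply/(Hybrid_zero_iff Ckt aP bPk (@int_even _ t)).
by have [u [v [/entry_nth -> [/entry_nth -> uv]]]] := mono j.+1 (leSS (le0m j)) (Xm _ jX).
Qed.

Lemma enc_main : ap f_enc [:: N; D; Q; P; a; b] = mtriple k i (mdelete N k b).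
Proof.
rewrite encE /= cond1; last by move/(Eval_mev Ckt aP).
have /(Eval_mev Ckt (In_Sn_Zn bS)) -> := b0; rewrite cond0.
by have [r [_ _ _ _ [_ _ iD _]]] := enc_position; case: pselect.
Qed.

Lemma delete_b : Is_delete N k b (mdelete N k b).
Proof. by apply: Is_delete_delete => j /bS [z [zb _]]; exists z. Qed.

Lemma In_C_enc : In_C N D Q (ap f_enc [:: N; D; Q; P; a; b]).
Proof.
rewrite enc_main; have [kr _ _] := switch_exists Ckt aP bS na b0.
have [r [_ _ _ _ [i1 _ iD _]]] := enc_position.
exists k, i, (mdelete N k b); do 3 split=> //; move=> j j1 jN.
have [y [yc [lt ge]]] := delete_b j1 jN; exists y; split=> //.
case: (leq_ltm k j) => [/ge yb|/lt yb]; rewrite -(entry_nth yb).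
  by have [z [/entry_nth -> ]] := bS (conj (leS j1) jN).
by have [z [/entry_nth -> ]] := bS (conj j1 (ltm_leW jN)).
Qed.

Lemma dec_enc : Tuple_eq (mlen N) (ap f_dec [:: N; D; Q; P; a; ap f_enc [:: N; D; Q; P; a; b]]) b.
Proof.
have [kr _ _] := switch_exists Ckt aP bS na b0; have [k1 kN] := kr.
have [r [rb rQ q0 Ei [i1 im _ fi]]] := enc_position.
rewrite enc_main decE /= cond1; last by move/(Eval_mev Ckt aP).
set c := mdelete N k b; have del : Is_delete N k b c := delete_b.
have bc j : 1 <= j -> j < k -> exists z, [/\ Entry b j z, Entry c j z & Is_int z].
  move=> j1 jk; have [z [zb iz_]] := In_Sn_before bS kr j1 jk; exists z; split=> //.
  by have [y [yc [/(_ jk) /entry_nth E _]]] := del j j1 (lem_trans jk kN); rewrite -(entry_nth zb) E.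
have sz x : size [:: N; D; P; a; x; k] = 6%N by [].
have tests j : ap f_root_test [:: j.+1; N; D; P; a; c; k] = ap f_root_test [:: j.+1; N; D; P; a; b; k].
  by rewrite !root_testE (line_val_ext Ckt aP bc) //; apply: int_even.
(* Equal tests give equal counts, so the root found from [c] is the one found from [b]. *)
have cnt : forall j, j <= mlen Q -> mcount f_root_test Q [:: N; D; P; a; c; k] j = mcount f_root_test Q [:: N; D; P; a; b; k] j.
  move: (k) sz tests => k' sz tests.
  apply: (@lind M [:: Q; N; D; P; a; b; k'; c]) => [||||j jQ IH]; [exact: Log_len | deft | by rewrite /mcount; def | |].
    by rewrite !count0.
  have [H1 H2] := countS f_root_test (sz b) jQ; have [H3 H4] := countS f_root_test (sz c) jQ.
  rewrite tests in H3 H4; case: (EM (ap f_root_test [:: j.+1; N; D; P; a; b; k'] = 0)) => E.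
    by rewrite H1 // H3 // IH.
  by rewrite H2 // H4.
have [_ _] := find_count (sz c) rQ (etrans (tests r) (etrans (root_testE _ _ _ _ _ _ _) q0)).
rewrite !cnt //; last exact: lem_refl.
rewrite -Ei => ->; case: pselect => [le /=|[]]; last exact: im.
rewrite msubS1.
move=> j jr; have cP l : 1 <= l -> l < mlen N -> exists y, Entry c l y.
  by move=> l1 lN; have [y [yc _]] := del l l1 lN; exists y.
have [y [ye [lt [eq gt]]]] := Is_insert_insert (2 * r) kr cP jr; exists y; split=> //.
have [j1 jN] := jr; have [z [zb _]] := bS jr.
case: (hybrid_cases k j) => [jk|[jk|kj]].
- have [x [xb xc _]] := bc j j1 jk.
  by have /entry_nth <- := lt jk; rewrite (entry_nth xc).
- by rewrite (eq jk) jk.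
have [l El] : exists l, j = l.+1 by exists (msub j 1); rewrite msuccE addm_sub.
have l1 : 1 <= l by apply: lem_trans k1 _; apply: le_SS; rewrite -El.
have lN : l < mlen N by rewrite -El.
have [x [xc [_ /(_ _) xb]]] := del l l1 lN.
have /entry_nth <- := gt l kj El; rewrite (entry_nth xc) El.
by apply: xb; apply: le_SS; rewrite -El.
Qed.

End Code.

End Point.

Lemma ev_correct : Ev_spec M f_ev.
Proof. by move=> N D P a Ckt aP; apply: mev_correct. Qed.

Lemma enc_correct : Enc_spec M f_enc.
Proof.
move=> N D Q P a b Ckt aP bS; case: (EM (~ Eval P a 0 /\ Eval P b 0)) => [[na b0]|H]; last first.
  left; split=> //; suff -> : ap f_enc [:: N; D; Q; P; a; b] = mtriple 1 1 0 by apply: Enc_default_triple.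
  rewrite encE /=; case: (EM (mev N D P a = 0)) => [->|na]; first by rewrite cond0.
  rewrite !cond1 // => b0; apply: H; split; first by move/(Eval_mev Ckt aP).
  by apply/(Eval_mev Ckt (In_Sn_Zn bS)).
right; split=> //; rewrite (enc_main Ckt aP bS na b0).
have [kr sw least] := switch_exists Ckt aP bS na b0.
have [r [rb _ _ _ [i1 im iD fi]]] := enc_position Ckt aP bS na b0.
exists (enc_k N D P a b); do 3 split=> //.
have [w [rts wE]] := Root_list_exists Q Ckt aP (In_Sn_before bS kr).
exists (mcount f_root_test Q [:: N; D; P; a; b; enc_k N D P a b] (mlen Q)), w, (2 * r).
exists (enc_i N D Q P a b (enc_k N D P a b)); do 3 split=> //.
split; first by have := wE _ (conj i1 im); rewrite fi msubS1.
by right; split=> //; exists (mdelete N (enc_k N D P a b) b); split=> //; apply: delete_b bS.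
Qed.

Lemma In_C_before N D Q k i c : In_C N D Q (mtriple k i c) ->
  [/\ In_range k (mlen N), In_range i (mlen D),
      forall j, 1 <= j -> j < mlen N -> exists z, Entry c j z /\ In_S Q z &
      forall j, 1 <= j -> j < k -> exists z, Entry c j z /\ Is_int z].
Proof.
move=> [k' [i' [c' [/mpair_inj [<- /mpair_inj [<- <-]] [kr [ir cS]]]]]]; split=> // j j1 jk.
have [z [zc /In_S_int iz_]] := cS j j1 (lem_trans jk (proj2 kr)); by exists z.
Qed.

Lemma dec_correct : Dec_spec M f_dec.
Proof.
move=> N D Q P a k i c Ckt aP /In_C_before [kr ir cS cPk]; rewrite decE /=.
case: (EM (mev N D P a = 0)) => [/[dup] /(Eval_mev Ckt aP) a0 ->|na].
  by left; rewrite cond0; split=> //; apply: Is_zero_tuple0.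
right; rewrite cond1 //; split; first by move/(Eval_mev Ckt aP).
have [w [rts wE]] := Root_list_exists Q Ckt aP cPk.
exists (mcount f_root_test Q [:: N; D; P; a; c; k] (mlen Q)), w; split=> //; case: pselect => [im|/ltm_nle mi] /=.
  right; split=> //; exists (2 * msub (mfind f_root_test Q [:: N; D; P; a; c; k] i) 1); split.
    by apply: wE; split=> //; case: ir.
  by apply: Is_insert_insert => // j j1 jN; have [z [zc _]] := cS j j1 jN; exists z.
by left; split=> //; apply: Is_zero_tuple0.
Qed.

Lemma In_Sn_dec N D Q P a x : In_Ckt N D P -> In_Zn N a -> In_C N D Q x -> 1 <= mlen Q ->
  In_Sn N Q (ap f_dec [:: N; D; Q; P; a; x]).
Proof.
move=> Ckt aP xC Q1; have [k [i [c [Ex [kr [[i1 _] cS]]]]]] := xC; rewrite Ex in xC *.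
(* The zero tuple is the default output, and it lies in S_q^n because q >= 1. *)
have S0 : In_S Q 0 by exists 0; rewrite mmulx0.
case: (dec_correct Ckt aP xC) => [[_ z0]|[_ [m [w [[_ [rts _]] [[_ z0]|[im [r [rw ins]]]]]]]]] j jr.
- by exists 0; split=> //; apply: z0.
- by exists 0; split=> //; apply: z0.
have rS : In_S Q r by have [z [/entry_nth <- [zS _]]] := rts i (conj i1 im); rewrite -(entry_nth rw).
have [y [ey [lt [eq gt]]]] := ins j jr; exists y; split=> //; have [j1 jN] := jr.
case: (hybrid_cases k j) => [jk|[/eq -> //|kj]].
  have [z [/entry_nth <- ]] := cS j j1 (lem_trans jk (proj2 kr)); by rewrite (entry_nth (lt jk)).
have [l El] : exists l, j = l.+1 by exists (msub j 1); rewrite msuccE addm_sub.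
have l1 : 1 <= l by apply: lem_trans (proj1 kr) _; apply: le_SS; rewrite -El.
have [|z [/entry_nth <- ]] := cS l l1; first by rewrite -El.
by rewrite (entry_nth (gt l kj El)).
Qed.

Lemma schwartz_zippel_correct : Schwartz_zippel M f_enc f_dec.
Proof.
move=> N D Q P Ckt; case: (EM (forall a, In_Zn N a -> Eval P a 0)) => [|_]; [by left | right].
move=> a aP na; split; first by move=> x; apply: In_Sn_dec.
split=> b [bS b0]; last by split; [apply: In_C_enc | apply: dec_enc].
by exists (ap f_enc [:: N; D; Q; P; a; b]); split; [apply: In_C_enc | apply: dec_enc].
Qed.

End Specifications.

Theorem theorem3p6 :
  exists (ev : pv 4) (enc dec : pv 6),
    [/\ S12_proves (ev_spec ev),
        S12_proves (enc_spec enc),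
        S12_proves (dec_spec dec) &
        S12_proves (schwartz_zippel enc dec)].
Proof.
exists f_ev, f_enc, f_dec; split.
- exact: S12_complete (fun M r => FD_spec_ev r f_ev) ev_correct.
- exact: S12_complete (fun M r => FD_spec_enc r f_enc) enc_correct.
- exact: S12_complete (fun M r => FD_spec_dec r f_dec) dec_correct.
- exact: S12_complete (fun M r => FD_spec_sz r f_enc f_dec) schwartz_zippel_correct.
Qed.
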